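(* Let $(X,\sigma)$ and $(Y,\tau)$ be Deaconu–Renault systems and let $h:X\to Y$ be a homeomorphism. Then the following are equivalent: (1) there is an eventual conjugacy from $(X,\sigma)$ to $(Y,\tau)$ with underlying homeomorphism $h$; (2) there is an isomorphism of topological groupoids $\Theta:G(X,\sigma)\to G(Y,\tau)$ such that $\Theta|_X=h$ and $c_X=c_Y\circ\Theta$; (3) there is an isomorphism $\phi:C^*(G(X,\sigma))\to C^*(G(Y,\tau))$ such that $\phi(C_0(X))=C_0(Y)$, with $\phi(f)=f\circ h^{-1}$ for $f\in C_0(X)$, and $\phi\circ\gamma^X_z=\gamma^Y_z\circ\phi$ for all $z\in\mathbb{T}$.
   Context: $\mathbb{N}$ includes $0$. A Deaconu–Renault system $(X,\sigma)$ is a locally compact Hausdorff space $X$ with a (surjective) local homeomorphism $\sigma:\operatorname{dom}(\sigma)\to\operatorname{ran}(\sigma)$ between open subsets of $X$; $\sigma^0=\mathrm{id}_X$, $D_n=\operatorname{dom}(\sigma^n)=\sigma^{-1}(\operatorname{dom}(\sigma^{n-1}))$. Equations involving powers of $\sigma$ include the assertion that the points lie in the relevant domains. $\operatorname{Stab}(x)=\{m-n:m,n\in\mathbb{N},x\in D_m\cap D_n,\sigma^n(x)=\sigma^m(x)\}\subseteq\mathbb{Z}$, $\operatorname{Stab}_{\min}(x)=\min\{n\in\operatorname{Stab}(x):n\ge1\}$, with $\min\emptyset=\infty$. $G(X,\sigma)=\bigcup_{n,m\in\mathbb{N}}\{(x,n-m,y)\in D_n\times\{n-m\}\times D_m:\sigma^n(x)=\sigma^m(y)\}$,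 with $r(x,p,y)=x$, $s(x,p,y)=y$, $(x,p,y)(y,q,z)=(x,p+q,z)$, $(x,p,y)^{-1}=(y,-p,x)$, and topology with basic open sets $Z(U,n,m,V)=\{(x,n-m,y):x\in U,y\in V,\sigma^n(x)=\sigma^m(y)\}$ for $U\subseteq D_n,V\subseteq D_m$ open with $\sigma^n|_U,\sigma^m|_V$ homeomorphisms onto their images. It is a locally compact Hausdorff étale amenable groupoid with unit space $\{(x,0,x)\}$ identified with $X$. The cocycle $c_X:G(X,\sigma)\to\mathbb{Z}$ is $c_X(x,n,y)=n$, and $\gamma^X:\mathbb{T}\to\operatorname{Aut}(C^*(G(X,\sigma)))$ is the action with $\gamma^X_z(f)(x,n,x')=z^nf(x,n,x')$ for $f\in C_c(G(X,\sigma))$. A continuous orbit equivalence $(h,l,k,l',k')$ from $(X,\sigma)$ to $(Y,\tau)$, with underlying homeomorphism $h$, consists of a homeomorphism $h:X\to Y$ and continuous $k,l:\operatorname{dom}(\sigma)\to\mathbb{N}$, $k',l':\operatorname{dom}(\tau)\to\mathbb{N}$ with $\tau^{l(x)}(h(x))=\tau^{k(x)}(h(\sigma(x)))$ and $\sigma^{l'(y)}(h^{-1}(y))=\sigma^{k'(y)}(h^{-1}(\tau(y)))$ for all $x\in\operatorname{dom}(\sigma)$, $y\in\operatorname{dom}(\tau)$. It preserves stabilisers if $\operatorname{Stab}_{\min}(h(x))<\infty\iff\operatorname{Stab}_{\min}(x)<\infty$ for all $x\in X$, $\big|\sum_{n=0}^{\operatorname{Stab}_{\min}(x)-1}(l(\sigma^n(x))-k(\sigma^n(x)))\big|=\operatorname{Stab}_{\min}(h(x))$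 whenever $\operatorname{Stab}(x)$ is nontrivial and $\sigma^{\operatorname{Stab}_{\min}(x)}(x)=x$, and $\big|\sum_{n=0}^{\operatorname{Stab}_{\min}(y)-1}(l'(\tau^n(y))-k'(\tau^n(y)))\big|=\operatorname{Stab}_{\min}(h^{-1}(y))$ whenever $\operatorname{Stab}(y)$ is nontrivial and $\tau^{\operatorname{Stab}_{\min}(y)}(y)=y$. An eventual conjugacy is a stabiliser-preserving continuous orbit equivalence $(h,l,k,l',k')$ such that $l(x)=k(x)+1$ for all $x\in\operatorname{dom}(\sigma)$. *)

(* Defs.v *)
From HB Require Import structures.
From mathcomp Require Export all_boot all_order all_algebra.
From mathcomp Require Export all_classical all_reals all_analysis.
From mathcomp Require Export complex.
From mathcomp Require Import zify.

Set Implicit Arguments.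
Unset Strict Implicit.
Unset Printing Implicit Defensive.

Export Order.TTheory GRing.Theory Num.Theory.
Export numFieldNormedType.Exports.

#[global] Open Scope classical_set_scope.
#[global] Open Scope ring_scope.

(* R[i] seen as a numClosedFieldType, so that it receives the topology and the
   norm of a numFieldType.  The order is the partial one: 0 < e means that e is
   a positive real, and `|z| is a nonnegative real seen in Cplx R. *)
Definition Cplx (R : realType) : numClosedFieldType := R[i]%C.

Definition homeomorphism (T T' : topologicalType) (f : T -> T') (g : T' -> T) :
  Prop := [/\ cancel f g, cancel g f, continuous f & continuous g].

Definition homeo_onto_image (T : topologicalType) (U : set T) (f : T -> T) :
  Prop :=
  {within U, continuous f} /\
  exists2 g : T -> T, {in U, cancel f g} & {within f @` U, continuous g}.

(* The partial map sigma is encoded by a total function whose values outside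
   [dr_dom] are never used; its range is [dr_sigma @` dr_dom]. *)
Record DRsystem := {
  dr_space :> topologicalType;
  dr_dom : set dr_space;
  dr_sigma : dr_space -> dr_space;
  dr_hausdorff : hausdorff_space dr_space;
  dr_locally_compact : locally_compact [set: dr_space];
  dr_open_dom : open dr_dom;
  dr_open_ran : open (dr_sigma @` dr_dom);
  dr_local_homeo : forall x, dr_dom x -> exists U : set dr_space,
    [/\ open U, U x, U `<=` dr_dom, open (dr_sigma @` U)
      & homeo_onto_image U dr_sigma] }.

Section DRdefs.
Variable S : DRsystem.
Local Notation sigma := (@dr_sigma S).

Fixpoint dr_domn (n : nat) : set S :=
  if n is m.+1 then [set x | dr_dom x /\ dr_domn m (sigma x)] else setT.

Definition dr_iter (n : nat) (x : S) : S := iter n sigma x.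

(* sigma^n(x) = sigma^m(y), including that x and y are in the domains. *)
Definition eq_iter (n : nat) (x : S) (m : nat) (y : S) : Prop :=
  [/\ dr_domn n x, dr_domn m y & dr_iter n x = dr_iter m y].

Definition Stab (x : S) : set int :=
  [set p | exists m n : nat, p = m%:Z - n%:Z /\ eq_iter n x m x].

(* None stands for infinity. *)
Definition Stab_min (x : S) : option nat :=
  match pselect (exists n, `[< (1 <= n)%N /\ Stab x n%:Z >]) with
  | left e => Some (ex_minn e)
  | right _ => None
  end.

End DRdefs.

Section OrbitEquivalence.
Variables X Y : DRsystem.

Record coe (h : X -> Y) (hinv : Y -> X) (l k : X -> nat) (l' k' : Y -> nat) :
  Prop := {
  coe_homeo : homeomorphism h hinv;
  coe_l : {within @dr_dom X, continuous l};
  coe_k : {within @dr_dom X, continuous k};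
  coe_l' : {within @dr_dom Y, continuous l'};
  coe_k' : {within @dr_dom Y, continuous k'};
  coe_eq : forall x, dr_dom x ->
    eq_iter (l x) (h x) (k x) (h (dr_sigma x));
  coe_eq' : forall y, dr_dom y ->
    eq_iter (l' y) (hinv y) (k' y) (hinv (dr_sigma y)) }.

End OrbitEquivalence.

Definition cocycle_sum (S : DRsystem) (l k : S -> nat) (x : S) (p : nat) : int :=
  \sum_(n < p) ((l (dr_iter n x))%:Z - (k (dr_iter n x))%:Z).

Section EventualConjugacy.
Variables X Y : DRsystem.

Record preserves_stabilisers (h : X -> Y) (hinv : Y -> X) (l k : X -> nat)
    (l' k' : Y -> nat) : Prop := {
  ps_finite : forall x : X, Stab_min (h x) <> None <-> Stab_min x <> None;
  ps_l : forall (x : X) (p : nat), Stab x <> [set 0] -> Stab_min x = Some p ->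
    eq_iter p x 0 x -> Stab_min (h x) = Some `|cocycle_sum l k x p|%N;
  ps_l' : forall (y : Y) (p : nat), Stab y <> [set 0] -> Stab_min y = Some p ->
    eq_iter p y 0 y -> Stab_min (hinv y) = Some `|cocycle_sum l' k' y p|%N }.

Definition eventual_conjugacy (h : X -> Y) (hinv : Y -> X) (l k : X -> nat)
    (l' k' : Y -> nat) : Prop :=
  [/\ coe h hinv l k l' k', preserves_stabilisers h hinv l k l' k'
    & forall x, dr_dom x -> l x = (k x + 1)%N].

End EventualConjugacy.

Record DRgroupoid (S : DRsystem) := DRArrow {
  rng : S;
  coc : int;
  src : S;
  arrowP : exists n m : nat, coc = n%:Z - m%:Z /\ eq_iter n rng m src }.

HB.instance Definition _ (S : DRsystem) := gen_eqMixin (DRgroupoid S).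
HB.instance Definition _ (S : DRsystem) := gen_choiceMixin (DRgroupoid S).

Definition basic_index (S : DRsystem) : Type :=
  (set S * nat * nat * set S)%type.
HB.instance Definition _ (S : DRsystem) := Pointed.on (basic_index S).

Definition basic_dom (S : DRsystem) : set (basic_index S) :=
  [set i | let: (U, n, m, V) := i in
    [/\ open U /\ open V, U `<=` @dr_domn S n, V `<=` @dr_domn S m,
        homeo_onto_image U (@dr_iter S n) & homeo_onto_image V (@dr_iter S m)]].

Definition basic_Z (S : DRsystem) (i : basic_index S) : set (DRgroupoid S) :=
  let: (U, n, m, V) := i in
  [set g | [/\ coc g = n%:Z - m%:Z, U (rng g), V (src g)
             & dr_iter n (rng g) = dr_iter m (src g)]].

(* The sets Z(U, n, m, V) are closed under finite intersections up to
   refinement, so the topology they generate has them as a basis. *)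
HB.instance Definition _ (S : DRsystem) :=
  @isSubBaseTopological.Build (DRgroupoid S)
    (basic_index S) (@basic_dom S) (@basic_Z S).

Section GroupoidOps.
Variable S : DRsystem.

Lemma dr_domnD n m (x : S) :
  dr_domn (m + n) x <-> dr_domn n x /\ dr_domn m (dr_iter n x).
Proof.
elim: n m x => [|n IHn] m x; first by rewrite addn0; split=> [|[]].
rewrite addnS /= IHn /dr_iter -iterSr iterS.
by split=> [[? [? ?]]|[[? ?] ?]].
Qed.

Lemma eq_iterD k n (x : S) m y :
  eq_iter n x m y -> dr_domn k (dr_iter n x) ->
  eq_iter (k + n) x (k + m) y.
Proof.
move=> [Dx Dy e] Dk; split; [exact/dr_domnD|by apply/dr_domnD; rewrite -e|].
by rewrite /dr_iter !iterD -/(dr_iter n x) -/(dr_iter m y) e.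
Qed.

Lemma eq_iter_trans n (x : S) m y k l z :
  eq_iter n x m y -> eq_iter k y l z ->
  exists n' l' : nat, n'%:Z - l'%:Z = (n%:Z - m%:Z) + (k%:Z - l%:Z) /\
    eq_iter n' x l' z.
Proof.
move=> exy eyz.
have [Dx Dy e] := exy; have [Dy' Dz e'] := eyz.
have [lemk|/ltnW lekm] := leqP m k.
  exists (k - m + n)%N, l; split; first lia.
  have Dk : dr_domn (k - m) (dr_iter m y).
    by have /dr_domnD[] : dr_domn (k - m + m) y by rewrite subnK.
  have [? _ E] := eq_iterD (k := k - m) exy ltac:(by rewrite e).
  by split=> //; rewrite E subnK.
exists n, (m - k + l)%N; split; first lia.
have Dk : dr_domn (m - k) (dr_iter k y).
  by have /dr_domnD[] : dr_domn (m - k + k) y by rewrite subnK.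
have [_ ? E] := eq_iterD (k := m - k) eyz Dk.
by split=> //; rewrite e -E subnK.
Qed.

Lemma gmul_subproof (a b : DRgroupoid S) : src a = rng b ->
  exists n m : nat, coc a + coc b = n%:Z - m%:Z /\ eq_iter n (rng a) m (src b).
Proof.
move=> ab; have [n [m [-> exy]]] := arrowP a.
have [k [l [-> eyz]]] := arrowP b; rewrite -ab in eyz.
by have [n' [l' [<- ?]]] := eq_iter_trans exy eyz; exists n', l'.
Qed.

Lemma ginv_subproof (a : DRgroupoid S) :
  exists n m : nat, - coc a = n%:Z - m%:Z /\ eq_iter n (src a) m (rng a).
Proof.
have [n [m [-> [Dx Dy e]]]] := arrowP a; exists m, n.
by rewrite opprB; split.
Qed.

Lemma unit_subproof (x : S) :
  exists n m : nat, 0 = n%:Z - m%:Z :> int /\ eq_iter n x m x.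
Proof. by exists 0%N, 0%N. Qed.

(* Only meaningful on composable pairs, i.e. when src a = rng b. *)
Definition gmul (a b : DRgroupoid S) : DRgroupoid S :=
  match pselect (src a = rng b) with
  | left e => DRArrow (gmul_subproof e)
  | right _ => a
  end.

Definition ginv (a : DRgroupoid S) : DRgroupoid S := DRArrow (ginv_subproof a).

Definition gunit (x : S) : DRgroupoid S := DRArrow (unit_subproof x).

End GroupoidOps.

Definition groupoid_iso (X Y : DRsystem) (Theta : DRgroupoid X -> DRgroupoid Y) :
  Prop :=
  [/\ exists Theta' : DRgroupoid Y -> DRgroupoid X, homeomorphism Theta Theta',
      forall a b, src a = rng b <-> src (Theta a) = rng (Theta b)
    & forall a b, src a = rng b ->
        Theta (gmul a b) = gmul (Theta a) (Theta b)].

(* Not necessarily unital, hence not built on a ring structure. *)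
Record cstarAlgebra (R : realType) := {
  cs_carrier :> completeNormedModType (Cplx R);
  cs_mul : cs_carrier -> cs_carrier -> cs_carrier;
  cs_star : cs_carrier -> cs_carrier;
  cs_mulA : associative cs_mul;
  cs_mulDl : left_distributive cs_mul +%R;
  cs_mulDr : right_distributive cs_mul +%R;
  cs_scaleAl : forall z a b, cs_mul (z *: a) b = z *: cs_mul a b;
  cs_scaleAr : forall z a b, cs_mul a (z *: b) = z *: cs_mul a b;
  cs_norm_mul : forall a b, `|cs_mul a b| <= `|a| * `|b|;
  cs_starK : involutive cs_star;
  cs_starD : {morph cs_star : a b / a + b};
  cs_starZ : forall z a, cs_star (z *: a) = Num.conj z *: cs_star a;
  cs_starM : forall a b, cs_star (cs_mul a b) = cs_mul (cs_star b) (cs_star a);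
  cs_cstar : forall a, `|cs_mul (cs_star a) a| = `|a| ^+ 2 }.

Record cstar_iso (R : realType) (A B : cstarAlgebra R) (phi : A -> B) : Prop := {
  ci_linear : linear phi;
  ci_mul : forall a b, phi (cs_mul a b) = cs_mul (phi a) (phi b);
  ci_star : forall a, phi (cs_star a) = cs_star (phi a);
  ci_bij : bijective phi }.

Record hilbertSpace (R : realType) := {
  hs_carrier :> completeNormedModType (Cplx R);
  hs_inner : hs_carrier -> hs_carrier -> Cplx R;
  hs_innerDl : forall z u v w,
    hs_inner (z *: u + v) w = z * hs_inner u w + hs_inner v w;
  hs_innerC : forall u v, hs_inner v u = Num.conj (hs_inner u v);
  hs_norm : forall u, hs_inner u u = `|u| ^+ 2 }.

Definition op_norm (R : realType) (H : hilbertSpace R) (T : H -> H) : \bar R :=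
  ereal_sup [set (complex.Re `|T v|)%:E | v in [set v : H | `|v| <= 1]].

Section FunctionSpaces.
Variables (R : realType) (T : topologicalType).

Definition Cc (f : T -> Cplx R) : Prop :=
  continuous f /\ compact (closure [set t | f t != 0]).

Definition C0 (f : T -> Cplx R) : Prop :=
  continuous f /\ forall e : Cplx R, 0 < e -> compact [set t | e <= `|f t|].

End FunctionSpaces.

Section GroupoidCstar.
Variables (R : realType) (S : DRsystem).
Local Notation G := (DRgroupoid S).
Local Notation C := (Cplx R).
Implicit Types f g : G -> C.

(* For f, g in C_c(G) only finitely many terms are nonzero. *)
Definition conv f g : G -> C := fun c =>
  \sum_(p \in [set p : G * G | src p.1 = rng p.2 /\ gmul p.1 p.2 = c])
    f p.1 * g p.2.

Definition invol f : G -> C := fun c => Num.conj (f (ginv c)).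

(* *-representations of C_c(G) by bounded operators on H; the values of pi
   outside C_c(G) are irrelevant. *)
Record Cc_rep (H : hilbertSpace R) (pi : (G -> C) -> H -> H) : Prop := {
  rep_bounded : forall f, Cc f -> linear (pi f) /\ continuous (pi f);
  rep_linear : forall (z : C) f g v, Cc f -> Cc g ->
    pi (fun c => z * f c + g c) v = z *: pi f v + pi g v;
  rep_mul : forall f g v, Cc f -> Cc g -> pi (conv f g) v = pi f (pi g v);
  rep_star : forall f v w, Cc f ->
    hs_inner (pi f v) w = hs_inner v (pi (invol f) w) }.

Definition full_norm f : \bar R :=
  ereal_sup [set a | exists (H : hilbertSpace R) (pi : (G -> C) -> H -> H),
                       Cc_rep pi /\ a = op_norm (pi f)].

(* (A, iota) is the completion of the *-algebra C_c(G) in the full norm, which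
   determines it up to a unique isomorphism compatible with iota; the values of
   iota outside C_c(G) are irrelevant. *)
Record groupoid_cstar (A : cstarAlgebra R) (iota : (G -> C) -> A) : Prop := {
  gc_linear : forall (z : C) f g, Cc f -> Cc g ->
    iota (fun c => z * f c + g c) = z *: iota f + iota g;
  gc_mul : forall f g, Cc f -> Cc g ->
    iota (conv f g) = cs_mul (iota f) (iota g);
  gc_star : forall f, Cc f -> iota (invol f) = cs_star (iota f);
  gc_norm : forall f, Cc f -> (complex.Re `|iota f|)%:E = full_norm f;
  gc_dense : closure [set iota f | f in @Cc R G] = [set: A] }.

Variables (A : cstarAlgebra R) (iota : (G -> C) -> A).

Definition gauge_action (gam : C -> A -> A) : Prop :=
  [/\ forall z, `|z| = 1 -> cstar_iso (gam z),
      forall z w a, `|z| = 1 -> `|w| = 1 -> gam (z * w) a = gam z (gam w a)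
    & forall z f, `|z| = 1 -> Cc f ->
        gam z (iota f) = iota (fun c => z ^ coc c * f c)].

Definition ext0 (f : S -> C) : G -> C := fun c =>
  if `[< exists x, c = gunit x >] then f (rng c) else 0.

(* The inclusion of C_0(S) in A, given by its graph: the continuous extension
   of f |-> iota (ext0 f) from C_c(S) (sup norm) to C_0(S), i.e. the closure of
   the graph of the latter. *)
Definition C0_elt (f : S -> C) (a : A) : Prop :=
  C0 f /\ forall e : C, 0 < e -> exists f' : S -> C,
    [/\ Cc f', forall x, `|f x - f' x| <= e & `|a - iota (ext0 f')| <= e].

Definition C0_subalgebra : set A := [set a | exists f : S -> C, C0_elt f a].

End GroupoidCstar.

(* Main.v *)
(* Both (1) and (2) amount to the existence of a homeomorphism Theta of the
   groupoids that sends (x, p, y) to (h x, p, h y).  From an eventual conjugacy,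
   such a Theta exists because the arrow (x, 1, sigma x) goes to an arrow
   (h x, 1, h (sigma x)); conversely k x is the least k with
   tau^(k+1) (h x) = tau^k (h (sigma x)).

   (2) => (3): composing with the inverse of Theta maps C_c(G_X) onto C_c(G_Y)
   as *-algebras, and it is isometric by the universality of the C*-norms.

   (3) => (2): let delta_y be the point mass at the unit y.  The map
   b |-> b delta_y from C*(G_Y) to l2(G_Y) extends the restriction of f in C_c(G_Y)
   to the source fibre over y.  If f is supported in a bisection and
   b = phi(f), then b* b lies in C_0(Y), so that the norm of b delta_(h x) is
   |f g| for the arrow g of the bisection with source x.  If it is nonzero, then
   b delta_(h x) is nonzero at some arrow g'.  The gauge actions give g' the
   cocycle value of g, and multiplication by elements of C_0(X) gives it the
   range h (rng g).  So g' is determined by g, and g |-> g' is continuous because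
   b is close to some f' in C_c(G_Y), which does not vanish on the image of a
   neighbourhood of g: near g, the images stay in the compact support of f'.

   Isomorphisms of C*-algebras are only assumed to be algebraic.  They are
   contractive because a self-adjoint a of small norm is the average of the
   formal unitary a + i sqrt (1 - a^2) and its adjoint. *)
From HB Require Import structures.
From mathcomp Require Import finmap.
Require Import Defs.
From mathcomp Require Import summability.
From mathcomp Require Import zify ring lra.
Set Implicit Arguments.
Unset Strict Implicit.
Unset Printing Implicit Defensive.

(** An arrow is determined by its range, cocycle value and source. Hence a map that respects all
    three is automatically multiplicative, and two such maps over [h] and [hinv] are mutually
    inverse; only continuity costs work. For continuity, the exponents behind a cocycle value must
    be kept uniform on a neighbourhood. In (1) => (2) the obstacle is the inverse. The relation
    between [l] and [k] makes the forward map preserve the cocycle, but [l'] and [k'] are not tied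
    in this way: the arrow from [hinv y] to the image under [hinv] of the next point of the orbit
    has the right cocycle value only up to the stabiliser of [y]. Preservation of stabilisers turns
    this ambiguity into an element of the stabiliser of [hinv y], where it can be removed. In (3) =>
    (2) the algebras are known only through their universal norm. The regular representation is one
    of those counted in that norm, so the vectors b delta_y make sense for every b in the
    completion. Isotropy could leave several arrows with the same range and source; the gauge action
    separates them. *)

Arguments dr_iter : simpl never.
#[local] Existing Instance totally_filter.

(** * The topology of the groupoid *)

Section LocalHomeomorphism.
Variable S : DRsystem.
Local Notation sigma := (@dr_sigma S).
Implicit Types (x y u v : S) (n m : nat).

Lemma dr_iterS n x : dr_iter n.+1 x = dr_iter n (sigma x).
Proof. by rewrite /dr_iter iterSr. Qed.

Lemma dr_iterD n m x : dr_iter (n + m) x = dr_iter n (dr_iter m x).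
Proof. by rewrite /dr_iter iterD. Qed.

Lemma dr_domn_le n m x : (m <= n)%N -> dr_domn n x -> dr_domn m x.
Proof. by move=> mn; rewrite -(subnK mn) dr_domnD => -[]. Qed.

Lemma sigma_continuous x : dr_dom x -> {for x, continuous sigma}.
Proof.
move=> /dr_local_homeo[U [oU Ux _ _ [cU _]]].
by move: cU; rewrite continuous_open_subspace//; apply; rewrite inE.
Qed.

Lemma sigma_open x (W : set S) : dr_dom x -> nbhs x W ->
  nbhs (sigma x) (sigma @` W).
Proof.
move=> /dr_local_homeo[U [oU Ux _ oV [_ [g gK cg]]]] xW.
have gx : g (sigma x) = x by rewrite gK ?inE.
have : {for sigma x, continuous g}.
  move: cg; rewrite continuous_open_subspace//; apply.
  by rewrite inE; exists x.
rewrite /prop_for /continuous_at gx => /(_ _ xW) gW.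
have nV : nbhs (sigma x) (sigma @` U) by apply: open_nbhs_nbhs; split => //; exists x.
have {}gW : nbhs (sigma x) (g @^-1` W) := gW.
apply: filterS2 gW nV => v /= + [u Uu uv].
by rewrite -uv gK ?inE// => Wu; exists u.
Qed.

Lemma sigma_injective x : dr_dom x ->
  exists2 W, nbhs x W & forall u v, W u -> W v -> sigma u = sigma v -> u = v.
Proof.
move=> /dr_local_homeo[U [oU Ux _ oV [_ [g gK cg]]]].
exists U; first exact: open_nbhs_nbhs.
by move=> u v Uu Uv e; rewrite -(gK u) ?inE// e gK ?inE.
Qed.

Lemma near_domn n x : dr_domn n x -> \forall u \near x, dr_domn n u.
Proof.
elim: n x => [|n IHn] x /=; first by move=> _; exact: filterT.
move=> [Dx Dn]; apply: filterI.
  by apply: open_nbhs_nbhs; split => //; exact: dr_open_dom.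
exact: (sigma_continuous Dx) (IHn _ Dn).
Qed.

Lemma dr_iter_continuous n x : dr_domn n x -> {for x, continuous (@dr_iter S n)}.
Proof.
elim: n x => [|n IHn] x /=; first by move=> _; exact: cvg_id.
move=> [Dx Dn]; rewrite (_ : @dr_iter S n.+1 = @dr_iter S n \o sigma).
  by apply: continuous_comp; [exact: sigma_continuous | exact: IHn].
by apply/funext => u; rewrite dr_iterS.
Qed.

Lemma dr_iter_open n x (W : set S) : dr_domn n x -> nbhs x W ->
  nbhs (dr_iter n x) (@dr_iter S n @` W).
Proof.
elim: n x W => [|n IHn] x W /=.
  by move=> _; apply: filterS => u Wu; exists u.
move=> [Dx Dn] /(sigma_open Dx)/(IHn _ _ Dn); rewrite dr_iterS.
by apply: filterS => v [_ [u Wu <-] <-]; exists u => //; rewrite dr_iterS.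
Qed.

Lemma dr_iter_injective n x : dr_domn n x ->
  exists2 W, nbhs x W &
    forall u v, W u -> W v -> dr_iter n u = dr_iter n v -> u = v.
Proof.
elim: n x => [|n IHn] x /=; first by exists setT => //; exact: filterT.
move=> [Dx Dn]; have [W nW iW] := IHn _ Dn; have [W' nW' iW'] := sigma_injective Dx.
exists (W' `&` sigma @^-1` W).
  by apply: filterI => //; exact: (sigma_continuous Dx).
by move=> u v [Wu Wu'] [Wv Wv']; rewrite !dr_iterS => /iW -/(_ Wu' Wv'); exact: iW'.
Qed.

(** These are the sets allowed as [U] and [V] in a basic open set. The local inverse [g] is
    continuous because [dr_iter n] is open. *)
Lemma dr_iter_chart n x (O : set S) : dr_domn n x -> nbhs x O ->
  exists U : set S, [/\ open U, U x, U `<=` O, U `<=` dr_domn n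
    & homeo_onto_image U (@dr_iter S n)].
Proof.
move=> Dx nO; have [W nW iW] := dr_iter_injective Dx.
have : nbhs x (W `&` O `&` dr_domn n).
  by apply: filterI; [exact: filterI | exact: near_domn].
rewrite nbhsE => -[U [oU Ux] sU].
have UD : U `<=` dr_domn n by move=> u /sU[].
exists U; split => //; first by move=> u /sU[[]].
split.
  rewrite continuous_open_subspace// => u; rewrite inE => Uu.
  exact: dr_iter_continuous (UD _ Uu).
pose g v := xget x [set u | U u /\ dr_iter n u = v].
have gK u : U u -> g (dr_iter n u) = u.
  rewrite /g => Uu; case: xgetP => [w _ [/= Uw e]|/(_ u)[]//].
  by apply: iW => //; [case: (sU _ Uw) => -[] | case: (sU _ Uu) => -[]].
exists g; first by move=> u; rewrite inE; exact: gK.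
rewrite continuous_open_subspace; last first.
  rewrite openE => _ [u Uu <-]; apply: dr_iter_open; first exact: UD.
  exact: open_nbhs_nbhs.
move=> v; rewrite inE => -[u Uu <-] A; rewrite gK// => nA.
have := @dr_iter_open n u (A `&` U) (UD _ Uu).
have nAU : nbhs u (A `&` U) by apply: filterI => //; exact: open_nbhs_nbhs.
move=> /(_ nAU); rewrite nbhs_filterE; apply: filterS => _ [w [Aw Uw] <-] /=.
by rewrite gK.
Qed.

Lemma eq_iterC n x m y : eq_iter n x m y -> eq_iter m y n x.
Proof. by move=> [? ? ?]; split. Qed.

(** The power [n' - n] is applied to both sides; equality of the differences forces the second
    exponent. *)
Lemma eq_iter_raise n x m y n' m' : (n <= n')%N -> n%:Z - m%:Z = n'%:Z - m'%:Z ->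
  dr_domn n' x -> eq_iter n x m y -> eq_iter n' x m' y.
Proof.
move=> nn' e; rewrite -(subnK nn') => /dr_domnD[_ D] /eq_iterD -/(_ _ D).
by rewrite (_ : (n' - n + m = m')%N) //; lia.
Qed.

(** Both equations are raised until they meet at the power [maxn m k] of [y]. Unlike in
    [eq_iter_trans] the exponents are explicit, hence the same for all nearby points, which
    continuity of the product requires. *)
Lemma eq_iter_comp n x m y k l z :
  eq_iter n x m y -> eq_iter k y l z ->
  eq_iter (n + (k - m)) x (l + (m - k)) z.
Proof.
move=> exy eyz; have [Dx Dy e] := exy; have [Dy' Dz e'] := eyz.
have Dmk : dr_domn (maxn m k) y by rewrite /maxn; case: ifP.
have [|||? _ E] := @eq_iter_raise n x m y (n + (k - m)) (maxn m k) _ _ _ exy;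
  [lia|lia| |].
  rewrite addnC; apply/dr_domnD; split => //; rewrite e.
  have : dr_domn (k - m + m) y by rewrite (_ : (k - m + m = maxn m k)%N)//; lia.
  by move=> /dr_domnD[].
have [|||? _ E'] := @eq_iter_raise l z k y (l + (m - k)) (maxn m k) _ _ _ (eq_iterC eyz);
  [lia|lia| |].
  rewrite addnC; apply/dr_domnD; split => //; rewrite -e'.
  have : dr_domn (m - k + k) y by rewrite (_ : (m - k + k = maxn m k)%N)//; lia.
  by move=> /dr_domnD[].
by split => //; rewrite E E'.
Qed.

(* Changing the exponents without changing their difference: locally this is
   harmless, because the powers of sigma are locally injective. *)
Lemma eq_iter_adjust n x m y n' m' : n%:Z - m%:Z = n'%:Z - m'%:Z ->
  eq_iter n x m y -> eq_iter n' x m' y ->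
  exists U V, [/\ nbhs x U, nbhs y V &
    forall u v, U u -> V v -> eq_iter n u m v -> eq_iter n' u m' v].
Proof.
move=> e [Dx Dy _] [Dx' Dy' E].
have [nn'|/ltnW n'n] := leqP n n'.
  exists (dr_domn n'), setT; split; [exact: near_domn|exact: filterT|].
  by move=> u v Du _; exact: eq_iter_raise.
have En : (n = n - n' + n')%N by lia.
have Em : (m = n - n' + m')%N by lia.
have : dr_domn (n - n' + n') x by rewrite -En.
move=> /dr_domnD[_ /dr_iter_injective[W nW iW]].
exists (dr_domn n' `&` @dr_iter S n' @^-1` W).
exists (dr_domn m' `&` @dr_iter S m' @^-1` W); split.
- by apply: filterI; [exact: near_domn | exact: (dr_iter_continuous Dx')].
- apply: filterI; first exact: near_domn.
  by apply: (dr_iter_continuous Dy'); rewrite -E.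
- move=> u v [Du Wu] [Dv Wv] [_ _]; rewrite En Em !dr_iterD => /iW -/(_ Wu Wv).
  by split.
Qed.

End LocalHomeomorphism.

Section ArrowTopology.
Variable S : DRsystem.
Implicit Types (a b c g : DRgroupoid S) (n m : nat).

(** [coc] records only a difference; this fixes a pair of exponents that realises it. *)
Definition arrow_at n m c := coc c = n%:Z - m%:Z /\ eq_iter n (rng c) m (src c).

Lemma arrow_atP c : exists n m, arrow_at n m c.
Proof. by have [n [m [? ?]]] := arrowP c; exists n, m; split. Qed.

Lemma arrow_eq a b : rng a = rng b -> coc a = coc b -> src a = src b -> a = b.
Proof.
case: a b => [r k s p] [r' k' s' p'] /= er ek es.
by subst r' k' s'; congr DRArrow; exact: Prop_irrelevance.
Qed.

Lemma basic_open (i : basic_index S) : basic_dom i -> open (basic_Z i).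
Proof.
move=> Di; exists [set basic_Z i]; last by rewrite bigcup_set1.
move=> _ ->; exists [fset i]%fset.
  by move=> j; rewrite in_fset1 => /eqP ->; rewrite inE.
by rewrite set_fset1 bigcap_set1.
Qed.

(** One pair of exponents describes all neighbourhoods of [g], although the basic sets around [g]
    may use other pairs: [eq_iter_adjust] converts between them. Continuity on the groupoid is
    reduced to this. *)
Lemma nbhs_arrow n m g (W : set (DRgroupoid S)) : arrow_at n m g ->
  nbhs g W <-> exists U V, [/\ nbhs (rng g) U, nbhs (src g) V &
    forall c, arrow_at n m c -> U (rng c) -> V (src c) -> W c].
Proof.
move=> [ec eg]; have [Dx Dy E] := eg; split; last first.
  move=> [U [V [nU nV UVW]]].
  have [U' [oU' Ux sU DU hU]] := dr_iter_chart Dx nU.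
  have [V' [oV' Vx sV DV hV]] := dr_iter_chart Dy nV.
  pose i : basic_index S := (U', n, m, V').
  rewrite nbhsE; exists (basic_Z i).
    by split; [apply: basic_open|].
  move=> c [ecc Uc Vc Ec]; apply: UVW; [|exact: sU|exact: sV].
  by split => //; split => //; [exact: DU|exact: DV].
(* Conversely, an open set is a union of finite intersections of subbasic sets. [A] is the
   intersection around [g], and its finitely many constraints are imposed one at a time in the
   product filter. *)
rewrite (@nbhsE _ g) => -[B [[D sD <-] [A DA Ag] AW]].
have {AW} AW : A `<=` W by move=> c Ac; apply: AW; exists A.
have [K sK eK] := sD _ DA.
pose P i := [set uv : S * S | forall c, arrow_at n m c ->
  rng c = uv.1 -> src c = uv.2 -> @basic_Z S i c].
suff : (filter_prod (nbhs (rng g)) (nbhs (src g)))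
    (\bigcap_(i in [set` K]) P i).
  move=> [[U V] /= [nU nV]] UV; exists U, V; split => // c ac Uc Vc.
  by apply: AW; rewrite -eK => i Ki; apply: (UV (rng c, src c) _ i).
apply: filter_bigI => -[[[U n'] m'] V] Ki.
have [[oU oV] UD VD hU hV] : basic_dom (U, n', m', V) by have := sK _ Ki; rewrite inE.
have [e Ug Vg E'] : basic_Z (U, n', m', V) g 
  by move: Ag; rewrite -eK => /(_ _ Ki).
have e' : n%:Z - m%:Z = n'%:Z - m'%:Z by rewrite -ec.
have [|U1 [V1 [nU1 nV1 adj]]] := eq_iter_adjust e' eg; first by split; [exact: UD|exact: VD|].
exists (U `&` U1, V `&` V1) => /=.
  by split; apply: filterI => //; exact: open_nbhs_nbhs.
move=> [u v] /= [[Uu U1u] [Vv V1v]] c [ecc eqc] /= ru sv; subst u v.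
have [_ _ E''] := adj _ _ U1u V1v eqc.
by split => //; rewrite -e'.
Qed.

Lemma rng_continuous : continuous (@rng S).
Proof.
move=> g U nU; have [n [m gnm]] := arrow_atP g.
by apply/(nbhs_arrow _ gnm); exists U, setT; split => //; exact: filterT.
Qed.

Lemma src_continuous : continuous (@src S).
Proof.
move=> g U nU; have [n [m gnm]] := arrow_atP g.
by apply/(nbhs_arrow _ gnm); exists setT, U; split => //; exact: filterT.
Qed.

Lemma near_coc g : \forall c \near g, coc c = coc g.
Proof.
have [n [m gnm]] := arrow_atP g.
apply/(nbhs_arrow _ gnm); exists setT, setT; split; [exact: filterT|exact: filterT|].
by move=> c [-> _] _ _; case: gnm.
Qed.

(** Range, source and the locally constant cocycle are continuous and together separate arrows. *)
Lemma DRgroupoid_hausdorff : hausdorff_space (DRgroupoid S).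
Proof.
move=> a b ab; apply: arrow_eq.
- apply: dr_hausdorff => U V nU nV.
  have [c [Uc Vc]] := ab _ _ (rng_continuous nU) (rng_continuous nV).
  by exists (rng c).
- by have [c [/= -> ->]] := ab _ _ (near_coc a) (near_coc b).
- apply: dr_hausdorff => U V nU nV.
  have [c [Uc Vc]] := ab _ _ (src_continuous nU) (src_continuous nV).
  by exists (src c).
Qed.

(** For [u] near [rng g], openness of the power [m] gives a [v] near [src g] that meets [u], hence
    an arrow in [W] with range [u]. *)
Lemma rng_open g (W : set (DRgroupoid S)) : nbhs g W -> nbhs (rng g) (@rng S @` W).
Proof.
have [n [m gnm]] := arrow_atP g; have [ec [Dx Dy E]] := gnm.
move=> /(nbhs_arrow _ gnm)[U [V [nU nV UVW]]].
have nVD : nbhs (src g) (V `&` dr_domn m).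
  by apply: filterI => //; exact: near_domn.
have := dr_iter_open Dy nVD; rewrite -E => /(dr_iter_continuous Dx) nVx.
have nUD : nbhs (rng g) (U `&` dr_domn n).
  by apply: filterI => //; exact: near_domn.
apply: filterS2 nUD nVx => u [Uu Du] [v [Vv Dv] vu].
have uv : exists n m : nat, coc g = n%:Z - m%:Z /\ eq_iter n u m v.
  by exists n, m; split.
by exists (DRArrow uv) => //; apply: UVW.
Qed.

Lemma ginv_continuous : continuous (@ginv S).
Proof.
move=> g W; have [n [m gnm]] := arrow_atP g.
have gmn : arrow_at m n (ginv g).
  by case: gnm => e /eq_iterC; split => //=; rewrite e opprB.
move=> /(nbhs_arrow _ gmn)[U [V [nU nV UVW]]].
apply/(nbhs_arrow _ gnm); exists V, U; split => // c [e ec] Vc Uc.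
by apply: UVW => //; split; rewrite /= ?e ?opprB//; exact: eq_iterC.
Qed.

(** With fixed exponents, one end determines the other wherever the two powers are injective. *)
Lemma near_arrow_inj g : exists2 Z, nbhs g Z &
  (forall a b, Z a -> Z b -> rng a = rng b -> a = b) /\
  (forall a b, Z a -> Z b -> src a = src b -> a = b).
Proof.
have [n [m gnm]] := arrow_atP g; have [_ [Dx Dy _]] := gnm.
have [U nU iU] := dr_iter_injective Dx.
have [V nV iV] := dr_iter_injective Dy.
exists [set c | [/\ arrow_at n m c, U (rng c) & V (src c)]].
  apply/(nbhs_arrow _ gnm); exists U, V; split => //.
split=> a b [[ea [_ _ Ea]] Ua Va] [[eb [_ _ Eb]] Ub Vb] e.
  apply: arrow_eq; rewrite ?ea ?eb//; apply: iV => //; by rewrite -Ea -Eb e.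
by apply: arrow_eq; rewrite ?ea ?eb//; apply: iU => //; rewrite Ea Eb e.
Qed.

Lemma arrow_at_gunit (x : S) : arrow_at 0 0 (gunit x).
Proof. by []. Qed.

Lemma gunit_continuous : continuous (@gunit S).
Proof.
move=> x W /(nbhs_arrow _ (arrow_at_gunit x))[U [V [nU nV UVW]]].
change (nbhs x (@gunit S @^-1` W)).
by apply: filterS2 nU nV => u Uu Vu; exact: UVW.
Qed.

Lemma near_gunit (x : S) : \forall c \near gunit x, c = gunit (rng c).
Proof.
apply/(nbhs_arrow _ (arrow_at_gunit x)); exists setT, setT; split; [exact: filterT..|].
by move=> c [ec [_ _ /= E]] _ _; exact: arrow_eq.
Qed.

Lemma gmulE a b : src a = rng b ->
  [/\ rng (gmul a b) = rng a, src (gmul a b) = src b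
    & coc (gmul a b) = coc a + coc b].
Proof. by rewrite /gmul; case: pselect. Qed.

(** Stated with neighbourhoods, because [gmul] has a meaning only on composable pairs. *)
Lemma gmul_continuous a b (W : set (DRgroupoid S)) : src a = rng b ->
  nbhs (gmul a b) W -> exists A B, [/\ nbhs a A, nbhs b B &
    forall a' b', A a' -> B b' -> src a' = rng b' -> W (gmul a' b')].
Proof.
move=> ab; have [n [m anm]] := arrow_atP a; have [k [l bkl]] := arrow_atP b.
have comp a' b' : arrow_at n m a' -> arrow_at k l b' -> src a' = rng b' ->
    arrow_at (n + (k - m)) (l + (m - k)) (gmul a' b').
  move=> [ea ea'] [eb eb'] e; have [er es ec] := gmulE e.
  split; first by rewrite ec ea eb; lia.
  by rewrite er es; apply: eq_iter_comp ea' _; rewrite e.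
move=> /(nbhs_arrow _ (comp _ _ anm bkl ab))[U [V []]].
have [-> -> _] := gmulE ab => nU nV UVW.
exists [set a' | arrow_at n m a' /\ U (rng a')].
exists [set b' | arrow_at k l b' /\ V (src b')]; split.
- apply/(nbhs_arrow _ anm); exists U, setT; split => //; exact: filterT.
- apply/(nbhs_arrow _ bkl); exists setT, V; split => //; exact: filterT.
- move=> a' b' [a'nm Ua] [b'kl Vb] e; have [er es _] := gmulE e.
  by apply: UVW; rewrite ?er ?es//; exact: comp.
Qed.

Lemma gmulKV a b : rng a = rng b -> gmul a (gmul (ginv a) b) = b.
Proof.
move=> ab; have [r1 s1 c1] := @gmulE (ginv a) b ab.
have [r2 s2 c2] := @gmulE a (gmul (ginv a) b) (esym r1).
by apply: arrow_eq; rewrite ?r2 ?s2 ?c2 ?s1 ?c1 ?addKr /= ?addNKr//; lia.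
Qed.

Lemma gmulVK a b : src a = rng b -> gmul (ginv a) (gmul a b) = b.
Proof.
move=> ab; have [r1 s1 c1] := gmulE ab.
have [r2 s2 c2] := @gmulE (ginv a) (gmul a b) (esym r1).
by apply: arrow_eq; rewrite ?r2 ?s2 ?c2 ?s1 ?c1 ?ab//=; lia.
Qed.

Lemma ginvK : involutive (@ginv S).
Proof. by move=> a; apply: arrow_eq => //=; rewrite opprK. Qed.

Lemma gmul1g a : gmul (gunit (rng a)) a = a.
Proof.
have [r1 s1 c1] := @gmulE (gunit (rng a)) a erefl.
by apply: arrow_eq; rewrite ?r1 ?s1 ?c1 ?add0r.
Qed.

Lemma gmulg1 a : gmul a (gunit (src a)) = a.
Proof.
have [r1 s1 c1] := @gmulE a (gunit (src a)) erefl.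
by apply: arrow_eq; rewrite ?r1 ?s1 ?c1 ?addr0.
Qed.

Lemma gmulVg a : gmul (ginv a) a = gunit (src a).
Proof.
have [r1 s1 c1] := @gmulE (ginv a) a erefl.
by apply: arrow_eq; rewrite ?r1 ?s1 ?c1 ?addNr.
Qed.

End ArrowTopology.

(** * Compactly supported functions, bumps and partitions of unity *)

Section CompactSupport.
Variable R : realType.
Local Notation C := (Cplx R).

Lemma real_complex_continuous : continuous (fun t : R => (t%:C)%C : C).
Proof.
move=> t; apply/cvgrPdist_lt => e e0.
have eR : e = ((complex.Re e)%:C)%C :> C.
  by apply/eqP; rewrite eq_complex /= eqxx /=; move: e0; rewrite ltcE /= => /andP[/eqP ->].
have e0' : 0 < complex.Re e by move: e0; rewrite ltcE => /andP[].
have : \forall u \near t, `|t - u| < complex.Re e.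
  by move/cvgrPdist_lt : (@cvg_id _ (nbhs t)); apply.
apply: filterS => u tu; rewrite -rmorphB eR normc_def /= expr0n addr0 sqrtr_sqr.
by rewrite ltcR.
Qed.

Lemma near_eq_continuous (T T' : topologicalType) (f g : T -> T') (t : T) :
  (\forall u \near t, f u = g u) -> {for t, continuous g} -> {for t, continuous f}.
Proof.
move=> e cg A; rewrite (nbhs_singleton e) => /cg nA.
change (nbhs t (f @^-1` A)); change (nbhs t (g @^-1` A)) in nA.
by apply: filterS2 e nA => u /= ->.
Qed.

(** Extension by zero: [K] is closed since the space is Hausdorff, so [f] vanishes near every point
    outside [O]. *)
Lemma Cc_extend (T : topologicalType) (O K : set T) (f : T -> C) :
  hausdorff_space T -> compact K -> open O -> K `<=` O ->
  (forall t, O t -> {for t, continuous f}) -> (forall t, ~ K t -> f t = 0) ->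
  Cc f.
Proof.
move=> hT cK oO KO cf f0; have clK := compact_closed hT cK.
split.
  move=> t; have [/cf//|nOt] := pselect (O t).
  have nKt : (~` K) t by move=> /KO.
  rewrite /continuous_at (f0 _ nKt); apply: cvg_near_cst.
  have : nbhs t (~` K) by apply: open_nbhs_nbhs; split => //; exact: closed_openC.
  by apply: filterS => u /f0.
apply: (subclosed_compact _ cK); first exact: closed_closure.
rewrite closureE; apply: smallest_sub => // t /eqP ft.
by apply: contrapT => /f0.
Qed.

Lemma Cc0 (T : topologicalType) : Cc (fun _ : T => 0 : C).
Proof.
split; first by move=> t; exact: cvg_cst.
rewrite (_ : [set _ | _] = set0) ?closure0; first exact: compact0.
by apply/seteqP; split => t //=; rewrite eqxx.
Qed.

Lemma Cc_cont_mul (T : topologicalType) (f g : T -> C) :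
  Cc f -> continuous g -> Cc (fun t => g t * f t).
Proof.
move=> [cf kf] cg; split.
  by move=> t; apply: cvgM; [exact: cg|exact: cf].
apply: (subclosed_compact _ kf); first exact: closed_closure.
apply: closureS => t /=; apply: contra_neq => ->; exact: mulr0.
Qed.

Lemma Cc_lin (T : topologicalType) (z : C) (f g : T -> C) :
  Cc f -> Cc g -> Cc (fun t => z * f t + g t).
Proof.
move=> [cf kf] [cg kg]; split.
  by move=> t; apply: cvgD; [apply: cvgM; [exact: cvg_cst|exact: cf]|exact: cg].
apply: (subclosed_compact _ (compactU kf kg)); first exact: closed_closure.
rewrite -closureU; apply: closureS => t /=; have [->|?] := eqVneq (f t) 0.
  by rewrite mulr0 add0r; right.
by left.
Qed.

Lemma Cc_add (T : topologicalType) (f g : T -> C) :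
  Cc f -> Cc g -> Cc (fun t => f t + g t).
Proof.
move=> cf cg; have := Cc_lin 1 cf cg.
by congr Cc; apply/funext => t; rewrite mul1r.
Qed.

Lemma Cc_comp (T T' : topologicalType) (h : T -> T') (hinv : T' -> T) (f : T' -> C) :
  homeomorphism h hinv -> Cc f -> Cc (f \o h).
Proof.
move=> [hK hinvK ch chinv] [cf kf]; split.
  by move=> t; apply: continuous_comp; [exact: ch|exact: cf].
have kK : compact (hinv @` closure [set t | f t != 0]).
  by apply: continuous_compact => //; exact: continuous_subspaceT.
apply: (subclosed_compact _ kK); first exact: closed_closure.
move=> t ht; exists (h t) => // B nB.
by have [u [fu Bu]] := ht _ (ch _ _ nB); exists (h u).
Qed.

Lemma bump (S : DRsystem) (x : S) (U : set S) : nbhs x U ->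
  exists (chi : S -> C) (K : set S), [/\ compact K, K `<=` U, continuous chi,
    chi x = 1 & (forall u, 0 <= chi u) /\ (forall u, ~ K u -> chi u = 0)].
Proof.
move=> nU; have [K0] := @dr_locally_compact S x I.
rewrite withinET => nK0 [cK0 clK0].
have nW : nbhs x (K0 `&` U) by exact: filterI.
have := @locally_compact_completely_regular S R (@dr_locally_compact S)
  (@dr_hausdorff S) x (~` (K0 `&` U)^°).
have clB : closed (~` (K0 `&` U)^°) by apply: open_closedC; exact: open_interior.
have nBx : ~ (~` (K0 `&` U)^°) x by apply; exact: nW.
move=> /(_ clB nBx) /(uniform_separatorP (R := R))[f [cf _ fx fB]].
have {}fx : f x = 0 by apply: fx; exists x.
(* [f] is 1 off the interior of the intersection of [K0] and [U], so the closed set where [f] is at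
   most 1/2 lies in both. Off that set [1 - 2 * f] is negative; truncated at 0 it is the required
   bump. *)
pose K := f @^-1` [set t | t <= 2^-1].
have sK : K `<=` K0 `&` U.
  move=> u Ku; apply: contrapT => nu.
  have f1 : f u = 1 by apply: fB; exists u => // /interior_subset.
  by move: Ku; rewrite /K /= f1; lra.
have clK : closed K.
  by apply: closed_comp; [by move=> u _; exact: cf|exact: closed_le].
exists (fun u => ((Num.max 0 (1 - 2 * f u))%:C)%C), K; split.
- by apply: (subclosed_compact _ cK0) => // u /sK[].
- by move=> u /sK[].
- move=> u; apply: continuous_comp; last exact: real_complex_continuous.
  apply: continuous_max; first exact: cvg_cst.
  by apply: cvgB; [exact: cvg_cst|apply: cvgM; [exact: cvg_cst|exact: cf]].
- by rewrite fx mulr0 subr0 max_r.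
- split=> u; first by rewrite ler0c le_max lexx.
  move=> /negP; rewrite -ltNge => fu; rewrite max_l//; lra.
Qed.

Definition bisection (S : DRsystem) (Z : set (DRgroupoid S)) :=
  [/\ open Z, forall a b, Z a -> Z b -> rng a = rng b -> a = b
    & forall a b, Z a -> Z b -> src a = src b -> a = b].

(** The range map is injective and open on [Z], so its inverse there is continuous. *)
Lemma bisection_section (S : DRsystem) (Z : set (DRgroupoid S)) : bisection Z ->
  exists s : S -> DRgroupoid S, [/\ open (@rng S @` Z),
    forall c, Z c -> s (rng c) = c
    & forall u, (@rng S @` Z) u -> {for u, continuous s}].
Proof.
move=> [oZ iZ _].
(* [xget] needs a default arrow, which an empty [Z] cannot supply; in that case any function will
   do. *)
have [->|/set0P[c0 Zc0]] := eqVneq Z set0.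
  have [s] : inhabited (S -> DRgroupoid S) by constructor; exact: gunit.
  exists s; split => //; first by rewrite image_set0; exact: open0.
  by rewrite image_set0.
pose s u := xget c0 [set c | Z c /\ rng c = u].
have sK c : Z c -> s (rng c) = c.
  rewrite /s => Zc; case: xgetP => [w _ [/= Zw e]|/(_ c)[]//].
  exact: iZ.
exists s; split => //.
  rewrite openE => _ [c Zc <-]; apply: rng_open; exact: open_nbhs_nbhs.
move=> _ [c Zc <-] A; rewrite sK// => nA.
have nAZ : nbhs c (A `&` Z) by apply: filterI => //; exact: open_nbhs_nbhs.
change (nbhs (rng c) (s @^-1` A)).
by apply: filterS (rng_open nAZ) => _ [b [Ab Zb] <-] /=; rewrite sK.
Qed.

Lemma near_bisection (S : DRsystem) (g : DRgroupoid S) (W : set (DRgroupoid S)) :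
  nbhs g W -> exists Z, [/\ bisection Z, Z g & Z `<=` W].
Proof.
move=> nW; have [Z nZ [iZ jZ]] := near_arrow_inj g.
have : nbhs g (Z `&` W) by exact: filterI.
rewrite nbhsE => -[B [oB Bg] sB].
exists B; split => //; last by move=> b /sB[].
split => // a b /sB[Za _] /sB[Zb _]; [exact: iZ|exact: jZ].
Qed.

Definition bisection_fun (S : DRsystem) (f : DRgroupoid S -> C) :=
  exists Z K, [/\ bisection Z, compact K, K `<=` Z, continuous f &
    forall c, ~ K c -> f c = 0].

Lemma bisection_fun_Cc (S : DRsystem) (f : DRgroupoid S -> C) :
  bisection_fun f -> Cc f.
Proof.
move=> [Z [K [[oZ _ _] cK KZ cf f0]]]; apply: (@Cc_extend _ Z K) => //.
- exact: DRgroupoid_hausdorff.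
- by move=> t _; exact: cf.
Qed.

(** A bump at [rng g] is transported to [Z] along the range map and extended by zero. *)
Lemma arrow_bump (S : DRsystem) (g : DRgroupoid S) (W : set (DRgroupoid S)) :
  nbhs g W -> exists (psi : DRgroupoid S -> C) (Z K : set (DRgroupoid S)),
    [/\ [/\ bisection Z, compact K, K `<=` Z & Z `<=` W], continuous psi,
      psi g = 1, forall c, 0 <= psi c & forall c, ~ K c -> psi c = 0].
Proof.
move=> nW; have [Z [bZ Zg ZW]] := near_bisection nW.
have [s [oR sK cs]] := bisection_section bZ; have [oZ iZ jZ] := bZ.
have nR : nbhs (rng g) (@rng S @` Z).
  by apply: rng_open; exact: open_nbhs_nbhs.
have [chi [K [cK KR cchi chi1 [chi0 chiK]]]] := bump nR.
pose psi c := if `[< Z c >] then chi (rng c) else 0.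
have ckK : compact (s @` K).
  apply: continuous_compact => //; apply: continuous_in_subspaceT => u.
  by rewrite inE => /KR; exact: cs.
have sKZ : s @` K `<=` Z by move=> _ [_ /KR[c Zc <-] <-]; rewrite sK.
have psiK c : ~ (s @` K) c -> psi c = 0.
  rewrite /psi => nc; case: asboolP => // Zc; apply: chiK => Kc; apply: nc.
  by exists (rng c) => //; exact: sK.
have psiZ c : Z c -> {for c, continuous psi}.
  move=> Zc; apply: (@near_eq_continuous _ _ _ (chi \o @rng S)).
    have : nbhs c Z by exact: open_nbhs_nbhs.
    by apply: filterS => b Zb; rewrite /psi asboolT.
  by apply: (@continuous_comp _ _ _ (@rng S) chi); [exact: rng_continuous|exact: cchi].
exists psi, Z, (s @` K); split => //.
- by case: (Cc_extend (@DRgroupoid_hausdorff S) ckK oZ sKZ psiZ psiK).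
- by rewrite /psi asboolT.
- by move=> c; rewrite /psi; case: ifP.
Qed.

Lemma continuous_sum (T : topologicalType) (J : Type) (s : seq J) (f : J -> T -> C) :
  (forall j, continuous (f j)) -> continuous (fun t => \sum_(j <- s) f j t).
Proof.
move=> cf; elim: s => [|j s IH].
  have -> : (fun t => \sum_(j <- [::]) f j t) = (fun=> 0 : C).
    by apply/funext => t; rewrite big_nil.
  by move=> t; exact: cvg_cst.
have -> : (fun t => \sum_(i <- j :: s) f i t) = (fun t => f j t + \sum_(i <- s) f i t).
  by apply/funext => t; rewrite big_cons.
by move=> t; apply: cvgD; [exact: cf|exact: IH].
Qed.

Lemma continuous_frac (T : topologicalType) (f g h : T -> C) (t : T) :
  continuous f -> continuous g -> continuous h -> h t != 0 ->
  {for t, continuous (fun t => f t * (g t / h t))}.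
Proof.
move=> cf cg ch ht; apply: cvgM; first exact: cf.
by apply: cvgM; [exact: cg|apply: cvgV => //; exact: ch].
Qed.

(* By a partition of unity subordinate to a cover by bisections. *)
Lemma Cc_ind (S : DRsystem) (P : (DRgroupoid S -> C) -> Prop) :
  P (fun=> 0) ->
  (forall f g, Cc f -> Cc g -> P f -> P g -> P (fun c => f c + g c)) ->
  (forall f, bisection_fun f -> P f) ->
  forall f, Cc f -> P f.
Proof.
move=> P0 PD Pb f Cf; have [cf kf] := Cf.
set K := closure _ in kf.
have ex g : {psi : DRgroupoid S -> C | exists (Z L : set (DRgroupoid S)),
    [/\ [/\ bisection Z, compact L & L `<=` Z], continuous psi, psi g = 1,
       forall c, 0 <= psi c & forall c, ~ L c -> psi c = 0]}.
  apply/cid; have [psi [Z [L [[? ? ? _] ? ? ? ?]]]] := @arrow_bump S g setT filterT.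
  by exists psi, Z, L.
pose psi g := sval (ex g).
have psic g : continuous (psi g) by rewrite /psi; case: (ex g) => /= ? [? [? []]].
have psi1 g : psi g g = 1 by rewrite /psi; case: (ex g) => /= ? [? [? []]].
have psi0 g c : 0 <= psi g c by rewrite /psi; case: (ex g) => /= ? [? [? []]].
have /compact_near_coveringP cover := kf.
(* Compactness in the form of near coverings, along the finite sets of arrows directed by inclusion:
   some finite [D] has, for each point of [K], a member whose bump does not vanish there. *)
have [c _|D KD] := cover {fset (DRgroupoid S)} totally
  (fun D c => exists2 g, g \in D & psi g c != 0) _.
  exists ([set b | psi c b != 0], [set D : {fset (DRgroupoid S)} | [fset c] `<=` D]%fset).
    split=> /=; last by exists [fset c]%fset.
    have : \forall b \near c, psi c b != 0.
      by apply: (cvgr_neq0 _ (psic c c)); rewrite psi1 oner_neq0.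
    exact.
  by move=> [b D] /= [pb cD]; exists c; rewrite // -fsub1set.
move=> /(_ _ (fsubset_refl _)) {}KD.
pose Psi c := \sum_(g <- D) psi g c.
have Psi_neq0 c : K c -> Psi c != 0.
  move=> /KD[g gD]; apply: contra_neq => /eqP.
  rewrite /Psi psumr_eq0// => /allP/(_ g gD) /=; by move/eqP.
have Psi_cont : continuous Psi.
  exact: continuous_sum psic.
(* The bumps are nonnegative, so their sum [Psi] has no zeros on [K]; off the closed set [K] the
   factor [f] vanishes, so the quotient causes no discontinuity. *)
pose F g c := f c * (psi g c / Psi c).
have Fcont g : continuous (F g).
  move=> c; have [Kc|nKc] := pselect (K c).
    exact: (continuous_frac cf (psic g) Psi_cont (Psi_neq0 _ Kc)).
  have c0 : {for c, continuous (fun _ : DRgroupoid S => 0 : C)} := @cst_continuous _ _ 0 c.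
  apply: near_eq_continuous c0.
  have : nbhs c (~` K).
    by apply: open_nbhs_nbhs; split => //; apply: closed_openC; exact: closed_closure.
  apply: filterS => b nKb; rewrite /F (_ : f b = 0) ?mul0r//.
  by apply: contrapT => /eqP fb; apply: nKb; exact: subset_closure.
have FB g : bisection_fun (F g).
  have [Z [L [[bZ cL LZ] _ _ _ pL]]] := svalP (ex g).
  exists Z, L; split; [exact: bZ|exact: cL|exact: LZ|exact: Fcont|].
  by move=> c /pL pc; rewrite /F /psi pc mul0r mulr0.
have fE : f = (fun c => \sum_(g <- D) F g c).
  apply/funext => c; rewrite /F -mulr_sumr -mulr_suml -/(Psi c).
  have [Kc|nKc] := pselect (K c); first by rewrite divff ?mulr1//; exact: Psi_neq0.
  rewrite (_ : f c = 0) ?mul0r//.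
  by apply: contrapT => /eqP fb; apply: nKc; exact: subset_closure.
(* [PD] asks for compact support of both summands, so this is carried through the induction. *)
suff [] : Cc f /\ P f by [].
rewrite {1 2}fE; elim: (enum_fset D) => [|g s [IHc IHP]].
  have -> : (fun c => \sum_(g <- [::]) F g c) = (fun=> 0).
    by apply/funext => c; rewrite big_nil.
  by split; [exact: Cc0|exact: P0].
have -> : (fun c => \sum_(i <- g :: s) F i c) = (fun c => F g c + \sum_(g <- s) F g c).
  by apply/funext => c; rewrite big_cons.
have cF := bisection_fun_Cc (FB g).
by split; [exact: Cc_add|apply: PD; [exact: cF|exact: IHc|exact: Pb|exact: IHP]].
Qed.

End CompactSupport.

(** * Square-summable families *)

Section ComplexComplete.
Variable R : realType.
Local Notation C := (Cplx R).

Lemma Cplx_real (e : C) : 0 <= e -> e = ((complex.Re e)%:C)%C.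
Proof.
by move=> e0; apply/eqP; rewrite eq_complex /= eqxx /=; move: e0; rewrite lecE /= => /andP[/eqP ->].
Qed.

Lemma real_complex_cvg (T : Type) (F : set_system T) (f : T -> R) (l : R) :
  Filter F -> f @ F --> l -> (fun t => ((f t)%:C)%C : C) @ F --> ((l%:C)%C : C).
Proof.
move=> FF fl; apply/cvgrPdist_lt => e e0.
have e0' : 0 < complex.Re e by move: e0; rewrite ltcE => /andP[].
move/cvgrPdist_lt : fl => /(_ _ e0'); apply: filterS => u tu.
rewrite -rmorphB [e](Cplx_real (ltW e0)) normc_def /= expr0n addr0 sqrtr_sqr.
by rewrite ltcR.
Qed.

Lemma Re_le_norm (z : C) : `|complex.Re z| <= complex.Re `|z|.
Proof.
by case: z => a b; rewrite normc_def /= -[leLHS]sqrtr_sqr ler_sqrt ?addr_ge0 ?sqr_ge0// lerDl sqr_ge0.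
Qed.

Lemma Im_le_norm (z : C) : `|complex.Im z| <= complex.Re `|z|.
Proof.
by case: z => a b; rewrite normc_def /= -[leLHS]sqrtr_sqr ler_sqrt ?addr_ge0 ?sqr_ge0// lerDr sqr_ge0.
Qed.

Lemma Cplx_cauchy_cvg (F : set_system C) : ProperFilter F -> cauchy F -> cvg F.
Proof.
move=> FF /cauchyP cF.
have key (g : C -> R) : (forall z w : C, `|g z - g w| <= complex.Re `|z - w|) ->
    cvg (g @ F).
  move=> gle; apply/cauchy_cvgP/cauchyP => e e0.
  have eC : 0 < (e%:C)%C :> C by rewrite ltcR.
  have [z Fz] := cF _ eC; exists (g z).
  change (F (g @^-1` ball (g z) e)); apply: filterS Fz => w; rewrite /ball /= => zw.
  by apply: le_lt_trans (gle _ _) _; move: zw; rewrite ltcE => /andP[].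
have /cvg_ex[/= a Fa] : cvg ((@complex.Re R : C -> R) @ F).
  by apply: key => z w; rewrite -raddfB; exact: Re_le_norm.
have /cvg_ex[/= b Fb] : cvg ((@complex.Im R : C -> R) @ F).
  by apply: key => z w; rewrite -raddfB; exact: Im_le_norm.
apply: (@cvgP _ _ ((a%:C + 'i * b%:C)%C : C)).
rewrite (_ : F = (fun z : C => (complex.Re z)%:C%C + 'i%C * (complex.Im z)%:C%C : C) @ F).
  apply: cvgD; first exact: real_complex_cvg.
  by apply: cvgM; [exact: cvg_cst|exact: real_complex_cvg].
rewrite (_ : (fun z : C => _) = id)//; apply/funext => z; exact: esym (complexE z).
Qed.

End ComplexComplete.

Section FsetSum.
Variables (R : realType) (I : choiceType).
Local Notation C := (Cplx R).

Lemma ler_sum_fset (A B : {fset I}) (f : I -> C) : (A `<=` B)%fset ->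
  (forall i, 0 <= f i) -> \sum_(i <- A) f i <= \sum_(i <- B) f i.
Proof.
move=> AB f0; rewrite (big_fsetID _ (mem A) B) /=.
rewrite (_ : [fset x in B | x \in A]%fset = A) ?lerDl ?sumr_ge0//.
by apply/fsetP => x; rewrite !finmap.inE /=; apply: andb_idl => /(fsubsetP AB).
Qed.

Definition fsum (f : I -> C) (F : {fset I}) : C := \sum_(i <- F) f i.

(** The order of [C] is partial, so the supremum is taken among real parts and then embedded. *)
Lemma nonneg_sum_cvg (f : I -> C) (M : C) : (forall i, 0 <= f i) ->
  (forall F, fsum f F <= M) -> exists s : C, [/\ fsum f @ totally --> s,
    forall F, fsum f F <= s & forall N, (forall F, fsum f F <= N) -> s <= N].
Proof.
move=> f0 fM; pose g i := complex.Re (f i).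
have fE F : fsum f F = ((\sum_(i <- F) g i)%:C)%C.
  by rewrite /fsum rmorph_sum; apply: eq_bigr => i _; exact: Cplx_real.
have g0 i : 0 <= g i by have := f0 i; rewrite lecE => /andP[].
pose E := [set \sum_(i <- F) g i | F in [set: {fset I}]].
have hE : has_sup E.
  split; first by exists (\sum_(i <- fset0) g i), fset0.
  exists (complex.Re M) => _ [F _ <-].
  by have := fM F; rewrite fE lecE => /andP[].
exists ((sup E)%:C)%C; split; last 2 first.
- by move=> F; rewrite fE lecR; apply: ub_le_sup; [case: hE|exists F].
- move=> N fN; have := fN fset0; rewrite !lecE /= fE /= => /andP[-> _] /=.
  apply: ge_sup; first by case: hE.
  by move=> _ [F _ <-]; have := fN F; rewrite fE lecE => /andP[].
rewrite (_ : fsum f = fun F => (\sum_(i <- F) g i)%:C%C); last exact/funext.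
apply: real_complex_cvg; apply/cvgrPdist_lt => e e0.
have [_ [F0 _ <-] lt0] := sup_adherent e0 hE.
exists F0 => // F /= F0F.
have le1 : \sum_(i <- F) g i <= sup E by apply: ub_le_sup; [case: hE|exists F].
have le2 : \sum_(i <- F0) g i <= \sum_(i <- F) g i.
  by rewrite -lecR -!fE; exact: ler_sum_fset.
by rewrite ger0_norm ?subr_ge0//; lra.
Qed.

Definition sqsum (u : I -> C^o) := exists M : C, forall F : {fset I}, fsum (fun i => `|u i| ^+ 2) F <= M.

Definition l2_pred : {pred I -> C^o} := fun u => `[< sqsum u >].

Lemma l2_submod_closed : submod_closed l2_pred.
Proof.
split; first by apply/asboolP; exists 0 => F; rewrite /fsum big1// => i _; rewrite normr0 expr0n.
move=> a u v /asboolP[M uM] /asboolP[N vN]; apply/asboolP.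
(* From [(s + t)^2 <= 2 s^2 + 2 t^2]. *)
exists (2 * `|a| ^+ 2 * M + 2 * N) => F.
apply: (@le_trans _ _ (2 * `|a| ^+ 2 * fsum (fun i => `|u i| ^+ 2) F + 2 * fsum (fun i => `|v i| ^+ 2) F)).
  rewrite /fsum !mulr_sumr -big_split /=; apply: ler_sum => i _.
  apply: (@le_trans _ _ ((`|a * u i| + `|v i|) ^+ 2)).
    by rewrite ler_pXn2r ?nnegrE ?addr_ge0//; exact: ler_normD.
  rewrite normrM -subr_ge0.
  have -> : 2 * `|a| ^+ 2 * `|u i| ^+ 2 + 2 * `|v i| ^+ 2 - (`|a| * `|u i| + `|v i|) ^+ 2
    = (`|a| * `|u i| - `|v i|) ^+ 2 by ring.
  by apply: real_exprn_even_ge0 => //; rewrite realB ?realM ?normr_real.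
by rewrite lerD// ler_wpM2l ?mulr_ge0 ?exprn_ge0.
Qed.

HB.instance Definition _ := GRing.isSubmodClosed.Build C (I -> C^o) l2_pred l2_submod_closed.

Record l2 := L2 { l2val :> I -> C^o; l2valP : l2val \in l2_pred }.
HB.instance Definition _ := [isSub for l2val].
HB.instance Definition _ := [Choice of l2 by <:].
HB.instance Definition _ := [SubChoice_isSubLmodule of l2 by <:].

Lemma fsum_cvg (T : Type) (F : set_system T) (f : T -> I -> C) (g : I -> C) G :
  Filter F -> (forall i, (fun t => f t i) @ F --> g i) ->
  (fun t => fsum (f t) G) @ F --> fsum g G.
Proof.
move=> FF fg; rewrite /fsum; elim: (enum_fset G) => [|i s IH].
  have -> : (fun t => \sum_(j <- [::]) f t j) = (fun=> 0 : C).
    by apply/funext => t; rewrite big_nil.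
  by rewrite big_nil; exact: cvg_cst.
have -> : (fun t => \sum_(j <- i :: s) f t j) = (fun t => f t i + \sum_(j <- s) f t j).
  by apply/funext => t; rewrite big_cons.
by rewrite big_cons; apply: cvgD; [exact: fg|exact: IH].
Qed.

Definition inner (u v : l2) : C := lim (fsum (fun i => u i * Num.conj (v i)) @ totally).

Lemma fsumD (f g : I -> C) F : fsum (fun i => f i + g i) F = fsum f F + fsum g F.
Proof. by rewrite /fsum big_split. Qed.

Lemma fsumZ a (f : I -> C) F : fsum (fun i => a * f i) F = a * fsum f F.
Proof. by rewrite /fsum mulr_sumr. Qed.

Lemma sqsum_cvg (u : l2) : exists s : C,
  [/\ fsum (fun i => `|u i| ^+ 2) @ totally --> s,
    forall F, fsum (fun i => `|u i| ^+ 2) F <= s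
  & forall N, (forall F, fsum (fun i => `|u i| ^+ 2) F <= N) -> s <= N].
Proof.
have /asboolP[M uM] := l2valP u.
by apply: nonneg_sum_cvg uM => i; exact: exprn_ge0.
Qed.

(** Reduces the sums that define [inner] to four sums of squares, which converge because they are
    monotone and bounded. *)
Lemma polarization (a b : C) : a * Num.conj b = 4^-1 *
  (`|a + b| ^+ 2 + (-1) * `|a - b| ^+ 2 + 'i * `|a + 'i * b| ^+ 2
   + (- 'i) * `|a - 'i * b| ^+ 2).
Proof.
rewrite !normCK !(rmorphD, rmorphN, rmorphM) /= !conjCi.
move: (Num.conj a) (Num.conj b) => a' b'.
have i2 : 'i * 'i = -1 :> C by rewrite -expr2 sqrCi.
transitivity (4^-1 * (a * b' * (2 - 2 * ('i * 'i)) + b * a' * (2 + 2 * ('i * 'i))) : C).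
  by rewrite i2; field.
by ring.
Qed.

Lemma cvg_lincomb4 (T : Type) (F : set_system T) (f1 f2 f3 f4 : T -> C)
    (c c1 c2 c3 s1 s2 s3 s4 : C) : Filter F ->
  f1 @ F --> s1 -> f2 @ F --> s2 -> f3 @ F --> s3 -> f4 @ F --> s4 ->
  (fun t => c * (f1 t + c1 * f2 t + c2 * f3 t + c3 * f4 t)) @ F -->
  c * (s1 + c1 * s2 + c2 * s3 + c3 * s4).
Proof.
move=> FF h1 h2 h3 h4; have cc (d : C) : (fun _ : T => d) @ F --> d by exact: cvg_cst.
exact: (cvgM (cc c) (cvgD (cvgD (cvgD h1 (cvgM (cc c1) h2))
  (cvgM (cc c2) h3)) (cvgM (cc c3) h4))).
Qed.

Lemma inner_cvg (u v : l2) :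
  fsum (fun i => u i * Num.conj (v i)) @ totally --> inner u v.
Proof.
have [s1 [c1 _ _]] := sqsum_cvg (u + v); have [s2 [c2 _ _]] := sqsum_cvg (u - v).
have [s3 [c3 _ _]] := sqsum_cvg (u + 'i *: v); have [s4 [c4 _ _]] := sqsum_cvg (u - 'i *: v).
suff [s cs] : exists s : C, fsum (fun i => u i * Num.conj (v i)) @ totally --> s.
  by apply: (cvgP _ cs).
exists (4^-1 * (s1 + (-1) * s2 + 'i * s3 + (-'i) * s4)).
have -> : fsum (fun i => u i * Num.conj (v i)) = fun F => 4^-1 *
   (fsum (fun i => `|(u + v) i| ^+ 2) F + (-1) * fsum (fun i => `|(u - v) i| ^+ 2) F
   + 'i * fsum (fun i => `|(u + 'i *: v) i| ^+ 2) F
   + (- 'i) * fsum (fun i => `|(u - 'i *: v) i| ^+ 2) F).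
  apply/funext => F; rewrite -!fsumZ -!fsumD -fsumZ; congr (fsum _ F).
  apply/funext => i.
  rewrite (_ : (u + v) i = u i + v i)//  (_ : (u - v) i = u i - v i)//.
  rewrite (_ : (u + 'i *: v) i = u i + 'i * v i)//  (_ : (u - 'i *: v) i = u i - 'i * v i)//.
  exact: polarization.
exact: cvg_lincomb4.
Qed.

Lemma innerDl z u v w : inner (z *: u + v) w = z * inner u w + inner v w.
Proof.
apply: (@cvg_unique _ _ (fsum (fun i => (z *: u + v) i * Num.conj (w i)) @ totally)).
- exact: norm_hausdorff.
- exact: inner_cvg.
have -> : fsum (fun i => (z *: u + v) i * Num.conj (w i)) = fun F =>
   z * fsum (fun i => u i * Num.conj (w i)) F + fsum (fun i => v i * Num.conj (w i)) F.
  apply/funext => F; rewrite -fsumZ -fsumD; congr (fsum _ F); apply/funext => i.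
  by rewrite (_ : (z *: u + v) i = z * u i + v i)// mulrDl mulrA.
by apply: cvgD; [apply: cvgM; [exact: cvg_cst|]|]; exact: inner_cvg.
Qed.

Lemma conj_cvg (T : Type) (F : set_system T) (f : T -> C) (l : C) :
  Filter F -> f @ F --> l -> (fun t => Num.conj (f t)) @ F --> Num.conj l.
Proof.
move=> FF /cvgrPdist_lt fl; apply/cvgrPdist_lt => e e0.
by apply: filterS (fl e e0) => t; rewrite -rmorphB norm_conjC.
Qed.

Lemma innerC u v : inner v u = Num.conj (inner u v).
Proof.
apply: (@cvg_unique _ _ (fsum (fun i => v i * Num.conj (u i)) @ totally)).
- exact: norm_hausdorff.
- exact: inner_cvg.
have -> : fsum (fun i => v i * Num.conj (u i)) =
    fun F => Num.conj (fsum (fun i => u i * Num.conj (v i)) F).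
  apply/funext => F; rewrite /fsum rmorph_sum; apply: eq_bigr => i _.
  by rewrite rmorphM /= conjCK mulrC.
by apply: conj_cvg; exact: inner_cvg.
Qed.

(** Gives access to the norm through bounds on finite sums, so that later estimates need not handle
    the limit. *)
Lemma inner_sqE (u : l2) :
  (forall F, fsum (fun i => `|u i| ^+ 2) F <= inner u u) /\
  (forall N, (forall F, fsum (fun i => `|u i| ^+ 2) F <= N) -> inner u u <= N).
Proof.
have [s [cs s1 s2]] := sqsum_cvg u.
suff -> : inner u u = s by [].
apply: (@cvg_unique _ _ (fsum (fun i => u i * Num.conj (u i)) @ totally)).
- exact: norm_hausdorff.
- exact: inner_cvg.
by rewrite (_ : (fun i => _) = (fun i => `|u i| ^+ 2))//; apply/funext => i; rewrite normCK.
Qed.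

Lemma coord_sq_le (u : l2) i : `|u i| ^+ 2 <= inner u u.
Proof. by have [/(_ [fset i]%fset)+ _] := inner_sqE u; rewrite /fsum big_seq_fset1. Qed.

Lemma inner_ge0 u : 0 <= inner u u.
Proof. by have [/(_ fset0)+ _] := inner_sqE u; rewrite /fsum big_seq_fset0. Qed.

Lemma l2_ext (u v : l2) : (forall i, u i = v i) -> u = v.
Proof. by move=> uv; apply: val_inj; apply/funext. Qed.

Lemma inner_eq0 u : inner u u = 0 -> u = 0.
Proof.
move=> u0; apply: l2_ext => i; have := coord_sq_le u i; rewrite u0 => ui.
have : `|u i| ^+ 2 == 0 by rewrite eq_le ui exprn_ge0.
by rewrite expf_eq0 normr_eq0 => /eqP.
Qed.

Lemma inner0l u : inner 0 u = 0.
Proof.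
have := innerDl 1 0 0 u; rewrite scale1r addr0 mul1r => /eqP.
by rewrite -subr_eq subrr eq_sym => /eqP.
Qed.

Lemma innerZl z u v : inner (z *: u) v = z * inner u v.
Proof. by rewrite -[z *: u]addr0 innerDl inner0l addr0. Qed.

Lemma innerZr z u v : inner u (z *: v) = Num.conj z * inner u v.
Proof. by rewrite innerC innerZl rmorphM /= -innerC. Qed.

Lemma innerDr u v w : inner u (v + w) = inner u v + inner u w.
Proof. by rewrite innerC -[v]scale1r innerDl mul1r rmorphD /= -!innerC scale1r. Qed.

Lemma cauchy_schwarz u v : `|inner u v| ^+ 2 <= inner u u * inner v v.
Proof.
set a := inner u u; set b := inner v v; set c := inner u v.
have a0 : 0 <= a := inner_ge0 u; have b0 : 0 <= b := inner_ge0 v.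
have bc : Num.conj b = b by apply: conj_Creal; exact: ger0_real.
have [b00|bn0] := eqVneq b 0.
  have v0 : v = 0 by exact: inner_eq0.
  by rewrite b00 mulr0 /c v0 -[0 : l2](scale0r v) innerZr conjC0 mul0r normr0 expr0n.
have bgt : 0 < b by rewrite lt_def bn0.
(* This vector is [b] times the component of [u] orthogonal to [v], written without a division. *)
have := inner_ge0 (b *: u + (- c) *: v).
have -> : inner (b *: u + (- c) *: v) (b *: u + (- c) *: v) = b * (a * b - `|c| ^+ 2).
  rewrite innerDl !innerDr innerZl !innerZr innerZl [inner v u]innerC.
  by rewrite -/a -/b -/c normCK rmorphN /= bc; ring.
by rewrite pmulr_rge0// subr_ge0.
Qed.

Lemma innerDl' u v w : inner (u + v) w = inner u w + inner v w.
Proof. by rewrite -[u]scale1r innerDl mul1r scale1r. Qed.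

Definition l2norm u : C := sqrtC (inner u u).

Lemma l2norm_sq u : l2norm u ^+ 2 = inner u u.
Proof. exact: sqrtCK. Qed.

Lemma l2norm_ge0 u : 0 <= l2norm u.
Proof. by rewrite sqrtC_ge0 inner_ge0. Qed.

Lemma l2normZ z u : l2norm (z *: u) = `|z| * l2norm u.
Proof.
apply/eqP; rewrite -(@eqrXn2 _ 2) ?mulr_ge0 ?l2norm_ge0//.
rewrite exprMn !l2norm_sq innerZl innerZr normCK mulrA.
by [].
Qed.

Lemma l2norm_eq0 u : l2norm u = 0 -> u = 0.
Proof. by move=> u0; apply: inner_eq0; rewrite -l2norm_sq u0 expr0n. Qed.

Lemma l2normD u v : l2norm (u + v) <= l2norm u + l2norm v.
Proof.
have n0 := l2norm_ge0; have i0 := inner_ge0.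
rewrite -(@ler_pXn2r _ 2) ?nnegrE ?addr_ge0//.
rewrite sqrrD !l2norm_sq innerDl' !innerDr.
have le1 : `|inner u v| <= l2norm u * l2norm v.
  rewrite -(@ler_pXn2r _ 2) ?nnegrE ?mulr_ge0// exprMn !l2norm_sq.
  exact: cauchy_schwarz.
have le2 : inner u v + inner v u <= (l2norm u * l2norm v) *+ 2.
  rewrite [inner v u]innerC; apply: (@le_trans _ _ (`|inner u v + Num.conj (inner u v)|)).
    apply: real_ler_norm; rewrite CrealE rmorphD /= conjCK addrC//.
  apply: le_trans (ler_normD _ _) _; rewrite norm_conjC -mulr2n.
  by rewrite lerMn2r le1 orbT.
rewrite [leLHS](_ : _ = inner u u + (inner u v + inner v u) + inner v v); last by ring.
by rewrite lerD2r lerD2l.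
Qed.

End FsetSum.

HB.instance Definition _ (R : realType) (I : choiceType) :=
  @Lmodule_isNormed.Build (Cplx R) (l2 R I) (@l2norm R I) (@l2normD R I)
    (@l2normZ R I) (@l2norm_eq0 R I).

Section L2Complete.
Variables (R : realType) (I : choiceType).
Local Notation C := (Cplx R).
Local Notation l2 := (l2 R I).

Lemma l2_normE (u : l2) : `|u| = l2norm u.
Proof. by []. Qed.

Lemma coord_le (u : l2) i : `|u i : C| <= `|u|.
Proof. by rewrite -(@ler_pXn2r _ 2) ?nnegrE// l2_normE l2norm_sq coord_sq_le. Qed.

Lemma l2_complete (F : set_system l2) : ProperFilter F -> cauchy F -> cvg F.
Proof.
move=> FF cF; have /cauchyP cF' := cF.
have coord i : exists w : C, (fun u : l2 => u i : C) @ F --> w.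
  suff : cvg ((fun u : l2 => u i : C) @ F) by move=> ?; eexists; eassumption.
  apply: Cplx_cauchy_cvg; apply/cauchyP => e e0; have [u Fu] := cF' e e0.
  exists (u i); change (F ((fun u : l2 => u i : C) @^-1` ball (u i : C) e)).
  apply: filterS Fu => v; rewrite /ball /= => uv.
  by apply: le_lt_trans uv; exact: (coord_le (u - v) i).
pose w i := sval (cid (coord i)).
have wP i : (fun u : l2 => u i : C) @ F --> w i by rewrite /w; case: cid.
(* On a finite set [G], closeness in norm passes to the coordinatewise limit. This holds before [w]
   is known to be square-summable, and [w = u - (u - w)] then shows that it is. *)
have key (u : l2) (e : C) : 0 < e -> F (ball u e) ->
    forall G, fsum (fun i => `|u i - w i| ^+ 2) G <= e ^+ 2.
  move=> e0 Fu G.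
  have cv : (fun v : l2 => fsum (fun i => `|u i - v i| ^+ 2 : C) G) @ F -->
            fsum (fun i => `|u i - w i| ^+ 2) G.
    apply: fsum_cvg => i; apply: cvgM; apply: cvg_norm; apply: cvgB => //; exact: cvg_cst.
  apply/ler_addgt0Pr => d d0.
  have nr x : fsum (fun i => `|u i - x i| ^+ 2 : C) G \is Num.real.
    by apply: ger0_real; apply: sumr_ge0 => i _; exact: exprn_ge0.
  have : F (ball u e `&` [set v : l2 | `|fsum (fun i => `|u i - w i| ^+ 2) G -
       fsum (fun i => `|u i - v i| ^+ 2 : C) G| < d]).
    by apply: filterI => //; move/cvgrPdist_lt : cv; exact.
  move=> /filter_ex[v [uv dv]].
  move: dv => /=; rewrite real_ltr_norml ?realB// => /andP[_].
  rewrite ltrBlDr => /ltW/le_trans; apply.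
  rewrite addrC lerD2r.
  have : `|u - v| ^+ 2 <= e ^+ 2.
    by rewrite ler_pXn2r ?nnegrE// ltW.
  rewrite l2_normE l2norm_sq; apply: le_trans.
  by have [+ _] := inner_sqE (u - v); apply.
have wl2 : (w : I -> C^o) \in (@l2_pred R I).
  have [u Fu] := cF' 1 ltr01.
  have : (fun i => u i - w i : C^o) \in (@l2_pred R I).
    by apply/asboolP; exists (1 ^+ 2) => G; exact: key.
  move=> duw; rewrite (_ : w = (u : I -> C^o) - ((fun i => u i - w i) : I -> C^o)).
    by apply: rpredB => //; exact: l2valP.
  by apply/funext => i; rewrite !fctE /=; rewrite subKr.
apply: (@cvgP _ _ (L2 wl2)); apply/(@cvgrPdist_le _ _ _ _ _ id) => e e0.
have e20 : 0 < e / 2 by rewrite divr_gt0.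
have [u Fu] := cF' _ e20.
have Fu' := Fu; apply: filterS Fu' => v uv /=; rewrite [e]splitr -(subrKA u).
apply: le_trans (ler_normD _ _) _; apply: lerD; last exact: ltW.
rewrite distrC -(@ler_pXn2r _ 2) ?nnegrE ?normr_ge0 ?(ltW e20)//.
rewrite l2_normE l2norm_sq; have [_ +] := inner_sqE (u - L2 wl2); apply => G.
by apply: (key u); [exact: e20|exact: Fu].
Qed.

End L2Complete.

HB.instance Definition _ (R : realType) (I : choiceType) :=
  Uniform_isComplete.Build (l2 R I) (@l2_complete R I).

Section L2Hilbert.
Variables (R : realType) (I : choiceType).
Local Notation C := (Cplx R).

Lemma l2_inner_norm (u : l2 R I) : inner u u = `|u| ^+ 2.
Proof. by rewrite l2_normE l2norm_sq. Qed.

Definition l2_hilbert : hilbertSpace R := Build_hilbertSpace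
  (@innerDl R I) (@innerC R I) l2_inner_norm.

End L2Hilbert.

(** * Orbit equivalences and arrow-preserving homeomorphisms *)

(** Existence of an arrow, as a relation on points that can be chained without the dependent
    record. *)
Definition arrow_rel (S : DRsystem) (x : S) (p : int) (y : S) :=
  exists n m : nat, p = n%:Z - m%:Z /\ eq_iter n x m y.

Section ArrowRel.
Variable S : DRsystem.
Implicit Types (x y z : S) (p q : int).

Lemma arrow_rel_refl x : arrow_rel x 0 x.
Proof. by exists 0%N, 0%N. Qed.

Lemma arrow_rel_sym x p y : arrow_rel x p y -> arrow_rel y (- p) x.
Proof. by move=> [n [m [-> /eq_iterC]]]; exists m, n; rewrite opprB. Qed.

Lemma arrow_rel_trans y x z p q :
  arrow_rel x p y -> arrow_rel y q z -> arrow_rel x (p + q) z.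
Proof.
move=> [n [m [-> xy]]] [k [l [-> yz]]].
by have [n' [l' [<- ?]]] := eq_iter_trans xy yz; exists n', l'.
Qed.

Lemma arrow_rel_iter n x : dr_domn n x -> arrow_rel x n%:Z (dr_iter n x).
Proof. by move=> Dx; exists n, 0%N; rewrite subr0; split => //; split. Qed.

Lemma StabP x p : Stab x p <-> arrow_rel x p x.
Proof. by split=> -[m [n [-> /eq_iterC]]]; exists m, n. Qed.

Lemma Stab_arrow_rel x y p q : arrow_rel x p y -> Stab x q -> Stab y q.
Proof.
move=> xy /StabP xx; apply/StabP.
have := arrow_rel_trans (arrow_rel_sym xy) (arrow_rel_trans xx xy).
by congr arrow_rel; lia.
Qed.

Lemma StabN x p : Stab x p -> Stab x (- p).
Proof. by rewrite !StabP; exact: arrow_rel_sym. Qed.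

Lemma StabD x p q : Stab x p -> Stab x q -> Stab x (p + q).
Proof. by rewrite !StabP; exact: arrow_rel_trans. Qed.

Lemma StabM x p (n : nat) : Stab x p -> Stab x (p * n%:Z).
Proof.
move=> xp; elim: n => [|n IH]; first by rewrite mulr0; apply/StabP; exact: arrow_rel_refl.
by rewrite intS mulrDr mulr1; exact: StabD.
Qed.

(** [Stab x] is a subgroup of the integers, so the remainder of an element modulo the least positive
    one must vanish. *)
Lemma Stab_minP x (p : nat) : Stab_min x = Some p ->
  (0 < p)%N /\ forall q, Stab x q <-> (p%:Z %| q)%Z.
Proof.
rewrite /Stab_min; case: pselect => // e [<-].
case: ex_minnP => n /asboolP[n0 xn] nmin; split => // q; split.
  move=> xq; apply/dvdz_mod0P/eqP/negPn/negP => r0.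
  have xr : Stab x (q %% n%:Z)%Z.
    have -> : (q %% n%:Z)%Z = q + - ((q %/ n%:Z)%Z * n%:Z).
      by have := divz_eq q n%:Z; lia.
    apply: StabD => //; apply: StabN; case: (q %/ n%:Z)%Z => m.
      by rewrite mulrC; exact: StabM.
    by rewrite NegzE mulNr; apply: StabN; rewrite mulrC; exact: StabM.
  have r1 : (0 <= q %% n%:Z)%Z by rewrite modz_ge0//; lia.
  have r2 : ((q %% n%:Z)%Z < n%:Z)%R by rewrite ltz_pmod//; lia.
  have := nmin `|(q %% n%:Z)%Z|%N.
  have -> : `[< (1 <= `|(q %% n%:Z)%Z|)%N /\ Stab x (`|(q %% n%:Z)%Z|%N)%:Z >].
    by apply/asboolP; split; [lia|rewrite gez0_abs].
  by move=> /(_ isT); lia.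
move=> /dvdzP[m ->]; case: m => m; first by rewrite mulrC; exact: StabM.
by rewrite NegzE mulNr; apply: StabN; rewrite mulrC; exact: StabM.
Qed.

Lemma Stab_min_None x q : Stab_min x = None -> Stab x q -> q = 0.
Proof.
rewrite /Stab_min; case: pselect => // ne _ xq; apply: contrapT => q0; apply: ne.
exists `|q|%N; apply/asboolP; split; first lia.
have [q1|/ltW q1] := lerP 0 q; first by rewrite gez0_abs.
by rewrite lez0_abs//; exact: StabN.
Qed.

(** [ps_l] speaks only of periodic points; a point with nontrivial stabiliser reaches one along its
    orbit. *)
Lemma Stab_min_periodic x (p : nat) : Stab_min x = Some p ->
  exists n, dr_domn n x /\ eq_iter p (dr_iter n x) 0 (dr_iter n x).
Proof.
move=> /Stab_minP[_ xP]; have /xP[m [n [e [Dn Dm E]]]] := dvdzz p%:Z.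
have mE : (m = p + n)%N by lia.
exists n; split => //; split => //.
  by move: Dm; rewrite mE => /dr_domnD[].
by rewrite -dr_iterD -mE -E.
Qed.

Lemma cocycle_sum_1 (l k : S -> nat) x (p : nat) :
  (forall y, dr_dom y -> l y = (k y + 1)%N) -> dr_domn p x ->
  cocycle_sum l k x p = p%:Z.
Proof.
move=> lk Dp; rewrite /cocycle_sum.
transitivity (\sum_(n < p) (1 : int)); last by rewrite sumr_const card_ord -[RHS]natz.
apply: eq_bigr => -[i ip] _ /=; rewrite lk; first by lia.
have : dr_domn (1 + i) x by exact: dr_domn_le Dp.
by move=> /dr_domnD[_ []].
Qed.

End ArrowRel.

Lemma Stab_min_eq (S T : DRsystem) (x : S) (y : T) :
  (forall q, Stab x q <-> Stab y q) -> Stab_min x = Stab_min y.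
Proof.
by move=> xy; rewrite /Stab_min (_ : Stab x = Stab y)//; apply/seteqP; split => q /xy.
Qed.

Lemma near_neq (T U : topologicalType) (f g : T -> U) (x : T) :
  hausdorff_space U -> {for x, continuous f} -> {for x, continuous g} ->
  f x <> g x -> \forall u \near x, f u <> g u.
Proof.
move=> hU cf cg; apply: contra_notP => nfg; apply: hU => A B nA nB.
apply: contrapT => AB; apply: nfg.
have fA : nbhs x (f @^-1` A) := cf _ nA.
have gB : nbhs x (g @^-1` B) := cg _ nB.
apply: filterS2 fA gB => u Au Bu fg; apply: AB.
by exists (f u); split => //; rewrite fg.
Qed.

(** Working form of condition (2): the algebraic conditions are replaced by the effect on range,
    cocycle value and source. *)
Definition spatial_iso (X Y : DRsystem) (h : X -> Y)
    (Theta : DRgroupoid X -> DRgroupoid Y) :=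
  (exists Theta', homeomorphism Theta Theta') /\
  forall g, [/\ rng (Theta g) = h (rng g), coc (Theta g) = coc g
    & src (Theta g) = h (src g)].

Section Spatial.
Variables (X Y : DRsystem) (h : X -> Y) (hinv : Y -> X).
Hypothesis hh : homeomorphism h hinv.

Let hK : cancel h hinv. Proof. by case: hh. Qed.
Let hinvK : cancel hinv h. Proof. by case: hh. Qed.
Let hc : continuous h. Proof. by case: hh. Qed.
Let hinvc : continuous hinv. Proof. by case: hh. Qed.

(** An arrow is composable with the units at its ends, and composability is preserved; this locates
    the ends of its image. Conversely, both sides of the product formula have the same range,
    cocycle value and source. *)
Lemma spatial_isoP (Theta : DRgroupoid X -> DRgroupoid Y) :
  [/\ groupoid_iso Theta, forall x, Theta (gunit x) = gunit (h x)
    & forall g, coc g = coc (Theta g)] <-> spatial_iso h Theta.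
Proof.
split=> [[[homT compT mulT] unitT cocT]|[homT spT]].
  split=> // g; split => //.
    have /compT : src (gunit (rng g)) = rng g by [].
    by rewrite unitT.
  have /compT : src g = rng (gunit (src g)) by [].
  by rewrite unitT.
have comp a b : src a = rng b <-> src (Theta a) = rng (Theta b).
  have [_ _ ->] := spT a; have [-> _ _] := spT b.
  by split=> [->//|/(can_inj hK)].
split; [split => //| |] => [a b ab|x|g].
- have [r1 s1 c1] := gmulE ab; have [r2 s2 c2] := gmulE (iffLR (comp _ _) ab).
  have [r3 c3 s3] := spT (gmul a b).
  have [r4 c4 _] := spT a; have [_ c5 s5] := spT b.
  by apply: arrow_eq; rewrite ?r3 ?r2 ?r1 ?r4 ?c3 ?c2 ?c1 ?c4 ?c5 ?s3 ?s2 ?s1 ?s5.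
- by have [? ? ?] := spT (gunit x); exact: arrow_eq.
- by have [] := spT g.
Qed.

Lemma spatial_iso_sym (Theta : DRgroupoid X -> DRgroupoid Y) :
  spatial_iso h Theta -> exists Theta', homeomorphism Theta Theta' /\ spatial_iso hinv Theta'.
Proof.
move=> [[T1 homT] spT]; exists T1; have [TK TK1 cT cT1] := homT; split => //.
split; first by exists Theta.
move=> g; have [r c s] := spT (T1 g); rewrite TK1 in r c s.
by rewrite r c s !hK.
Qed.

(** * From an eventual conjugacy to a homeomorphism of groupoids *)

Section FromConjugacy.
Variables (l k : X -> nat) (l' k' : Y -> nat).
Hypothesis ec : eventual_conjugacy h hinv l k l' k'.

Let coeh : coe h hinv l k l' k'. Proof. by case: ec. Qed.
Let psh : preserves_stabilisers h hinv l k l' k'. Proof. by case: ec. Qed.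
Let lk x : dr_dom x -> l x = (k x + 1)%N. Proof. by case: ec => _ _; apply. Qed.

Lemma near_k x : dr_dom x -> \forall u \near x, k u = k x.
Proof.
move=> Dx; have := coe_k coeh.
rewrite continuous_open_subspace; last exact: dr_open_dom.
move=> /(_ x); rewrite inE => /(_ Dx) kc.
have n1 : nbhs (k x) [set k x] by exact: discrete_set1.
exact: (kc _ n1).
Qed.

(** One exponent [a] serves a whole neighbourhood because [k] is locally constant. This uniformity
    yields the continuity of the map on arrows. *)
Lemma conj_step n x : dr_domn n x -> exists a, \forall u \near x,
  eq_iter (n + a) (h u) a (h (dr_iter n u)).
Proof.
elim: n x => [|n IHn] x /= Dx.
  by exists 0%N; apply: nearW => u; split.
have [Dx1 Dxn] := Dx; have [a aP] := IHn _ Dxn.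
(* The second exponent that [eq_iter_comp] yields for [(k x + 1, k x)] followed by [(n + a, a)]. *)
exists (a + (k x - (n + a)))%N.
have aP' : nbhs x (@dr_sigma X @^-1` [set v | eq_iter (n + a) (h v) a (h (dr_iter n v))]).
  exact: sigma_continuous aP.
have nD : nbhs x (@dr_dom X) by apply: open_nbhs_nbhs; split => //; exact: dr_open_dom.
apply: filterS3 (near_k Dx1) nD aP' => u ku Du au.
have := coe_eq coeh Du; rewrite lk// ku => e1.
rewrite dr_iterS; have := eq_iter_comp e1 au.
by rewrite (_ : (k x + 1 + (n + a - k x) = n.+1 + (a + (k x - (n + a))))%N)//; lia.
Qed.

(** Both [h u] and [h v] are linked to the image under [h] of the point where the two orbits
    meet. *)
Lemma conj_local n m x y : eq_iter n x m y -> exists N M U V,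
  [/\ n%:Z - m%:Z = N%:Z - M%:Z, nbhs x U, nbhs y V &
    forall u v, U u -> V v -> eq_iter n u m v -> eq_iter N (h u) M (h v)].
Proof.
move=> [Dx Dy _]; have [a aP] := conj_step Dx; have [b bP] := conj_step Dy.
exists (n + a + (b - a))%N, (m + b + (a - b))%N.
exists [set u | eq_iter (n + a) (h u) a (h (dr_iter n u))].
exists [set v | eq_iter (m + b) (h v) b (h (dr_iter m v))].
split => //; first lia.
move=> u v ua /eq_iterC vb [_ _ E]; rewrite -E in vb.
exact: (eq_iter_comp ua vb).
Qed.

Lemma conj_arrow x p y : arrow_rel x p y -> arrow_rel (h x) p (h y).
Proof.
move=> [n [m [-> xy]]]; have [N [M [U [V [-> nU nV]]]]] := conj_local xy.
by move=> /(_ _ _ (nbhs_singleton nU) (nbhs_singleton nV) xy); exists N, M.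
Qed.

(** One inclusion comes from the arrows. For the other, move along the orbit to a periodic point
    [x']. There the cocycle sum over a period is the period itself, so [ps_l] gives [h x'] the same
    least stabiliser element as [x'], and both stabilisers consist of its multiples. *)
Lemma conj_Stab x q : Stab (h x) q <-> Stab x q.
Proof.
split; last by rewrite !StabP; exact: conj_arrow.
case hx : (Stab_min (h x)) => [p'|]; last first.
  by move=> /(Stab_min_None hx) ->; apply/StabP; exact: arrow_rel_refl.
case x0 : (Stab_min x) => [p|]; last first.
  by have /ps_finite := psh => /(_ x)[]; rewrite hx x0 => /(_ ltac:(by [])).
have [n [Dn per]] := Stab_min_periodic x0.
have xx' := arrow_rel_iter Dn; set x' := dr_iter n x in per xx'.
have [p0 xP] := Stab_minP x0.
have x'S r : Stab x' r <-> Stab x r.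
  by split; apply: Stab_arrow_rel; [exact: arrow_rel_sym xx'|exact: xx'].
have x'0 : Stab_min x' = Some p by rewrite (Stab_min_eq x'S).
have nt : Stab x' <> [set 0].
  move=> e; have : Stab x' p%:Z by apply/x'S/xP; exact: dvdzz.
  by rewrite e /=; lia.
have := ps_l psh nt x'0 per.
have [Dp _ _] := per; rewrite (cocycle_sum_1 lk Dp) /= => hx'.
move=> hxq; apply/xP; have [_ hP] := Stab_minP hx'; apply/hP.
exact: Stab_arrow_rel (conj_arrow xx') hxq.
Qed.

(** The equivalence provides an arrow of cocycle value [l' y - k' y] from [hinv y] to
    [hinv (dr_sigma y)]. Its image under [h], compared with the arrow of value 1 from [y] to
    [dr_sigma y], shows that the discrepancy [1 - (l' y - k' y)] lies in [Stab y]. By [conj_Stab] it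
    lies in [Stab (hinv y)], so composing with that isotropy arrow corrects the value to 1. *)
Lemma conj_arrow_inv_iter n y : dr_domn n y ->
  arrow_rel (hinv y) n%:Z (hinv (dr_iter n y)).
Proof.
elim: n y => [|n IHn] y; first by move=> _; exact: arrow_rel_refl.
move=> [Dy Dn]; rewrite intS dr_iterS; apply: arrow_rel_trans (IHn _ Dn).
have yy' : arrow_rel (hinv y) ((l' y)%:Z - (k' y)%:Z) (hinv (dr_sigma y)).
  by exists (l' y), (k' y); split => //; exact: coe_eq' coeh _ Dy.
have := conj_arrow yy'; rewrite !hinvK => /arrow_rel_sym yy''.
have D1 : dr_domn 1 y by [].
have := arrow_rel_trans (arrow_rel_iter D1) yy''.
move=> /StabP; rewrite -[y in Stab y]hinvK => /conj_Stab/StabP y1.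
have := arrow_rel_trans y1 yy'.
by congr arrow_rel; lia.
Qed.

Lemma conj_arrow_inv x p y : arrow_rel x p y -> arrow_rel (hinv x) p (hinv y).
Proof.
move=> [n [m [-> [Dx Dy E]]]]; apply: arrow_rel_trans (conj_arrow_inv_iter Dx) _.
by apply: arrow_rel_sym; rewrite E; exact: conj_arrow_inv_iter.
Qed.

Lemma conj_spatial : exists Theta, spatial_iso h Theta.
Proof.
pose Theta (g : DRgroupoid X) : DRgroupoid Y := DRArrow (conj_arrow (arrowP g)).
pose Theta' (g : DRgroupoid Y) : DRgroupoid X := DRArrow (conj_arrow_inv (arrowP g)).
have TK : cancel Theta Theta' by move=> g; apply: arrow_eq => //=; exact: hK.
have TK' : cancel Theta' Theta by move=> g; apply: arrow_eq => //=; exact: hinvK.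
exists Theta; split; last by [].
exists Theta'; split => //.
- move=> g W; have [n [m gnm]] := arrow_atP g; have [eg gg] := gnm.
  have [N [M [U [V [e nU nV UV]]]]] := conj_local gg.
  have hUV c : arrow_at n m c -> U (rng c) -> V (src c) -> arrow_at N M (Theta c).
    by move=> [ec' cc] Uc Vc; split; [rewrite /= ec'|exact: UV].
  have TgNM := hUV _ gnm (nbhs_singleton nU) (nbhs_singleton nV).
  move=> /(nbhs_arrow _ TgNM)[U1 [V1 [nU1 nV1 UVW]]].
  apply/(nbhs_arrow _ gnm); exists (U `&` h @^-1` U1), (V `&` h @^-1` V1); split.
  + by apply: filterI => //; exact: hc nU1.
  + by apply: filterI => //; exact: hc nV1.
  + by move=> c cnm [Uc U1c] [Vc V1c]; apply: UVW => //; exact: hUV.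
(* Continuity of the inverse does not follow by symmetry, since [conj_local] is about [h]. For [c]
   near [Theta g], openness of a power on [X] produces a [v] near [src g] linked to [hinv (rng c)].
   Then [h v] and [src c] agree after [M] steps, and injectivity of that power on [J] identifies
   them. *)
- move=> g'; rewrite -(TK' g'); move: (Theta' g') => {g'} g W; rewrite TK => nW.
  have [n [m gnm]] := arrow_atP g; have [eg gg] := gnm.
  have [N [M [U [V [e nU nV UV]]]]] := conj_local gg.
  have gNM := UV _ _ (nbhs_singleton nU) (nbhs_singleton nV) gg.
  have TgNM : arrow_at N M (Theta g) by split; [rewrite /= eg|].
  move: nW => /(nbhs_arrow _ gnm)[U1 [V1 [nU1 nV1 UVW]]].
  have [Dx Dy E] := gg; have [DX DY _] := gNM.
  have [J nJ iJ] := dr_iter_injective DY.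
  pose V0 := V `&` V1 `&` dr_domn m `&` h @^-1` J.
  have nV0 : nbhs (src g) V0.
    apply: filterI; last exact: hc nJ.
    by apply: filterI; [exact: filterI|exact: near_domn].
  have nnV : nbhs (rng g) (@dr_iter X n @^-1` (@dr_iter X m @` V0)).
    by apply: (dr_iter_continuous Dx); rewrite E; exact: dr_iter_open.
  pose U0 := U `&` U1 `&` dr_domn n `&` (@dr_iter X n @^-1` (@dr_iter X m @` V0)).
  have nU0 : nbhs (rng g) U0.
    apply: filterI => //; apply: filterI; last exact: near_domn.
    exact: filterI.
  apply/(nbhs_arrow _ TgNM).
  exists (hinv @^-1` U0), (hinv @^-1` V0); split.
  + by apply: hinvc; rewrite /= hK.
  + by apply: hinvc; rewrite /= hK.
  move=> c [ecc [Dc1 Dc2 Ec]] [[[Uc U1c] Dnc] [v [[[Vv V1v] Dv] Jv] vE]].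
  move=> [[_ _] Jc].
  have uv : eq_iter n (hinv (rng c)) m v by split.
  have [_ Dv' Ev] := UV _ _ Uc Vv uv; rewrite hinvK in Ev.
  have hv : h v = src c.
    by apply: iJ; [exact: Jv|move: Jc => /=; rewrite hinvK|rewrite -Ev].
  have vc : hinv (src c) = v by rewrite -hv hK.
  by apply: UVW => //=; [split; rewrite /= ?vc//; lia|rewrite vc].
Qed.

End FromConjugacy.

(** * From a homeomorphism of groupoids to an eventual conjugacy *)

Lemma spatial_arrow (Theta : DRgroupoid X -> DRgroupoid Y) x p y :
  spatial_iso h Theta -> arrow_rel x p y -> arrow_rel (h x) p (h y).
Proof.
move=> [_ spT] xy; have [r c s] := spT (DRArrow xy).
by have := arrowP (Theta (DRArrow xy)); rewrite r c s.
Qed.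

(* Taking the least possible exponent makes the cocycle locally constant. *)
Definition spatial_k (x : X) : nat :=
  match pselect (exists k, `[< eq_iter k.+1 (h x) k (h (dr_sigma x)) >]) with
  | left e => ex_minn e
  | right _ => 0%N
  end.

Lemma spatial_kP (Theta : DRgroupoid X -> DRgroupoid Y) x :
  spatial_iso h Theta -> dr_dom x ->
  eq_iter (spatial_k x).+1 (h x) (spatial_k x) (h (dr_sigma x)) /\
  forall k, eq_iter k.+1 (h x) k (h (dr_sigma x)) -> (spatial_k x <= k)%N.
Proof.
move=> spT Dx; rewrite /spatial_k; case: pselect => [e|ne].
  by case: ex_minnP => k /asboolP ? kmin; split => // j ?; apply: kmin; apply/asboolP.
exfalso; apply: ne; have D1 : dr_domn 1 x by [].
have [n [m [e E]]] := spatial_arrow spT (arrow_rel_iter D1).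
by exists m; apply/asboolP; rewrite (_ : m.+1 = n)//; lia.
Qed.

Lemma spatial_k_continuous (Theta : DRgroupoid X -> DRgroupoid Y) :
  spatial_iso h Theta -> {within @dr_dom X, continuous spatial_k}.
Proof.
move=> spT; have [[T1 [_ _ cT _]] spT'] := spT.
rewrite continuous_open_subspace; last exact: dr_open_dom.
move=> x; rewrite inE => Dx; have [kx kmin] := spatial_kP spT Dx.
have nD : nbhs x (@dr_dom X) by apply: open_nbhs_nbhs; split => //; exact: dr_open_dom.
have x1 : eq_iter 1 x 0 (dr_sigma x) by [].
(* Upper bound: by continuity of [Theta], the image of the arrow from [u] to [dr_sigma u] is still
   realised by the exponents found at [x], and the exponent at [u] is minimal. *)
have le1 : \forall u \near x, (spatial_k u <= spatial_k x)%N.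
  have xx : arrow_rel x 1 (dr_sigma x) by exists 1%N, 0%N.
  pose g := DRArrow xx; have [rg cg sg] := spT' g.
  have Tg : arrow_at (spatial_k x).+1 (spatial_k x) (Theta g).
    by split; rewrite ?rg ?cg ?sg//=; lia.
  have nT : nbhs (Theta g) [set c | arrow_at (spatial_k x).+1 (spatial_k x) c].
    by apply/(nbhs_arrow _ Tg); exists setT, setT; split => //; exact: filterT.
  have g10 : arrow_at 1 0 g by [].
  have /(nbhs_arrow _ g10)[U [V [nU nV UV]]] := cT _ _ nT.
  have nV' : nbhs x (@dr_sigma X @^-1` V) := sigma_continuous Dx nV.
  apply: filterS3 nD nU nV' => u Du Uu Vu.
  have [_ umin] := spatial_kP spT Du; apply: umin.
  have uu : arrow_rel u 1 (dr_sigma u) by exists 1%N, 0%N.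
  have [_ ] := UV (DRArrow uu) (conj erefl (And3 (conj Du I) I erefl)) Uu Vu.
  by have [-> _ ->] := spT' (DRArrow uu).
(* Lower bound: if [spatial_k x] is [j + 1], the equation with exponent [j] fails at [x], hence
   nearby because [Y] is Hausdorff, whereas an exponent at most [j] at [u] could be raised to
   [j]. *)
have le2 : \forall u \near x, (spatial_k x <= spatial_k u)%N.
  case kE : (spatial_k x) => [|j]; first exact: nearW.
  rewrite kE in kx kmin; have [Dh Dhs _] := kx.
  have Dj : dr_domn j (h (dr_sigma x)) by exact: dr_domn_le Dhs.
  have Dj1 : dr_domn j.+1 (h x) by exact: dr_domn_le Dh.
  have nj : dr_iter j.+1 (h x) <> dr_iter j (h (dr_sigma x)).
    by move=> E; have := kmin j (And3 Dj1 Dj E); lia.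
  have cf : {for x, continuous (fun u => dr_iter j.+1 (h u))}.
    by apply: (@continuous_comp _ _ _ h); [exact: hc|exact: dr_iter_continuous].
  have cg : {for x, continuous (fun u => dr_iter j (h (dr_sigma u)))}.
    apply: (@continuous_comp _ _ _ (@dr_sigma X) (fun v => dr_iter j (h v))).
      exact: sigma_continuous.
    apply: (@continuous_comp _ _ _ h (@dr_iter Y j)); first exact: hc.
    exact: dr_iter_continuous.
  have nDh : nbhs x (h @^-1` (@dr_domn Y j.+1)) by apply: hc; exact: near_domn.
  apply: filterS3 (near_neq (@dr_hausdorff Y) cf cg nj) nD nDh => u nu Du Dhu.
  rewrite leqNgt; apply/negP => lt.
  have [ku _] := spatial_kP spT Du.
  have [|||_ _] := @eq_iter_raise _ _ _ _ _ j.+1 j _ _ _ ku => //; lia.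
move=> A nA; change (nbhs x (spatial_k @^-1` A)).
apply: filterS2 le1 le2 => u l1 l2 /=.
by rewrite (_ : spatial_k u = spatial_k x); [exact: nbhs_singleton|lia].
Qed.

Lemma spatial_Stab (Theta : DRgroupoid X -> DRgroupoid Y) x q :
  spatial_iso h Theta -> Stab (h x) q <-> Stab x q.
Proof.
move=> spT; split; last by rewrite !StabP => xx; exact: spatial_arrow spT xx.
have [[T1 [_ TK _ _]] spT'] := spT.
move=> /StabP hx; have [r c s] := spT' (T1 (DRArrow hx)); rewrite TK /= in r c s.
apply/StabP; have [n [m [e a]]] := arrowP (T1 (DRArrow hx)).
exists n, m; split; first by rewrite -e -c.
by move: a; rewrite -[rng _]hK -[src _]hK -r -s hK.
Qed.

End Spatial.

Lemma spatial_conj (X Y : DRsystem) (h : X -> Y) (hinv : Y -> X)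
    (Theta : DRgroupoid X -> DRgroupoid Y) : homeomorphism h hinv ->
  spatial_iso h Theta ->
  exists (l k : X -> nat) (l' k' : Y -> nat), eventual_conjugacy h hinv l k l' k'.
Proof.
move=> hh spT; have [T1 [_ spT1]] := spatial_iso_sym hh spT.
have [hK hinvK hc hinvc] := hh.
have hh' : homeomorphism hinv h by [].
have cS (S : DRsystem) (k : S -> nat) : {within @dr_dom S, continuous k} ->
    {within @dr_dom S, continuous (fun x => (k x).+1)}.
  rewrite !(continuous_open_subspace _ (@dr_open_dom S)) => kc x Dx A nA.
  have n1 : nbhs (k x) [set k x] by exact: discrete_set1.
  have nx : nbhs x (k @^-1` [set k x]) := kc _ Dx _ n1.
  change (nbhs x ((fun x => (k x).+1) @^-1` A)).
  by apply: filterS nx => u /= ->; exact: nbhs_singleton.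
exists (fun x => (spatial_k h x).+1), (spatial_k h).
exists (fun y => (spatial_k hinv y).+1), (spatial_k hinv).
have Sh x : Stab_min (h x) = Stab_min x.
  by apply: Stab_min_eq => q; exact: spatial_Stab hh _ _ _ spT.
have Sh' y : Stab_min (hinv y) = Stab_min y by rewrite -[in RHS](hinvK y) Sh.
have one (S : DRsystem) (k : S -> nat) y : dr_dom y -> (k y).+1 = (k y + 1)%N.
  by rewrite addn1.
split; [split|split|] => //.
- by apply: cS; exact: spatial_k_continuous hh _ spT.
- exact: spatial_k_continuous hh _ spT.
- by apply: cS; exact: spatial_k_continuous hh' _ spT1.
- exact: spatial_k_continuous hh' _ spT1.
- by move=> x Dx; case: (spatial_kP spT Dx).
- by move=> x Dx; case: (spatial_kP spT1 Dx).
- by move=> x; rewrite Sh.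
- move=> x p _ xp [Dp _ _]; rewrite Sh xp (cocycle_sum_1 _ Dp)//; exact: one.
- move=> y p _ yp [Dp _ _]; rewrite Sh' yp (cocycle_sum_1 _ Dp)//; exact: one.
- by move=> x Dx; rewrite addn1.
Qed.

Lemma conj_iff_spatial (X Y : DRsystem) (h : X -> Y) (hinv : Y -> X) :
  homeomorphism h hinv ->
  (exists (l k : X -> nat) (l' k' : Y -> nat), eventual_conjugacy h hinv l k l' k')
  <-> exists Theta, spatial_iso h Theta.
Proof.
move=> hh; split; first by move=> [l [k [l' [k' ec]]]]; exact: (conj_spatial hh ec).
by move=> [T spT]; exact: spatial_conj hh spT.
Qed.

(** * Extension and automatic continuity for C*-algebras *)

Section CstarBasics.
Variables (R : realType) (A : cstarAlgebra R).
Local Notation C := (Cplx R).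
Implicit Types a b c : A.
Local Notation "a ** b" := (cs_mul a b) (at level 40, left associativity).
Local Notation "a ^#" := (cs_star a) (at level 8, format "a ^#").

Lemma cs_mul0l a : 0 ** a = 0.
Proof.
by have /eqP := cs_mulDl 0 0 a; rewrite addr0 -subr_eq subrr eq_sym => /eqP.
Qed.

Lemma cs_mul0r a : a ** 0 = 0.
Proof.
by have /eqP := cs_mulDr a 0 0; rewrite addr0 -subr_eq subrr eq_sym => /eqP.
Qed.

Lemma cs_mulNl a b : (- a) ** b = - (a ** b).
Proof. by apply/eqP; rewrite -addr_eq0 -cs_mulDl addNr cs_mul0l. Qed.

Lemma cs_mulNr a b : a ** (- b) = - (a ** b).
Proof. by apply/eqP; rewrite -addr_eq0 -cs_mulDr addNr cs_mul0r. Qed.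

Lemma cs_mulBl a b c : (a - b) ** c = a ** c - b ** c.
Proof. by rewrite cs_mulDl cs_mulNl. Qed.

Lemma cs_mulBr a b c : c ** (a - b) = c ** a - c ** b.
Proof. by rewrite cs_mulDr cs_mulNr. Qed.

Lemma cs_star0 : (0 : A)^# = 0.
Proof.
by have /eqP := cs_starD (0 : A) 0; rewrite addr0 -subr_eq subrr eq_sym => /eqP.
Qed.

Lemma cs_starN a : (- a)^# = - a^#.
Proof. by apply/eqP; rewrite -addr_eq0 -cs_starD addNr cs_star0. Qed.

Lemma cs_starB a b : (a - b)^# = a^# - b^#.
Proof. by rewrite cs_starD cs_starN. Qed.

Lemma cs_norm_star a : `|a^#| = `|a|.
Proof.
suff le b : `|b| <= `|b^#|.
  by apply/eqP; rewrite eq_le le andbT -{2}(cs_starK a) le.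
have [->|b0] := eqVneq b 0; first by rewrite cs_star0.
have := cs_norm_mul b^# b; rewrite cs_cstar expr2.
by rewrite ler_pM2r// normr_gt0.
Qed.

Lemma cs_starC a : {for a, continuous (@cs_star R A)}.
Proof.
apply/cvgrPdist_lt => e e0.
have : \forall b \near a, `|a - b| < e by move/cvgrPdist_lt : (@cvg_id _ (nbhs a)); apply.
by apply: filterS => b; rewrite -cs_starB cs_norm_star.
Qed.

Lemma cvg_cs_mul (T : Type) (F : set_system T) (f g : T -> A) a b : Filter F ->
  f @ F --> a -> g @ F --> b -> (fun t => f t ** g t) @ F --> a ** b.
Proof.
move=> FF /cvgrPdist_lt fa /cvgrPdist_lt gb; apply/cvgrPdist_lt => e e0.
(* This [d] is at most 1 and satisfies [d * M < e]; its form avoids a minimum in the partially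
   ordered [C]. *)
pose M := `|a| + `|b| + 1; pose d := e / (e + M).
have M0 : 0 < M by rewrite ltr_wpDl ?addr_ge0.
have eM0 : 0 < e + M by exact: addr_gt0.
have d0 : 0 < d by exact: divr_gt0.
have d1 : d <= 1 by rewrite ler_pdivrMr// mul1r lerDl ltW.
have dM : d * M < e by rewrite mulrAC ltr_pdivrMr// ltr_pM2l// ltrDr.
apply: filterS2 (fa d d0) (gb d d0) => t ft gt.
have -> : a ** b - f t ** g t = (a - f t) ** g t + a ** (b - g t).
  by rewrite cs_mulBl cs_mulBr [RHS]addrC subrKA.
apply: le_lt_trans dM; apply: le_trans (ler_normD _ _) _.
have gtb : `|g t| <= `|b| + 1.
  rewrite -[g t](subrK b); apply: le_trans (ler_normD _ _) _.
  rewrite addrC lerD2l distrC; apply: le_trans d1; exact: ltW.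
rewrite /M [d * _](_ : _ = d * (`|b| + 1) + `|a| * d); last by ring.
apply: lerD.
  apply: le_trans (cs_norm_mul _ _) _.
  by apply: ler_pM => //; exact: ltW.
apply: le_trans (cs_norm_mul _ _) _; apply: ler_wpM2l => //; exact: ltW.
Qed.

End CstarBasics.

(** * Complete normed spaces and extension by density *)

Section Completeness.
Variable R : realType.
Local Notation C := (Cplx R).

Lemma near_half_exp (e : C) : 0 < e -> exists N, forall n, (N <= n)%N -> (2^-1 : C) ^+ n < e.
Proof.
move=> e0; have er : e = ((complex.Re e)%:C)%C.
  by apply/eqP; rewrite eq_complex /= eqxx /=; move: e0; rewrite ltcE /= => /andP[/eqP ->].
have e0' : 0 < complex.Re e by move: e0; rewrite ltcE => /andP[].
have : (fun n => (2^-1 : R) ^+ n) @ \oo --> (0 : R).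
  by apply: cvg_expr; rewrite ger0_norm ?invr_ge0// invf_lt1 ?ltr1n.
move=> /cvgrPdist_lt/(_ _ e0')[N _ HN]; exists N => n Nn.
have := HN n Nn; rewrite sub0r normrN ger0_norm ?exprn_ge0 ?invr_ge0// er => h.
rewrite (_ : 2^-1 ^+ n = ((2^-1 ^+ n)%:C)%C); first by rewrite ltcR.
by rewrite rmorphXn /= fmorphV /= rmorph_nat.
Qed.

Lemma geometric_cvg (V : completeNormedModType C) (u : nat -> V) :
  (forall n, `|u n.+1 - u n| <= 2^-1 ^+ n) -> exists l : V, u @ \oo --> l.
Proof.
move=> hu.
have d n m : `|u (n + m)%N - u n| <= 2 * (2^-1 ^+ n - 2^-1 ^+ (n + m)).
  elim: m => [|m IH]; first by rewrite addn0 !subrr normr0 mulr0.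
  rewrite addnS -(subrKA (u (n + m)%N)); apply: le_trans (ler_normD _ _) _.
  apply: le_trans (lerD (hu _) IH) _; rewrite exprS.
  by rewrite le_eqVlt; apply/orP; left; apply/eqP; field.
suff : cauchy (u @ \oo) by move=> /cauchy_cvg/cvg_ex.
apply/cauchyP => e e0; have e20 : 0 < e / 2 by exact: divr_gt0.
have [N HN] := near_half_exp e20.
exists (u N); exists N => // n /= Nn; rewrite -ball_normE /= distrC -(subnKC Nn).
apply: le_lt_trans (d _ _) _.
apply: (@le_lt_trans _ _ (2 * 2^-1 ^+ N)).
  by rewrite ler_pM2l// gerBl exprn_ge0// invr_ge0.
by rewrite mulrC -ltr_pdivlMr//; exact: HN.
Qed.

(** The single inequality encodes that [Psi] extends [psi] (take [v = iota i]) and that it is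
    contractive, as [extension_dist] shows. It also spares a separate proof that [psi] factors
    through [iota]. *)
Lemma dense_extension (I : Type) (D : set I) (V W : completeNormedModType C)
    (iota : I -> V) (psi : I -> W) :
  closure [set iota i | i in D] = setT ->
  (forall i j, D i -> D j -> `|psi i - psi j| <= `|iota i - iota j|) ->
  exists Psi : V -> W, forall v i, D i -> `|Psi v - psi i| <= `|v - iota i|.
Proof.
move=> dn lip; suff /choice[Psi PsiP] : forall v, exists w, forall i, D i ->
    `|w - psi i| <= `|v - iota i| by exists Psi => v i; exact: PsiP.
move=> v.
pose F := filter_from [set e : C | 0 < e] (fun e => [set i | D i /\ `|v - iota i| < e]).
have FF : ProperFilter F.
  apply: filter_from_proper; last first.
    move=> e /= e0; have : closure [set iota i | i in D] v by rewrite dn.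
    move=> /(_ _ (nbhsx_ballx v e e0)) [_ [[i Di <-] vi]].
    by exists i; split => //; move: vi; rewrite -ball_normE.
  apply: filter_from_filter; first by exists 1 => /=.
  (* A positive number below both [e1] and [e2], again without a minimum. *)
  move=> e1 e2 /= e10 e20; exists (e1 * e2 / (e1 + e2)) => /=.
    by rewrite divr_gt0 ?mulr_gt0 ?addr_gt0.
  have e12 : 0 < e1 + e2 by rewrite addr_gt0.
  move=> i [Di vi]; split; split => //; apply: lt_trans vi _; rewrite ltr_pdivrMr//.
    by rewrite ltr_pM2l// ltrDr.
  by rewrite mulrC ltr_pM2l// ltrDl.
have cF : cauchy (psi @ F).
  apply/cauchyP => e e0; have e20 : 0 < e / 2 by exact: divr_gt0.
  have Fi : F [set i | D i /\ `|v - iota i| < e / 2] by exists (e / 2).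
  have [i [Di vi]] := filter_ex Fi.
  exists (psi i); change (F (psi @^-1` ball (psi i) e)).
  apply: filterS Fi => j [Dj vj]; rewrite -ball_normE /=.
  apply: le_lt_trans (lip _ _ Di Dj) _; rewrite [e]splitr -(subrKA v).
  by apply: le_lt_trans (ler_normD _ _) _; rewrite ltrD// distrC.
have /cauchy_cvg/cvg_ex[/= w Fw] := cF.
exists w => i Di; apply/ler_addgt0Pr => e e0; have e20 : 0 < e / 2 by exact: divr_gt0.
have Fj : F [set j | D j /\ `|v - iota j| < e / 2] by exists (e / 2).
have Fw' : F [set j | `|w - psi j| < e / 2].
  by move/cvgrPdist_lt : Fw => /(_ _ e20).
have [j [[Dj vj] wj]] := filter_ex (filterI Fj Fw').
rewrite -(subrKA (psi j)); apply: le_trans (ler_normD _ _) _.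
rewrite [e]splitr [leRHS](_ : _ = e / 2 + (e / 2 + `|v - iota i|)); last by ring.
apply: lerD; first exact: ltW.
apply: le_trans (lip _ _ Dj Di) _; rewrite -(subrKA v).
by apply: le_trans (ler_normD _ _) _; rewrite lerD2r distrC ltW.
Qed.

Lemma extension_dist (I : Type) (D : set I) (V W : completeNormedModType C)
    (iota : I -> V) (psi : I -> W) (Psi : V -> W) :
  closure [set iota i | i in D] = setT ->
  (forall v i, D i -> `|Psi v - psi i| <= `|v - iota i|) ->
  forall v w, `|Psi v - Psi w| <= `|v - w|.
Proof.
move=> dn PsiP v w; apply/ler_addgt0Pr => e e0.
have e20 : 0 < e / 2 by exact: divr_gt0.
have : closure [set iota i | i in D] w by rewrite dn.
move=> /(_ _ (nbhsx_ballx w _ e20)) [_ [[i Di <-]]]; rewrite -ball_normE /= => wi.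
rewrite -(subrKA (psi i)); apply: le_trans (ler_normD _ _) _.
rewrite [e]splitr addrA; apply: lerD; last first.
  by rewrite distrC; apply: le_trans (PsiP _ _ Di) _; exact: ltW.
apply: le_trans (PsiP _ _ Di) _; rewrite -(subrKA w).
by apply: le_trans (ler_normD _ _) _; rewrite lerD2l ltW.
Qed.

Lemma dist_continuous (V W : normedModType C) (f : V -> W) :
  (forall v w, `|f v - f w| <= `|v - w|) -> continuous f.
Proof.
move=> fd v; apply/(@cvgrPdist_lt _ _ _ (nbhs v) _) => e e0.
have : \forall w \near v, `|v - w| < e.
  by move/cvgrPdist_lt : (@cvg_id _ (nbhs v)); apply.
by apply: filterS => w vw; apply: le_lt_trans (fd _ _) _.
Qed.

Lemma dense_eq (I : Type) (D : set I) (V : completeNormedModType C)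
    (W : topologicalType) (iota : I -> V) (f g : V -> W) : hausdorff_space W ->
  closure [set iota i | i in D] = setT -> continuous f -> continuous g ->
  (forall i, D i -> f (iota i) = g (iota i)) -> forall v, f v = g v.
Proof.
move=> hW dn cf cg fg v; apply: hW => A B nA nB.
have nfA : nbhs v (f @^-1` A) := cf v _ nA.
have ngB : nbhs v (g @^-1` B) := cg v _ nB.
have : closure [set iota i | i in D] v by rewrite dn.
move=> /(_ _ (filterI nfA ngB)) [_ [[i Di <-] [/= Ai Bi]]].
by exists (f (iota i)); split => //; rewrite fg.
Qed.

End Completeness.

(** * Automatic continuity of algebraic isomorphisms *)

Section AutomaticContinuity.
Variables (R : realType) (A B : cstarAlgebra R) (phi : A -> B).
Local Notation C := (Cplx R).
Local Notation "a ** b" := (cs_mul a b) (at level 40, left associativity).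
Local Notation "a ^#" := (cs_star a) (at level 8, format "a ^#").

(* c = 1 - sqrt (1 - a^2) is the fixed point of c |-> (c^2 + a^2) / 2; it lives in
   the algebra without needing a unit. *)
Lemma cs_sqrt (a : A) : a^# = a -> `|a| <= 2^-1 ->
  exists c : A, [/\ c^# = c, c ** a = a ** c & c ** c + a ** a = 2 *: c].
Proof.
move=> sa na; pose u n := iter n (fun c => 2^-1 *: (c ** c + a ** a)) (0 : A).
have uS n : u n.+1 = 2^-1 *: (u n ** u n + a ** a) by [].
have conj2 : Num.conj (2^-1 : C) = 2^-1 by rewrite conj_Creal// rpredV realn.
have us n : (u n)^# = u n.
  elim: n => [|n IH]; first exact: cs_star0.
  by rewrite uS cs_starZ cs_starD !cs_starM IH sa conj2.
have uc n : u n ** a = a ** u n.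
  elim: n => [|n IH]; first by rewrite cs_mul0l cs_mul0r.
  by rewrite uS cs_scaleAl cs_scaleAr cs_mulDl cs_mulDr -!cs_mulA IH !cs_mulA IH.
have aa : `|a ** a| <= 4^-1.
  apply: le_trans (cs_norm_mul _ _) _; rewrite [leRHS](_ : _ = 2^-1 * 2^-1); last by field.
  exact: ler_pM.
(* The ball of radius 1/4 is stable under the iteration: [(1/16 + 1/4) / 2 = 5/32]. *)
have un n : `|u n| <= 4^-1.
  elim: n => [|n IH]; first by rewrite normr0 invr_ge0.
  rewrite uS normrZ ger0_norm ?invr_ge0//.
  apply: (@le_trans _ _ (2^-1 * (4^-1 * 4^-1 + 4^-1))).
    rewrite ler_wpM2l ?invr_ge0//; apply: le_trans (ler_normD _ _) _; apply: lerD => //.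
    by apply: le_trans (cs_norm_mul _ _) _; exact: ler_pM.
  have -> : 2^-1 * (4^-1 * 4^-1 + 4^-1) = 5 / 32 :> C by field.
  by rewrite ler_pdivrMr// ler_pdivlMl// -!natrM ler_nat.
have ud n : `|u n.+1 - u n| <= 2^-1 ^+ n.
  elim: n => [|n IH].
    rewrite subr0; apply: le_trans (un 1%N) _.
    by rewrite expr0 invf_le1// ler1n.
  rewrite [u n.+2]uS {2}[u n.+1]uS -scalerBr opprD addrACA subrr addr0.
  rewrite normrZ ger0_norm ?invr_ge0// exprS ler_wpM2l ?invr_ge0//.
  (* Each difference is multiplied by an iterate of norm at most 1/4, so the distance between
     successive iterates is at least halved. *)
  have -> : u n.+1 ** u n.+1 - u n ** u n =
      u n.+1 ** (u n.+1 - u n) + (u n.+1 - u n) ** u n.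
    by rewrite cs_mulBl cs_mulBr addrA subrK.
  apply: le_trans (ler_normD _ _) _.
  apply: (@le_trans _ _ (4^-1 * 2^-1 ^+ n + 2^-1 ^+ n * 4^-1)).
    by apply: lerD; (apply: le_trans (cs_norm_mul _ _) _; exact: ler_pM).
  rewrite [leLHS](_ : _ = 2^-1 * 2^-1 ^+ n); last by field.
  by rewrite ger_pMl ?exprn_gt0 ?invr_gt0// invf_le1// ler1n.
have [c uc'] := geometric_cvg ud.
have ucS : [sequence u n.+1]_n @ \oo --> c by rewrite cvg_shiftS.
have uq (a' b' : A) (f g : nat -> A) : f @ \oo --> a' -> g @ \oo --> b' ->
    (forall n, f n = g n) -> a' = b'.
  move=> fa gb /funext fg; rewrite fg in fa.
  exact: (cvg_unique (@norm_hausdorff _ A) fa gb).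
have ca : (fun _ : nat => a) @ \oo --> a by exact: cvg_cst.
exists c; split.
- apply: (uq _ _ (fun n => (u n)^#) u) => //.
  by apply: continuous_cvg => //; exact: cs_starC.
- by apply: (uq _ _ (fun n => u n ** a) (fun n => a ** u n)) => //; exact: cvg_cs_mul.
- have c2 : (fun n => 2 *: u n.+1) @ \oo --> 2 *: c by exact: cvgZr.
  apply: (uq _ _ (fun n => u n ** u n + a ** a) (fun n => 2 *: u n.+1)) => //.
    by apply: cvgD; exact: cvg_cs_mul.
  by move=> n; rewrite uS scalerA divff ?scale1r// pnatr_eq0.
Qed.

Hypothesis iso : cstar_iso phi.

Lemma hom_D (a b : A) : phi (a + b) = phi a + phi b.
Proof. by have := ci_linear iso 1 a b; rewrite !scale1r. Qed.

Lemma hom_0 : phi 0 = 0.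
Proof. by have := hom_D 0 0; rewrite addr0 => /eqP; rewrite -subr_eq subrr eq_sym => /eqP. Qed.

Lemma hom_Z z (a : A) : phi (z *: a) = z *: phi a.
Proof. by rewrite -[z *: a]addr0 (ci_linear iso) hom_0 addr0. Qed.

Lemma hom_B (a b : A) : phi (a - b) = phi a - phi b.
Proof. by rewrite hom_D -scaleN1r hom_Z scaleN1r. Qed.

(* u = b + i (1 - c) is formally unitary, so x |-> u x is isometric, and b is the
   average of u and its adjoint. *)
Lemma unitary_bound (b c : B) : b^# = b -> c^# = c -> c ** b = b ** c ->
  c ** c + b ** b = 2 *: c -> `|b| <= 1.
Proof.
move=> sb sc cb e.
(* Left multiplication by [b + s (1 - c)], written without a unit; it is used for [s = 'i] and
   [s = - 'i]. *)
pose L (s : C) x := b ** x + s *: (x - c ** x).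
have Liso s x : Num.conj s * s = 1 -> Num.conj s = - s -> `|L s x| = `|x|.
  move=> s1 s2; apply/eqP; rewrite -(@eqrXn2 _ 2)//; apply/eqP; rewrite -!cs_cstar.
  (* The cross terms cancel because [b] and [c] commute and [Num.conj s = - s]. What remains is
     [b^2 + (1 - c)^2 = 1], a rewriting of the hypothesis [e]. *)
  suff -> : (L s x)^# ** L s x = x^# ** x by [].
  rewrite /L cs_starD cs_starM cs_starZ cs_starB cs_starM sb sc.
  set y := b ** x; set w := x - c ** x; set y' := x^# ** b; set w' := x^# - x^# ** c.
  have yw : y' ** w = w' ** y.
    rewrite /w /w' cs_mulBr cs_mulBl /y /y' !cs_mulA; congr (_ - _ ** _).
    by rewrite -!cs_mulA cb.
  have yy : y' ** y + w' ** w = x^# ** x.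
    have e' : x^# ** c ** c ** x + x^# ** b ** b ** x = 2 *: (x^# ** c ** x).
      rewrite -cs_scaleAl -cs_scaleAr -e cs_mulDr cs_mulDl !cs_mulA.
      by [].
    have aux (P Q CC : B) : (Q + Q - CC) + (P - Q - (Q - CC)) = P.
      by rewrite opprB addrACA addKr (addrC P) addrA addrK (addrC Q P) addrK.
    rewrite -[RHS](aux _ (x^# ** c ** x) (x^# ** c ** c ** x)).
    congr (_ + _); last by rewrite /w /w' cs_mulBr !cs_mulBl !cs_mulA.
    rewrite /y /y' !cs_mulA -mulr2n -scaler_nat -e'.
    by rewrite addrAC subrr add0r.
  rewrite !(cs_mulDl, cs_mulDr) !(cs_scaleAl, cs_scaleAr) scalerA s2 yw.
  rewrite -s2 s1 scale1r s2 scaleNr.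
  by rewrite addrA addrK.
have i1 : Num.conj 'i * 'i = 1 :> C by rewrite conjCi mulNr -expr2 sqrCi opprK.
have i2 : Num.conj (- 'i) * - 'i = 1 :> C by rewrite rmorphN /= mulrNN.
have bx x : `|b ** x| <= `|x|.
  have : 2 *: (b ** x) = L 'i x + L (- 'i) x.
    by rewrite /L addrACA scaleNr subrr addr0 scaler_nat mulr2n.
  move=> /(congr1 (fun x => `|x|)); rewrite normrZ ger0_norm// => h.
  have := ler_normD (L 'i x) (L (- 'i) x); rewrite -h !Liso//; last first.
  - by rewrite conjCi.
  - by rewrite rmorphN /= conjCi.
  rewrite (_ : `|x| + `|x| = 2 * `|x|); last by ring.
  by rewrite ler_pM2l.
(* Multiplication by [b] is contractive; at [x = b] the C*-identity turns this into
   [|b|^2 <= |b|]. *)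
have [->|b0] := eqVneq b 0; first by rewrite normr0.
have := bx b; rewrite -{1}sb cs_cstar expr2.
by rewrite ger_pMl// normr_gt0.
Qed.

(** The identities of [cs_sqrt] are algebraic, so they survive under [phi] and [unitary_bound]
    applies to the image. The factor 2 comes from scaling [a] to norm 1/2. *)
Lemma hom_selfadjoint_bound (a : A) : a^# = a -> `|phi a| <= 2 * `|a|.
Proof.
move=> sa; have [->|a0] := eqVneq a 0; first by rewrite hom_0 !normr0 mulr0.
have na : 0 < `|a| by rewrite normr_gt0.
pose r : C := (2 * `|a|)^-1.
have r0 : 0 < r by rewrite invr_gt0 mulr_gt0.
have sra : (r *: a)^# = r *: a by rewrite cs_starZ sa conj_Creal// ger0_real// ltW.
have nra : `|r *: a| <= 2^-1.
  rewrite normrZ ger0_norm ?(ltW r0)// /r.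
  suff -> : (2 * `|a|)^-1 * `|a| = 2^-1 by [].
  by rewrite invfM -mulrA mulVf ?mulr1// normr_eq0.
have [c [sc ca e]] := cs_sqrt sra nra.
have : `|phi (r *: a)| <= 1.
  apply: (@unitary_bound _ (phi c)).
  - by rewrite -(ci_star iso) sra.
  - by rewrite -(ci_star iso) sc.
  - by rewrite -!(ci_mul iso) ca.
  - by rewrite -!(ci_mul iso) -hom_D e hom_Z.
rewrite hom_Z normrZ ger0_norm ?(ltW r0)// => h.
by rewrite -[leRHS]mulr1 -ler_pdivrMl// mulr_gt0.
Qed.

(** The self-adjoint bound is applied to [cs_mul (cs_star a) a]; the resulting factor 2 between
    squares is weakened to 4. *)
Lemma hom_bound (a : A) : `|phi a| <= 2 * `|a|.
Proof.
rewrite -(@ler_pXn2r _ 2) ?nnegrE ?mulr_ge0//.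
rewrite -cs_cstar -(ci_star iso) -(ci_mul iso).
apply: le_trans (hom_selfadjoint_bound _) _.
  by rewrite cs_starM cs_starK.
rewrite cs_cstar exprMn ler_wpM2r ?exprn_ge0//.
by rewrite -natrX ler_nat.
Qed.

Lemma hom_continuous : continuous phi.
Proof.
move=> a; apply/cvgrPdist_lt => e e0.
have e20 : 0 < e / 2 by exact: divr_gt0.
have : \forall b \near a, `|a - b| < e / 2.
  by move/cvgrPdist_lt : (@cvg_id _ (nbhs a)); apply.
apply: filterS => b ab; rewrite -hom_B; apply: le_lt_trans (hom_bound _) _.
by rewrite mulrC -ltr_pdivlMr.
Qed.

End AutomaticContinuity.

(** * The regular representation *)

Section Convolution.
Variables (R : realType) (S : DRsystem).
Local Notation C := (Cplx R).
Local Notation G := (DRgroupoid S).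
Implicit Types (f g : G -> C) (a b c d e : G) (x : S).

Definition rfib f x := [set a | rng a = x /\ f a != 0].

(** A factorisation of [c] is determined by its first factor, which may be any arrow with the range
    of [c]. *)
Lemma convE f g c :
  conv f g c = \sum_(a \in [set a | rng a = rng c]) f a * g (gmul (ginv a) c).
Proof.
rewrite /conv (@reindex_fsbig _ _ _ _ _ (fun a => (a, gmul (ginv a) c)) [set a | rng a = rng c])//.
split=> [a /= ac|a b _ _ [//]|[a b] /= [ab e]].
  have [r _ _] := @gmulE _ (ginv a) c ac; split; first by rewrite r.
  exact: gmulKV.
have [r _ _] := gmulE ab; exists a; first by rewrite /= -e r.
by rewrite -e gmulVK.
Qed.

(** Lets several convolutions be summed over one common finite set. *)
Lemma conv_sub f g c (A : set G) : A `<=` [set a | rng a = rng c] ->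
  rfib f (rng c) `<=` A -> conv f g c = \sum_(a \in A) f a * g (gmul (ginv a) c).
Proof.
move=> Ac fA; rewrite convE; apply/esym/fsbig_widen => // a [/= ac nA].
have [->|fa] := eqVneq (f a) 0; first exact: mul0r.
by exfalso; apply: nA; apply: fA.
Qed.

Lemma conv_single f g c a : rng a = rng c ->
  (forall b, rng b = rng c -> f b != 0 -> b = a) ->
  conv f g c = f a * g (gmul (ginv a) c).
Proof.
move=> ac fa; rewrite (@conv_sub _ _ _ [set a]) ?fsbig_set1//.
  by move=> _ ->.
by move=> b [bc fb]; exact: fa.
Qed.

Lemma conv_eq0 f g c : (forall b, rng b = rng c -> f b = 0) -> conv f g c = 0.
Proof.
move=> f0; rewrite (@conv_sub _ _ _ set0) ?fsbig_set0//.
by move=> b [bc]; rewrite f0// eqxx.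
Qed.

Definition finite_rfib f := forall x, finite_set (rfib f x).

Lemma convDl f1 f2 g c : finite_rfib f1 -> finite_rfib f2 ->
  conv (fun a => f1 a + f2 a) g c = conv f1 g c + conv f2 g c.
Proof.
move=> h1 h2; pose A := rfib f1 (rng c) `|` rfib f2 (rng c).
have fA : finite_set A by rewrite finite_setU.
have Ac : A `<=` [set a | rng a = rng c] by move=> a [] [].
rewrite (@conv_sub f1 _ _ A)//; last exact: subsetUl.
rewrite (@conv_sub f2 _ _ A)//; last exact: subsetUr.
rewrite (@conv_sub _ _ _ A)//; last first.
  move=> a [ac]; have [f1a|f1a _] := eqVneq (f1 a) 0; last by left.
  by rewrite f1a add0r; right.
by rewrite -fsbig_split//; apply: eq_fsbigr => a _; rewrite mulrDl.
Qed.

Lemma convZl z f g c : finite_rfib f ->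
  conv (fun a => z * f a) g c = z * conv f g c.
Proof.
move=> h; have Ac : rfib f (rng c) `<=` [set a | rng a = rng c] by move=> a [].
rewrite (@conv_sub f _ _ _ Ac)// (@conv_sub _ _ _ _ Ac); last first.
  by move=> a [ac fa]; split => //; apply: contra_neq fa => ->; rewrite mulr0.
by rewrite !fsbig_finite// mulr_sumr; apply: eq_bigr => a _; rewrite mulrA.
Qed.

Lemma conv_linr f (v w : G -> C) z c : finite_rfib f ->
  conv f (fun a => z * v a + w a) c = z * conv f v c + conv f w c.
Proof.
move=> h; have Ac : rfib f (rng c) `<=` [set a | rng a = rng c] by move=> a [].
rewrite !(@conv_sub f _ _ _ Ac)// !fsbig_finite// mulr_sumr -big_split /=.
by apply: eq_bigr => a _; rewrite mulrDr mulrCA.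
Qed.

(** Here [v] is arbitrary, so that the lemma applies to vectors of [l2]; finiteness comes from [f]
    and [g] alone. *)
Lemma convA f g (v : G -> C) c : finite_rfib f -> finite_rfib g ->
  conv (conv f g) v c = conv f (conv g v) c.
Proof.
move=> hf hg; pose A := rfib f (rng c).
have Ac : A `<=` [set a | rng a = rng c] by move=> a [].
(* All products of supporting arrows of [f] and [g] with range [rng c]; outside [E], [conv f g]
   vanishes on that fibre. *)
pose E := \bigcup_(a in A) [set gmul a b | b in rfib g (src a)].
have fE : finite_set E.
  apply: bigcup_finite; first exact: hf.
  by move=> a _; apply: finite_image; exact: hg.
have Ec : E `<=` [set a | rng a = rng c].
  move=> _ [a Aa [b [ba _] <-]]; have [r _ _] := gmulE (esym ba).
  by rewrite /= r; exact: Ac.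
rewrite (@conv_sub (conv f g) _ _ E Ec); last first.
  move=> e [ec]; apply: contra_neqP => nE; rewrite convE fsbig1// => a /= ae.
  have [->|fa] := eqVneq (f a) 0; first exact: mul0r.
  have [->|ga] := eqVneq (g (gmul (ginv a) e)) 0; first exact: mulr0.
  exfalso; apply: nE; exists a; first by split; rewrite ?ae.
  exists (gmul (ginv a) e); last exact: gmulKV.
  by have [r _ _] := @gmulE _ (ginv a) e ae; split.
transitivity (\sum_(e \in E) \sum_(a \in A)
    f a * g (gmul (ginv a) e) * v (gmul (ginv e) c)).
  apply: eq_fsbigr => e; rewrite inE => /Ec /= ec.
  rewrite (@conv_sub f g e A) ?ec//.
  by rewrite !(fsbig_finite _ _ (hf _)) mulr_suml.
rewrite exchange_fsbig//; last exact: hf.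
rewrite (@conv_sub f _ c A)//; apply: eq_fsbigr => a; rewrite inE => -[ac fa].
have [ra sa _] := @gmulE _ (ginv a) c ac.
have Bc : rfib g (src a) `<=` [set b | rng b = rng (gmul (ginv a) c)].
  by move=> b [bc _]; rewrite /= ra.
rewrite (@conv_sub g _ _ _ Bc); last by rewrite ra.
(* For fixed [a] only the products [gmul a b] in [E] contribute, and they are reindexed by [b]. *)
rewrite -(@fsbig_widen _ _ _ _ [set gmul a b | b in rfib g (src a)] E) //; last 2 first.
- by move=> _ [b gb <-]; exists a => //; exists b.
- move=> e [/Ec /= ec ne]; have [->|ga] := eqVneq (g (gmul (ginv a) e)) 0.
    by rewrite mulr0 mul0r.
  exfalso; apply: ne; exists (gmul (ginv a) e); last by apply: gmulKV; rewrite ac.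
  by have [r _ _] := @gmulE _ (ginv a) e (etrans ac (esym ec)); split.
rewrite (@reindex_fsbig _ _ _ _ _ (gmul a) (rfib g (src a))); last first.
  split=> [b gb|b1 b2|_ [b gb <-]]; [by exists b| |by exists b].
  by rewrite !inE => -[r1 _] [r2 _] e; rewrite -(gmulVK (esym r1)) e gmulVK.
rewrite !(fsbig_finite _ _ (hg _)) mulr_sumr; apply: eq_big_seq => b.
rewrite in_fset_set; last exact: hg.
rewrite inE => -[bc gb]; rewrite gmulVK// -mulrA; congr (_ * (_ * v _)).
have [r1 s1 c1] := gmulE (esym bc).
have [r2 s2 c2] := @gmulE _ (ginv (gmul a b)) c (etrans r1 ac).
have [r3 s3 c3] := @gmulE _ (ginv b) (gmul (ginv a) c) (etrans bc (esym ra)).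
have [_ _ c4] := @gmulE _ (ginv a) c ac.
by apply: arrow_eq; rewrite ?r2 ?r3 ?s2 ?s3 ?c2 ?c3 ?sa ?c4//= c1; lia.
Qed.

(** A bisection contains at most one arrow with a given range, and [Cc_ind] reduces to functions
    supported in bisections. *)
Lemma finite_rfib_Cc f : Cc f -> finite_rfib f.
Proof.
move: f; apply: Cc_ind => [x|f g _ _ hf hg x|f [Z [K [[_ iZ _] _ KZ _ f0]]] x].
- by rewrite (_ : rfib _ _ = set0)//; apply/seteqP; split => // a [_]; rewrite eqxx.
- apply: (@sub_finite_set _ _ (rfib f x `|` rfib g x)); last by rewrite finite_setU.
  move=> a [ax]; have [->|fa _] := eqVneq (f a) 0; last by left.
  by rewrite add0r; right.
- have fZ a : f a != 0 -> Z a by move=> fa; apply: KZ; apply: contrapT => /f0/eqP; rewrite (negPf fa).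
  have [e|/set0P[a [ax fa]]] := eqVneq (rfib f x) set0; first by rewrite e.
  apply: (@sub_finite_set _ _ [set a]) => // b [bx fb].
  by apply: iZ; [exact: fZ|exact: fZ|rewrite bx].
Qed.

Lemma Cc_invol f : Cc f -> Cc (invol f).
Proof.
move=> cf; have hi : homeomorphism (@ginv S) (@ginv S).
  by split; [exact: ginvK|exact: ginvK|exact: ginv_continuous|exact: ginv_continuous].
have [cfi kfi] := Cc_comp hi cf; split.
  have cj : continuous (fun z : C => Num.conj z).
    move=> z; apply/(@cvgrPdist_lt _ _ _ (nbhs z) _) => e e0.
    have : \forall w \near z, `|z - w| < e.
      by move/cvgrPdist_lt : (@cvg_id _ (nbhs z)); apply.
    by apply: filterS => w; rewrite -rmorphB norm_conjC.
  move=> c; apply: (@continuous_comp _ _ _ (f \o @ginv S) (fun z : C => Num.conj z)).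
    exact: cfi.
  exact: cj.
rewrite (_ : [set t | invol f t != 0] = [set t | (f \o @ginv S) t != 0])//.
by apply/seteqP; split => a /=; rewrite /invol conjC_eq0.
Qed.

Lemma Cc_bounded f : Cc f -> exists2 M : C, 0 <= M & forall c, `|f c| <= M.
Proof.
move=> [cf kf]; pose g c : R := complex.Re `|f c|.
have cRe : continuous (fun z : C => complex.Re `|z| : R).
  move=> z; apply/(@cvgrPdist_lt _ _ _ (nbhs z) _) => e e0.
  have eC : 0 < (e%:C)%C :> C by rewrite ltcR.
  have : \forall w \near z, `|z - w| < (e%:C)%C.
    by move/cvgrPdist_lt : (@cvg_id _ (nbhs z)); apply.
  apply: filterS => w zw; rewrite -raddfB.
  apply: le_lt_trans (Re_le_norm _) _.
  have : `|(`|z| - `|w|)| < (e%:C)%C :> C by apply: le_lt_trans zw; exact: ler_dist_dist.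
  by rewrite ltcE => /andP[].
have cg : continuous g.
  by move=> c; apply: (@continuous_comp _ _ _ f (fun z : C => complex.Re `|z| : R)); [exact: cf|exact: cRe].
have kg : compact (g @` closure [set t | f t != 0]).
  by apply: continuous_compact; [exact: continuous_subspaceT|].
have [M [Mr Mb]] := compact_bounded kg.
have M1 : M < `|M| + 1 by rewrite ltr_pwDr// ler_norm.
exists ((`|M| + 1)%:C)%C; first by rewrite lecR addr_ge0.
move=> c; have [->|fc] := eqVneq (f c) 0; first by rewrite normr0 lecR addr_ge0.
rewrite (Cplx_real (normr_ge0 (f c))) lecR.
apply: le_trans (Mb _ M1 (g c) _); first exact: ler_norm.
by exists c => //; exact: subset_closure.
Qed.

End Convolution.

(** * Bounded operators on l2(G) and their adjoints *)

Section RegularRepresentation.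
Variables (R : realType) (S : DRsystem).
Local Notation C := (Cplx R).
Local Notation G := (DRgroupoid S).
Local Notation H := (l2 R G).
Implicit Types (f g : G -> C) (a b c d e : G) (x : S).

(** That [conv f xi] is square-summable has to be proved, so it is decided here; [regular_bound_aux]
    rules out the default branch for [f] in C_c(G). *)
Definition regular f (xi : H) : H :=
  match pselect (exists eta : H, forall c, eta c = conv f xi c) with
  | left ex => sval (cid ex)
  | right _ => 0
  end.

Lemma regularE f (xi eta : H) : (forall c, eta c = conv f xi c) -> regular f xi = eta.
Proof.
move=> e; rewrite /regular; case: pselect => [ex|[]]; last by exists eta.
by apply: l2_ext => c; rewrite e; case: cid.
Qed.

Lemma l2_mem (u : G -> C^o) (M : C) :
  (forall F : {fset G}, fsum (fun c => `|u c| ^+ 2 : C) F <= M) ->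
  exists2 v : H, (forall c, v c = u c) & `|v| ^+ 2 <= M.
Proof.
move=> uM; have ul : u \in (@l2_pred R G) by apply/asboolP; exists M.
exists (L2 ul) => //; rewrite l2_normE l2norm_sq.
by have [_] := inner_sqE (L2 ul); apply.
Qed.

Lemma l2_fsum_le (v : H) (F : {fset G}) : fsum (fun c => `|v c| ^+ 2 : C) F <= `|v| ^+ 2.
Proof. by rewrite l2_normE l2norm_sq; have [+ _] := inner_sqE v; exact. Qed.

(** For [f] supported in a bisection, convolution is a weighted partial permutation of the
    coordinates, bounded by a bound of [f]; [Cc_ind] adds up such bounds. *)
Lemma regular_bound_aux f : Cc f ->
  exists2 M : C, 0 <= M & forall xi : H, exists2 eta : H,
    (forall c, eta c = conv f xi c) & `|eta| <= M * `|xi|.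
Proof.
move: f; apply: Cc_ind => [|f g cf cg [M M0 HM] [N N0 HN]|f bf].
- exists 0 => // xi; exists 0; last by rewrite normr0 mul0r.
  by move=> c; rewrite conv_eq0.
- exists (M + N); first exact: addr_ge0.
  move=> xi; have [u uE un] := HM xi; have [v vE vn] := HN xi.
  exists (u + v).
    by move=> c; rewrite convDl; [rewrite -uE -vE|exact: finite_rfib_Cc|exact: finite_rfib_Cc].
  by rewrite mulrDl; apply: le_trans (ler_normD _ _) _; exact: lerD.
have cf := bisection_fun_Cc bf; have [M M0 fM] := Cc_bounded cf.
have [Z [K [bZ _ KZ _ f0]]] := bf; have [_ iZ jZ] := bZ.
have fZ a : f a != 0 -> Z a.
  by move=> fa; apply: KZ; apply: contrapT => /f0/eqP; rewrite (negPf fa).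
have [s [_ sK _]] := bisection_section bZ.
exists M => // xi.
(* At [c], the convolution reads the coordinate of [xi] at [phi c]; [P] marks the arrows whose range
   is met by the bisection. *)
pose phi c := gmul (ginv (s (rng c))) c.
pose P c := `[< exists2 a, Z a & rng a = rng c >].
have convP c : P c -> conv f xi c = f (s (rng c)) * xi (phi c).
  move=> /asboolP[a Za ac]; have sa : s (rng c) = a by rewrite -ac sK.
  rewrite /phi sa; apply: conv_single => // b bc fb.
  by apply: iZ => //; [exact: fZ|rewrite bc].
have convN c : ~~ P c -> conv f xi c = 0.
  move=> /asboolP nP; apply: conv_eq0 => b bc; apply: contrapT => /eqP fb.
  by apply: nP; exists b => //; exact: fZ.
have phi_inj c d : P c -> P d -> phi c = phi d -> c = d.
  move=> /asboolP[a Za ac] /asboolP[b Zb bd].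
  rewrite /phi -ac -bd !sK// => e.
  have [_ s1 _] := @gmulE _ (ginv a) c ac; have [_ s2 _] := @gmulE _ (ginv b) d bd.
  have [r1 _ _] := @gmulE _ (ginv a) c ac; have [r2 _ _] := @gmulE _ (ginv b) d bd.
  have ab : a = b by apply: jZ => //; move: r1; rewrite e r2.
  by rewrite -(gmulKV ac) e ab gmulKV.
have [eta etaE etan] : exists2 v : H, (forall c, v c = conv f xi c) &
    `|v| ^+ 2 <= M ^+ 2 * `|xi| ^+ 2.
  apply: l2_mem => F.
  (* Only coordinates with [P] contribute, and [phi] is injective on them, so no coordinate of [xi]
     is counted twice. *)
  pose F' := [fset c in F | P c]%fset.
  apply: (@le_trans _ _ (\sum_(c <- F') M ^+ 2 * `|xi (phi c) : C| ^+ 2)).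
    rewrite /fsum (big_fsetID _ P F) /= [X in _ + X]big1_seq ?addr0.
      rewrite big_seq [leRHS]big_seq; apply: ler_sum => c.
      rewrite !finmap.inE /= => /andP[_ Pc].
      by rewrite (convP _ Pc) normrM exprMn ler_wpM2r ?exprn_ge0// ler_pXn2r ?nnegrE.
    move=> c /=; rewrite !finmap.inE /= => /andP[_ nP].
    by rewrite (convN _ nP) normr0 expr0n.
  rewrite -mulr_sumr ler_wpM2l ?exprn_ge0//.
  apply: le_trans (l2_fsum_le xi (phi @` F')%fset); rewrite /fsum.
  rewrite [leRHS](_ : _ = \sum_(c <- F') `|xi (phi c) : C| ^+ 2)//.
  rewrite big_imfset// => c d; rewrite !finmap.inE /= => /andP[_ Pc] /andP[_ Pd]; exact: phi_inj.
exists eta => //.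
by rewrite -(@ler_pXn2r _ 2) ?nnegrE ?mulr_ge0// exprMn.
Qed.

Lemma regular_coord f (xi : H) c : Cc f -> regular f xi c = conv f xi c.
Proof.
move=> /regular_bound_aux[M _ /(_ xi)[eta etaE _]].
by rewrite (regularE etaE).
Qed.

Lemma regular_bound f : Cc f -> exists2 M : C, 0 <= M &
  forall xi : H, `|regular f xi| <= M * `|xi|.
Proof.
move=> /regular_bound_aux[M M0 HM]; exists M => // xi.
by have [eta etaE etan] := HM xi; rewrite (regularE etaE).
Qed.

Lemma regular_linear f : Cc f -> linear (regular f).
Proof.
move=> cf z u v; apply: l2_ext => c.
rewrite (_ : (z *: regular f u + regular f v) c = z * regular f u c + regular f v c)//.
rewrite !regular_coord// -conv_linr//; exact: finite_rfib_Cc.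
Qed.

Lemma regular_continuous f : Cc f -> continuous (regular f).
Proof.
move=> cf u; have [M M0 HM] := regular_bound cf.
have fB v w : regular f (v - w) = regular f v - regular f w.
  have := regular_linear cf (-1) w v; by rewrite !scaleN1r !(addrC (- _)).
apply/(@cvgrPdist_lt _ _ _ (nbhs u) _) => e e0; pose d := e / (M + 1).
have M1 : 0 < M + 1 by rewrite ltr_wpDl.
have d0 : 0 < d by exact: divr_gt0.
have : \forall v \near u, `|u - v| < d.
  by move/cvgrPdist_lt : (@cvg_id _ (nbhs u)); apply.
apply: filterS => v uv; rewrite -fB; apply: le_lt_trans (HM _) _.
apply: (@le_lt_trans _ _ (M * d)); first by rewrite ler_wpM2l// ltW.
by rewrite mulrCA gtr_pMr// ltr_pdivrMr// mul1r ltrDl.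
Qed.

Definition delta c : G -> C^o := fun d => (d == c)%:R.

Lemma delta_fsum c (h : G -> C) (F : {fset G}) : c \in F ->
  fsum (fun d => (d == c)%:R * h d) F = h c.
Proof.
move=> cF; rewrite /fsum (big_fsetD1 c)//= eqxx mul1r big1_seq ?addr0// => d.
by rewrite in_fsetD1 => /= /andP[/negPf-> _]; rewrite mul0r.
Qed.

Lemma delta_l2 c : delta c \in (@l2_pred R G).
Proof.
apply/asboolP; exists 1 => F; rewrite /fsum.
apply: (@le_trans _ _ (\sum_(d <- (c |` F)%fset) `|delta c d : C| ^+ 2)).
  by apply: ler_sum_fset; [exact: fsubsetU1|move=> d; exact: exprn_ge0].
rewrite (big_fsetD1 c) ?fset1U1//= big1_seq ?addr0; last first.
  by move=> d /=; rewrite in_fsetD1 /delta => /andP[/negPf-> _]; rewrite normr0 expr0n.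
by rewrite /delta eqxx normr1 expr1n.
Qed.

Definition deltaH c : H := L2 (delta_l2 c).
Arguments deltaH : simpl never.

Lemma deltaHE c d : deltaH c d = (d == c)%:R.
Proof. by []. Qed.

Lemma deltaE c d : delta c d = (d == c)%:R.
Proof. by []. Qed.

Lemma inner_delta (u : H) c : inner u (deltaH c) = u c.
Proof.
apply: (@cvg_unique _ _ (fsum (fun i => u i * Num.conj (deltaH c i)) @ totally)).
- exact: norm_hausdorff.
- exact: inner_cvg.
apply: cvg_near_cst; exists [fset c]%fset => // F /= cF.
have {}cF : c \in F by rewrite -fsub1set.
rewrite -(delta_fsum u cF) /fsum; apply: eq_bigr => d _.
by rewrite mulrC deltaE; case: eqP => _; rewrite ?conjC1 ?conjC0.
Qed.

Lemma norm_delta c : `|deltaH c| = 1.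
Proof.
apply/eqP; rewrite -(@eqrXn2 _ 2)// expr1n -l2_inner_norm inner_delta.
by rewrite /deltaH /= /delta eqxx.
Qed.

Lemma inner_norm_le (u v : H) : `|inner u v| <= `|u| * `|v|.
Proof.
rewrite -(@ler_pXn2r _ 2) ?nnegrE ?mulr_ge0// exprMn -!l2_inner_norm.
exact: cauchy_schwarz.
Qed.

Lemma l2_coordD (u v : H) c : (u + v) c = u c + v c.
Proof. by []. Qed.

Lemma l2_coordZ z (u : H) c : (z *: u) c = z * u c.
Proof. by []. Qed.

Lemma l2_coord_sum (I : Type) (s : seq I) (h : I -> H) c :
  (\sum_(i <- s) h i) c = \sum_(i <- s) h i c.
Proof. by elim: s => [|i s IH]; rewrite ?big_nil// !big_cons l2_coordD IH. Qed.

Lemma inner_sumr (I : Type) (s : seq I) (h : I -> H) u :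
  inner u (\sum_(i <- s) h i) = \sum_(i <- s) inner u (h i).
Proof.
elim: s => [|i s IH]; last by rewrite !big_cons innerDr IH.
by rewrite !big_nil -[0 : H](scale0r 0) innerZr rmorph0 mul0r.
Qed.

(** Finite combinations of point masses are dense. Only additivity is asked of [T], since
    [regular_star] applies this to a conjugate-linear functional. *)
Lemma delta_total (T : H -> C) (M : C) : 0 <= M ->
  (forall u v, T (u + v) = T u + T v) -> (forall u, `|T u| <= M * `|u|) ->
  (forall z c, T (z *: deltaH c) = 0) -> forall u, T u = 0.
Proof.
move=> M0 TD TM Td u; apply/eqP; rewrite -normr_le0; apply/ler_addgt0Pr => e e0.
rewrite add0r; pose d := e / (M + 1); have M1 : 0 < M + 1 by rewrite ltr_wpDl.
have d0 : 0 < d by exact: divr_gt0.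
have T0 : T 0 = 0 by have := TD 0 0; rewrite addr0 => /eqP; rewrite -subr_eq subrr eq_sym => /eqP.
have [F uF] : exists F : {fset G}, `|u - \sum_(c <- F) u c *: deltaH c| <= d.
  have [s [cs s1 s2]] := sqsum_cvg u.
  have d20 : 0 < d ^+ 2 by exact: exprn_gt0.
  have [F _ HF] : \forall F \near totally, `|s - fsum (fun i => `|u i| ^+ 2) F| < d ^+ 2.
    by move/cvgrPdist_lt : cs; apply.
  exists F; move wE : (u - \sum_(c <- F) u c *: deltaH c) => w.
  rewrite -(@ler_pXn2r _ 2) ?nnegrE ?(ltW d0)//.
  rewrite -l2_inner_norm; have [_] := inner_sqE w; apply => K.
  (* [w] is the part of [u] off [F], so its squared norm is at most [s] minus the partial sum over
     [F]. *)
  have cE c : w c = if c \in F then 0 else u c.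
    rewrite -wE (_ : (u - _) c = u c - (\sum_(c <- F) u c *: deltaH c) c)// l2_coord_sum.
    case: ifP => cF.
      rewrite (big_fsetD1 c)// big1_seq.
        by rewrite l2_coordZ deltaHE eqxx mulr1 /= addr0 subrr.
      move=> b; rewrite andTb in_fsetD1 l2_coordZ deltaHE eq_sym => /andP[/negPf-> _].
      by rewrite mulr0.
    rewrite big1_seq ?subr0// => b; rewrite andTb => bF; rewrite l2_coordZ deltaHE.
    by case: eqP => [cb|_]; [rewrite cb bF in cF|rewrite mulr0].
  have le1 : fsum (fun i => `|w i : C| ^+ 2) K +
      fsum (fun i => `|u i| ^+ 2) F <= s.
    apply: le_trans (s1 (F `|` K)%fset).
    rewrite addrC /fsum (big_fsetID _ (mem F) (F `|` K)%fset) /=.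
    rewrite (_ : [fset x in (F `|` K)%fset | x \in F]%fset = F); last first.
      by apply/fsetP => x; rewrite !finmap.inE /=; case: (x \in F); rewrite /= ?andbF.
    rewrite lerD2l (big_fsetID _ (mem F) K) /= big1_seq ?add0r; last first.
      by move=> b; rewrite cE !finmap.inE /= => /andP[_ ->]; rewrite normr0 expr0n.
    rewrite (_ : [fset x in (F `|` K)%fset | x \notin F]%fset = [fset x in K | x \notin F]%fset).
      rewrite big_seq [leRHS]big_seq; apply: ler_sum => b; rewrite cE !finmap.inE /= => /andP[_ /negPf->].
      exact: lexx.
    by apply/fsetP => x; rewrite !finmap.inE /=; case: (x \in F); rewrite ?andbF.
  apply: (@le_trans _ _ (s - fsum (fun i => `|u i| ^+ 2) F)); first by rewrite lerBrDr.
  have := HF F (fsubset_refl _) => /ltW; apply: le_trans.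
  by apply: real_ler_norm; apply: ger0_real; rewrite subr_ge0.
have : T (\sum_(c <- F) u c *: deltaH c) = 0.
  by elim: (enum_fset F) => [|c s IH]; rewrite ?big_nil// big_cons TD Td IH addr0.
move=> TF; rewrite -[u](subrK (\sum_(c <- F) u c *: deltaH c)) TD TF addr0.
apply: le_trans (TM _) _; apply: (@le_trans _ _ (M * d)); first by rewrite ler_wpM2l.
by rewrite mulrCA ger_pMr// ler_pdivrMr// mul1r lerDl.
Qed.

Lemma involK f : invol (invol f) = f.
Proof. by apply/funext => c; rewrite /invol ginvK conjCK. Qed.

(** The only first factor that contributes to the convolution is [gmul d (ginv c)]. *)
Lemma regular_coord_delta f c d : Cc f -> regular f (deltaH c) d =
  if src d == src c then f (gmul d (ginv c)) else 0.
Proof.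
move=> cf; rewrite regular_coord//; case: eqP => [dc|ndc]; last first.
  rewrite convE fsbig1// => a ad; rewrite deltaHE; case: eqP => [e|]; last by rewrite mulr0.
  by have [_ s _] := @gmulE _ (ginv a) d ad; case: ndc; rewrite -s e.
pose a := gmul d (ginv c); have [r s k] := @gmulE _ d (ginv c) dc.
rewrite convE -(@fsbig_widen _ _ _ _ [set a]) ?fsbig_set1; last 2 first.
- by move=> _ ->.
- move=> b [bd ba]; rewrite /preimage /set1 /mkset deltaHE; case: eqP => [e|]; last by rewrite mulr0.
  exfalso; apply: ba; rewrite /a -e.
  have [r1 s1 k1] := @gmulE _ (ginv b) d bd.
  have [r2 s2 k2] := @gmulE _ d (ginv (gmul (ginv b) d)) (esym s1).
  by apply: arrow_eq; rewrite ?r2 ?s2 ?k2 /= ?r1 ?k1//= ; lia.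
rewrite deltaHE (_ : gmul _ _ = c) ?eqxx ?mulr1//.
have [r1 s1 k1] := @gmulE _ (ginv a) d r.
by apply: arrow_eq; rewrite ?r1 ?s1 ?k1//= ?s ?k//=; lia.
Qed.

(** By [delta_total] it is enough to take a point mass at some [c] for [w]; both sides are then
    finite sums over the supporting arrows of [f] with range [rng c]. *)
Lemma regular_star f (v w : H) : Cc f ->
  inner (regular f v) w = inner v (regular (invol f) w).
Proof.
move=> cf; have cfi := Cc_invol cf; apply/eqP; rewrite -subr_eq0; apply/eqP; move: w.
have [N N0 HN] := regular_bound cfi; have linv := regular_linear cfi.
apply: (@delta_total _ (`|regular f v| + `|v| * N)).
- by rewrite addr_ge0// mulr_ge0.
- move=> u w; have := linv 1 u w; rewrite !scale1r => ->.
  by rewrite !innerDr opprD addrACA.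
- move=> w; apply: le_trans (ler_normB _ _) _; rewrite mulrDl; apply: lerD.
    exact: inner_norm_le.
  apply: le_trans (inner_norm_le _ _) _; rewrite -mulrA ler_wpM2l//; exact: HN.
move=> z c; have := linv z (deltaH c) 0.
have -> : regular (invol f) 0 = 0.
  by have := linv 1 0 0; rewrite !scale1r addr0 => /eqP; rewrite -subr_eq subrr eq_sym => /eqP.
rewrite !addr0 => ->; rewrite !innerZr -mulrBr; apply/eqP; rewrite mulf_eq0 subr_eq0; apply/orP; right.
rewrite inner_delta regular_coord//.
have fA := finite_rfib_Cc cf (rng c); set A := rfib f (rng c) in fA.
have Ac : A `<=` [set a | rng a = rng c] by move=> a [].
rewrite (@conv_sub _ _ f _ c A)// fsbig_finite//.
have -> : regular (invol f) (deltaH c) =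
    \sum_(a <- fset_set A) Num.conj (f a) *: deltaH (gmul (ginv a) c).
  apply: l2_ext => d; rewrite regular_coord_delta// l2_coord_sum.
  case: eqP => [dc|ndc]; last first.
    rewrite big1_seq// => a; rewrite andTb in_fset_set// inE => aA; have ac : rng a = rng c := Ac _ aA.
    rewrite l2_coordZ deltaHE; case: eqP => [e|]; last by rewrite mulr0.
    by have [_ s _] := @gmulE _ (ginv a) c ac; case: ndc; rewrite -s e.
  have dc' : src c = rng (ginv d) by [].
  have [r s k] := gmulE dc'.
  have eq_a a : rng a = rng c -> d = gmul (ginv a) c -> a = gmul c (ginv d).
    move=> ac e; have [r1 s1 k1] := @gmulE _ (ginv a) c ac.
    by apply: arrow_eq; rewrite ?r ?s ?k ?e /= ?r1 ?k1//=; lia.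
  have eq_d : gmul (ginv (gmul c (ginv d))) c = d.
    have [r1 s1 k1] := @gmulE _ (ginv (gmul c (ginv d))) c r.
    by apply: arrow_eq; rewrite ?r1 ?s1 ?k1 /= ?s ?k//=; lia.
  have ginv_dc : ginv (gmul d (ginv c)) = gmul c (ginv d).
    have [r1 s1 k1] := @gmulE _ d (ginv c) dc.
    by apply: arrow_eq; rewrite ?r ?s ?k /= ?r1 ?s1 ?k1//=; lia.
  rewrite /invol ginv_dc; set a := gmul c (ginv d).
  have [aA|naA] := boolP (a \in fset_set A).
    rewrite (big_fsetD1 a)// big1_seq; last first.
      move=> b; rewrite andTb in_fsetD1 => /andP[ba bA].
      have [bc _] : A b by move: bA; rewrite in_fset_set// inE.
      rewrite l2_coordZ deltaHE; case: eqP => [e|]; last by rewrite mulr0.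
      by rewrite (eq_a _ bc e) eqxx in ba.
    by rewrite l2_coordZ deltaHE eq_d eqxx mulr1 /= addr0.
  rewrite big1_seq; last first.
    move=> b; rewrite andTb => bA; rewrite l2_coordZ deltaHE.
    case: eqP => [e|]; last by rewrite mulr0.
    have bA' : A b by move: bA; rewrite in_fset_set// inE.
    by move: naA; rewrite /a -(eq_a _ (Ac _ bA') e) bA.
  have -> : f a = 0; last by rewrite conjC0.
  apply: contrapT => /eqP fa; move/negP : naA; apply.
  by rewrite in_fset_set// inE; split.
rewrite inner_sumr; apply/eqP; apply: eq_bigr => a _.
by rewrite innerZr conjCK inner_delta.
Qed.

Lemma regular_rep : Cc_rep (regular : (G -> C) -> l2_hilbert R G -> l2_hilbert R G).
Proof.
split.
- by move=> f cf; split; [exact: regular_linear|exact: regular_continuous].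
- move=> z f g v cf cg; apply: regularE => c.
  rewrite l2_coordD l2_coordZ !regular_coord// convDl ?convZl//; last 3 first.
  + exact: finite_rfib_Cc.
  + move=> x; apply: (@sub_finite_set _ _ (rfib f x)); last exact: finite_rfib_Cc.
    by move=> a [ax fa]; split => //; apply: contra_neq fa => ->; rewrite mulr0.
  + exact: finite_rfib_Cc.
- move=> f g v cf cg; apply: regularE => c; rewrite regular_coord// convA//.
  + by congr conv; apply/funext => a; rewrite regular_coord.
  + exact: finite_rfib_Cc.
  + exact: finite_rfib_Cc.
- by move=> f v w cf; exact: regular_star.
Qed.

End RegularRepresentation.

(** * Convolution on C_c(G), and functions on the unit space *)

Section ConvolutionSupport.
Variables (R : realType) (S : DRsystem).
Local Notation C := (Cplx R).
Local Notation G := (DRgroupoid S).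
Implicit Types (f g : G -> C) (a b c d e : G) (x : S).

(** Composable pairs form a closed set because the unit space is Hausdorff, and [gmul] is continuous
    on it. *)
Lemma composable_mul_compact (K L : set G) : compact K -> compact L ->
  compact [set c | exists a b, [/\ K a, L b, src a = rng b & c = gmul a b]].
Proof.
move=> cK cL; pose A := (K `*` L) `&` [set p : G * G | src p.1 = rng p.2].
have cA : compact A.
  apply: compact_closedI; first exact: compact_setX.
  rewrite -openC openE => p np.
  have cf : {for p, continuous (fun p : G * G => src p.1)}.
    by apply: (@continuous_comp _ _ _ fst (@src S)); [exact: cvg_fst|exact: src_continuous].
  have cg : {for p, continuous (fun p : G * G => rng p.2)}.
    by apply: (@continuous_comp _ _ _ snd (@rng S)); [exact: cvg_snd|exact: rng_continuous].
  exact: near_neq (@dr_hausdorff S) cf cg np.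
have -> : [set c | exists a b, [/\ K a, L b, src a = rng b & c = gmul a b]] =
    (fun p : G * G => gmul p.1 p.2) @` A.
  apply/seteqP; split => [_ [a [b [Ka Lb ab ->]]]|_ [[a b] [[/= Ka Lb] ab] <-]].
    by exists (a, b).
  by exists a, b.
apply: continuous_compact => //; apply/subspace_continuousP => -[a b] [_ /= ab].
move=> W nW; have [U [V [nU nV UV]]] := gmul_continuous ab nW.
exists (U, V) => //= -[a' b'] [/= Ua Vb] [_ /= ab']; exact: UV.
Qed.

(** For [f] on a bisection with section [s], the sum has the single term with first factor
    [s (rng c)], continuous in [c] wherever [rng c] meets the bisection; [Cc_extend] handles the
    rest. *)
Lemma Cc_conv f g : Cc f -> Cc g -> Cc (conv f g).
Proof.
move=> cf cg; move: f cf; apply: Cc_ind => [|f1 f2 cf1 cf2 h1 h2|f].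
- have -> : conv (fun=> 0) g = (fun=> 0).
    by apply/funext => c; rewrite conv_eq0.
  exact: Cc0.
- have -> : conv (fun c => f1 c + f2 c) g = (fun c => conv f1 g c + conv f2 g c).
    by apply/funext => c; rewrite convDl//; exact: finite_rfib_Cc.
  exact: Cc_add.
move=> [Z [K [bZ cK KZ contf f0]]]; have [_ iZ _] := bZ.
have [s [oR sK cs]] := bisection_section bZ; have [contg kg] := cg.
have fZ a : f a != 0 -> K a.
  by move=> fa; apply: contrapT => /f0/eqP; rewrite (negPf fa).
have oO : open (@rng S @^-1` (@rng S @` Z)).
  by move/continuousP : (@rng_continuous S); apply.
have convZ c : (@rng S @` Z) (rng c) ->
    conv f g c = f (s (rng c)) * g (gmul (ginv (s (rng c))) c).
  move=> [a Za ac]; rewrite -ac sK//; apply: conv_single => // b bc fb.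
  by apply: iZ => //; [exact/KZ/fZ|rewrite ac bc].
apply: (@Cc_extend _ _ _ _ _ (@DRgroupoid_hausdorff S)
  (composable_mul_compact cK kg) oO).
- move=> _ [a [b [Ka _ ab ->]]]; have [r _ _] := gmulE ab.
  by rewrite /= r; exists a => //; exact: KZ.
- move=> c Oc; apply: (@near_eq_continuous _ _ _ (fun c => f (s (rng c)) *
      g (gmul (ginv (s (rng c))) c))).
    have : nbhs c (@rng S @^-1` (@rng S @` Z)) by exact: open_nbhs_nbhs.
    by apply: filterS => d /convZ.
  have csr : {for c, continuous (fun c => s (rng c))}.
    by apply: (@continuous_comp _ _ _ (@rng S) s); [exact: rng_continuous|exact: cs].
  have cm : {for c, continuous (fun c => gmul (ginv (s (rng c))) c)}.
    have [a Za ac] := Oc.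
    have sc : src (ginv (s (rng c))) = rng c by rewrite -ac /= sK.
    move=> W nW; have [U [V [nU nV UV]]] := gmul_continuous sc nW.
    have nU' : nbhs c ((fun c => ginv (s (rng c))) @^-1` U).
      have cgi : {for c, continuous (fun c => ginv (s (rng c)))}.
        by apply: (@continuous_comp _ _ _ (fun c => s (rng c)) (@ginv S)); [exact: csr|exact: ginv_continuous].
      exact: cgi _ nU.
    have nO : nbhs c (@rng S @^-1` (@rng S @` Z)) by exact: open_nbhs_nbhs.
    change (nbhs c ((fun c => gmul (ginv (s (rng c))) c) @^-1` W)).
    apply: filterS3 nU' nV nO => d Ud Vd [a' Za' ad]; apply: UV => //=.
    by rewrite -ad sK.
  apply: (@continuousM _ _ (fun c => f (s (rng c))) (fun c => g (gmul (ginv (s (rng c))) c))).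
    by apply: (@continuous_comp _ _ _ (fun c => s (rng c)) f); [exact: csr|exact: contf].
  by apply: (@continuous_comp _ _ _ (fun c => gmul (ginv (s (rng c))) c) g); [exact: cm|exact: contg].
- move=> c nc; rewrite convE fsbig1// => a /= ac.
  have [->|fa] := eqVneq (f a) 0; first exact: mul0r.
  have [->|ga] := eqVneq (g (gmul (ginv a) c)) 0; first exact: mulr0.
  exfalso; apply: nc; exists a, (gmul (ginv a) c).
  have [r _ _] := @gmulE _ (ginv a) c ac.
  split; [exact: fZ|exact: subset_closure|by rewrite r|by rewrite gmulKV].
Qed.

Lemma ext0E (F : S -> C) c : ext0 F c = if `[< c = gunit (rng c) >] then F (rng c) else 0.
Proof.
rewrite /ext0; congr (if _ then _ else _); apply/asbool_equiv_eq.
by split=> [[x ->]|->]; [|exists (rng c)].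
Qed.

Lemma ext0_gunit (F : S -> C) x : ext0 F (gunit x) = F x.
Proof. by rewrite ext0E asboolT. Qed.

(** The units form an open subset of the groupoid, so [ext0] is an extension by zero. *)
Lemma Cc_ext0 (F : S -> C) : Cc F -> Cc (ext0 F).
Proof.
move=> [cF kF]; pose O := [set c : G | c = gunit (rng c)].
have nO c : O c -> nbhs c O by move=> ->; exact: near_gunit.
apply: (@Cc_extend _ _ O (@gunit S @` closure [set t | F t != 0]) _
  (@DRgroupoid_hausdorff S)).
- by apply: continuous_compact => //; apply: continuous_subspaceT; exact: gunit_continuous.
- by rewrite openE => c /nO.
- by move=> _ [x _ <-].
- move=> c Oc; apply: (@near_eq_continuous _ _ _ (fun c => F (rng c))).
    by apply: filterS (nO _ Oc) => d Od; rewrite ext0E asboolT.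
  by apply: (@continuous_comp _ _ _ (@rng S) F); [exact: rng_continuous|exact: cF].
- move=> c nc; rewrite ext0E; case: asboolP => // Oc.
  apply: contrapT => /eqP Fc; apply: nc; exists (rng c) => //; exact: subset_closure.
Qed.

Lemma conv_ext0 (F : S -> C) (xi : G -> C) c : conv (ext0 F) xi c = F (rng c) * xi c.
Proof.
rewrite (@conv_single _ _ _ _ _ (gunit (rng c)))//; last first.
  move=> b bc; rewrite ext0E; case: asboolP => [bu _|]; last by rewrite eqxx.
  by rewrite bu bc.
rewrite ext0_gunit (_ : ginv _ = gunit (rng c)) ?gmul1g//.
by apply: arrow_eq => //=; rewrite oppr0.
Qed.

Lemma Cc_gauge (z : C) f : Cc f -> Cc (fun c => z ^ coc c * f c).
Proof.
move=> cf; apply: (Cc_cont_mul (g := fun c => z ^ coc c) cf) => d.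
apply: (@near_eq_continuous _ _ _ (fun=> z ^ coc d)); last exact: cst_continuous.
by apply: filterS (near_coc d) => a ->.
Qed.

Lemma Cc_gunit f : Cc f -> Cc (fun x => f (gunit x)).
Proof.
move=> [cf kf]; split.
  move=> x; apply: (@continuous_comp _ _ _ (@gunit S) f); last exact: cf.
  exact: gunit_continuous.
have kr : compact (@rng S @` closure [set c | f c != 0]).
  by apply: continuous_compact => //; apply: continuous_subspaceT; exact: rng_continuous.
apply: (subclosed_compact _ kr); first exact: closed_closure.
rewrite closureE; apply: smallest_sub; first exact: compact_closed (@dr_hausdorff S) kr.
by move=> x /= fx; exists (gunit x) => //; exact: subset_closure.
Qed.

Lemma Cc_C0 (F : S -> C) : Cc F -> C0 F.
Proof.
move=> [cF kF]; split => // e e0; apply: (subclosed_compact _ kF); last first.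
  move=> x /= eF; apply: subset_closure => /=; apply: contraTneq eF => ->.
  by rewrite normr0 -real_ltNge ?real0 ?(gtr0_real e0).
rewrite -openC openE => x /= /negP; rewrite -real_ltNge ?(gtr0_real e0) ?normr_real// => Fx.
have d0 : 0 < e - `|F x| by rewrite subr_gt0.
have nF : \forall u \near x, `|F x - F u| < e - `|F x|.
  by move/cvgrPdist_lt : (cF x) => /(_ _ d0).
apply: filterS nF => u Fu; apply/negP; rewrite -real_ltNge ?(gtr0_real e0) ?normr_real//.
rewrite -(subrKC (F x) (F u)); apply: le_lt_trans (ler_normD _ _) _.
by rewrite -ltrBrDl distrC.
Qed.

Lemma C0_elt_ext0 (B : cstarAlgebra R) (iota : (G -> C) -> B) (F : S -> C) :
  Cc F -> C0_elt iota F (iota (ext0 F)).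
Proof.
move=> cF; split; first exact: Cc_C0.
move=> e e0; exists F; split => //; last by rewrite subrr normr0 ltW.
by move=> x; rewrite subrr normr0 ltW.
Qed.

End ConvolutionSupport.

(** * The vectors b delta_y for b in the C*-algebra *)

Section Evaluation.
Variables (R : realType) (S : DRsystem) (B : cstarAlgebra R).
Variable iota : (DRgroupoid S -> Cplx R) -> B.
Hypothesis Bc : groupoid_cstar iota.
Local Notation C := (Cplx R).
Local Notation G := (DRgroupoid S).
Local Notation H := (l2 R G).
Implicit Types (f g : G -> C) (a c d e : G) (x y : S) (b : B).

Lemma iota_Z z f : Cc f -> iota (fun c => z * f c) = z *: iota f.
Proof.
move=> cf; have i0 : iota (fun=> 0) = 0.
  have := gc_linear Bc 1 (@Cc0 R G) (@Cc0 R G); rewrite scale1r.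
  rewrite (_ : (fun c : G => 1 * 0 + 0) = (fun=> 0 : C)); last first.
    by apply/funext => c; rewrite mulr0 addr0.
  by move=> /eqP; rewrite -subr_eq subrr eq_sym => /eqP.
rewrite -[RHS]addr0 -i0 -(gc_linear Bc z cf (@Cc0 R G)); congr iota.
by apply/funext => c; rewrite addr0.
Qed.

Lemma iota_B f g : Cc f -> Cc g -> iota (fun c => f c - g c) = iota f - iota g.
Proof.
move=> cf cg; have := gc_linear Bc (-1) cg cf; rewrite scaleN1r addrC => <-.
by congr iota; apply/funext => c; rewrite mulN1r addrC.
Qed.

Lemma Cc_sub f g : Cc f -> Cc g -> Cc (fun c => f c - g c).
Proof.
move=> cf cg; have := Cc_lin (-1) cg cf; congr Cc.
by apply/funext => c; rewrite mulN1r addrC.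
Qed.

Lemma iota_approx b (e : C) : 0 < e -> exists2 f, Cc f & `|b - iota f| < e.
Proof.
move=> e0; have : closure [set iota f | f in @Cc R G] b by rewrite (gc_dense Bc).
move=> /(_ _ (nbhsx_ballx b e e0)) [_ [[f cf <-]]]; rewrite -ball_normE => bf.
by exists f.
Qed.

(** The regular representation is one of those over which the full norm is a supremum, and [deltaH]
    gives unit vectors. *)
Lemma regular_delta_le f c : Cc f -> `|regular f (deltaH R c)| <= `|iota f|.
Proof.
move=> cf; rewrite (Cplx_real (normr_ge0 (regular f _))) (Cplx_real (normr_ge0 (iota f))).
rewrite lecR -lee_fin (gc_norm Bc cf).
apply: (@le_trans _ _ (op_norm (regular f : l2_hilbert R G -> l2_hilbert R G))).
  apply: ereal_sup_ubound; exists (deltaH R c) => //=.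
  by rewrite (_ : `|_| = 1)//; exact: norm_delta.
apply: ereal_sup_ubound; exists (l2_hilbert R G), (@regular R S); split => //.
exact: regular_rep.
Qed.

Lemma eval_ex y : exists L : B -> H, forall b f, Cc f ->
  `|L b - regular f (deltaH R (gunit y))| <= `|b - iota f|.
Proof.
apply: (dense_extension (gc_dense Bc)) => f g cf cg.
rewrite -iota_B//; apply: le_trans (regular_delta_le (gunit y) (Cc_sub cf cg)).
rewrite le_eqVlt; apply/orP; left; apply/eqP; congr (`|_|).
apply/esym; apply: regularE => c.
rewrite (_ : (regular f _ - regular g _) c = regular f (deltaH R (gunit y)) c -
   regular g (deltaH R (gunit y)) c)// !regular_coord//.
have -> : (fun c => f c - g c) = (fun c => f c + -1 * g c).
  by apply/funext => d; rewrite mulN1r.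
rewrite convDl ?convZl ?mulN1r//; [exact: finite_rfib_Cc|exact: finite_rfib_Cc|].
have := finite_rfib_Cc cg => h x; apply: (@sub_finite_set _ _ (rfib g x)); last exact: h.
by move=> a [ax ga]; split => //; apply: contra_neq ga => ->; rewrite mulr0.
Qed.

(* On C_c(G) this is the restriction to the source fibre over y, as an element of
   l2(G): the regular representation applied to the point mass at the unit y. *)
Definition eval y : B -> H := sval (cid (eval_ex y)).

Lemma eval_le y b f : Cc f -> `|eval y b - regular f (deltaH R (gunit y))| <= `|b - iota f|.
Proof. by rewrite /eval; case: cid => L /= LP cf; exact: LP. Qed.

Lemma eval_iota y f : Cc f -> eval y (iota f) = regular f (deltaH R (gunit y)).
Proof.
move=> cf; apply/eqP; rewrite -subr_eq0 -normr_le0.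
by apply: le_trans (eval_le _ _ cf) _; rewrite subrr normr0.
Qed.

Lemma eval_iotaE y f c : Cc f -> eval y (iota f) c = if src c == y then f c else 0.
Proof.
move=> cf; rewrite eval_iota// regular_coord_delta//; case: eqP => //= e; congr f.
rewrite (_ : ginv _ = gunit (src c)); first exact: gmulg1.
by apply: arrow_eq => //=; rewrite oppr0.
Qed.

Lemma eval_dist y b1 b2 : `|eval y b1 - eval y b2| <= `|b1 - b2|.
Proof. exact: (extension_dist (gc_dense Bc) (fun b f cf => eval_le y b cf)). Qed.

Lemma eval_continuous y : continuous (eval y).
Proof. exact/dist_continuous/eval_dist. Qed.

Lemma coord_continuous c : continuous (fun u : H => u c : C).
Proof. by apply: (@dist_continuous R H C) => u v; exact: (coord_le (u - v) c). Qed.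

Lemma eval_coord_continuous y c : continuous (fun b => eval y b c : C).
Proof.
move=> b; apply: (@continuous_comp _ _ _ (eval y) (fun u : H => u c : C)).
  exact: eval_continuous.
exact: coord_continuous.
Qed.

Lemma Cplx_hausdorff : hausdorff_space C.
Proof. exact: norm_hausdorff. Qed.

Lemma eval_src y b c : src c <> y -> eval y b c = 0.
Proof.
move=> cy; apply: (dense_eq (f := fun b => eval y b c : C) (g := fun=> 0) Cplx_hausdorff (gc_dense Bc)).
- exact: eval_coord_continuous.
- exact: cst_continuous.
- by move=> f cf; rewrite eval_iotaE//; case: eqP.
Qed.

Lemma evalZ y z b : eval y (z *: b) = z *: eval y b.
Proof.
apply: (dense_eq (f := fun b => eval y (z *: b)) (g := fun b => z *: eval y b)
  (@norm_hausdorff _ H) (gc_dense Bc)).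
- move=> b'; apply: (@continuous_comp _ _ _ (fun b => z *: b) (eval y)).
    by apply: cvgZr; exact: cvg_id.
  exact: eval_continuous.
- by move=> b'; apply: cvgZr; exact: eval_continuous.
- move=> f cf; rewrite -iota_Z//; apply: l2_ext => c; rewrite l2_coordZ !eval_iotaE//.
    by case: eqP => _; rewrite ?mulr0.
  apply: Cc_cont_mul cf _; exact: cst_continuous.
Qed.

Lemma eval_mul y f b : Cc f -> eval y (cs_mul (iota f) b) = regular f (eval y b).
Proof.
move=> cf; apply: (dense_eq (f := fun b => eval y (cs_mul (iota f) b))
  (g := fun b => regular f (eval y b)) (@norm_hausdorff _ H) (gc_dense Bc)).
- move=> b'; apply: (@continuous_comp _ _ _ (cs_mul (iota f)) (eval y)); last exact: eval_continuous.
  by apply: cvg_cs_mul; [exact: cvg_cst|exact: cvg_id].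
- move=> b'; apply: (@continuous_comp _ _ _ (eval y) (regular f)); first exact: eval_continuous.
  exact: regular_continuous.
- move=> g cg; rewrite -(gc_mul Bc cf cg) !eval_iota//; last exact: Cc_conv.
  exact: (rep_mul (regular_rep R S) _ cf cg).
Qed.

(** Both sides are the inner product of [cs_mul (cs_star b) b] applied to the point mass with the
    point mass itself; the identity is checked on C_c(G) and extended by continuity. *)
Lemma eval_sq y b : eval y (cs_mul (cs_star b) b) (gunit y) = `|eval y b| ^+ 2 :> C.
Proof.
apply: (dense_eq (f := fun b => eval y (cs_mul (cs_star b) b) (gunit y) : C)
  (g := fun b => `|eval y b| ^+ 2 : C) Cplx_hausdorff (gc_dense Bc)).
- move=> b'; apply: (@continuous_comp _ _ _ (fun b => cs_mul (cs_star b) b)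
    (fun b => eval y b (gunit y) : C)); last exact: eval_coord_continuous.
  by apply: cvg_cs_mul; [exact: cs_starC|exact: cvg_id].
- move=> b'; have cn : (fun b => `|eval y b| : C) @ b' --> (`|eval y b'| : C).
    by apply: cvg_norm; exact: eval_continuous.
  rewrite /continuous_at expr2 (_ : (fun b => `|eval y b| ^+ 2) = (fun b => `|eval y b| * `|eval y b|)).
    exact: (cvgM cn cn).
  by apply/funext => u; rewrite expr2.
- move=> f cf; rewrite -(gc_star Bc cf) eval_mul; last exact: Cc_invol.
  rewrite -inner_delta regular_star; last exact: Cc_invol.
  by rewrite involK -eval_iota// l2_inner_norm.
Qed.

(** [gam z] is given only as an algebraic isomorphism; [hom_continuous] makes it enough to check
    C_c(G). *)
Lemma eval_gauge (gam : C -> B -> B) y z b c : gauge_action iota gam -> `|z| = 1 ->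
  eval y (gam z b) c = z ^ coc c * eval y b c.
Proof.
move=> [iso _ gE] z1; apply: (dense_eq (f := fun b => eval y (gam z b) c : C)
  (g := fun b => z ^ coc c * eval y b c : C) Cplx_hausdorff (gc_dense Bc)).
- move=> b'; apply: (@continuous_comp _ _ _ (gam z) (fun b => eval y b c : C)).
    exact: (hom_continuous (iso z z1)).
  exact: eval_coord_continuous.
- by move=> b'; apply: cvgM; [exact: cvg_cst|exact: eval_coord_continuous].
- move=> f cf; rewrite gE// !eval_iotaE//; first by case: eqP => _; rewrite ?mulr0.
  exact: Cc_gauge.
Qed.

Lemma eval_C0_mul y F D b c : C0_elt iota F D ->
  eval y (cs_mul D b) c = F (rng c) * eval y b c.
Proof.
move=> [_ FD]; apply/eqP; rewrite -subr_eq0 -normr_le0; apply/ler_addgt0Pr => e e0.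
(* The errors to absorb are [d] times the norm of [b] and [d] times that of the coordinate; the
   summand 1 keeps [M] positive. *)
rewrite add0r; pose M := `|b| + `|eval y b c : C| + 1; pose d := e / M.
have M0 : 0 < M by rewrite ltr_wpDl ?addr_ge0.
have d0 : 0 < d by exact: divr_gt0.
have [f [cf fF Df]] := FD d d0.
rewrite -(subrKA (eval y (cs_mul (iota (ext0 f)) b) c)).
apply: le_trans (ler_normD _ _) _.
have -> : e = d * M by rewrite mulfVK// gt_eqF.
rewrite /M [leRHS](_ : _ = d * `|b| + (d * `|eval y b c : C| + d)); last by ring.
apply: lerD.
  apply: le_trans (coord_le (eval y (cs_mul D b) - eval y (cs_mul (iota (ext0 f)) b)) c) _.
  apply: le_trans (eval_dist _ _ _) _; rewrite -cs_mulBl.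
  by apply: le_trans (cs_norm_mul _ _) _; rewrite ler_wpM2r.
rewrite eval_mul; last exact: Cc_ext0.
rewrite regular_coord; last exact: Cc_ext0.
rewrite conv_ext0 -mulrBl normrM distrC; apply: (@le_trans _ _ (d * `|eval y b c : C|)).
  by rewrite ler_wpM2r.
by rewrite lerDl ltW.
Qed.

Lemma eval_C0 F D y : C0_elt iota F D -> eval y D (gunit y) = F y.
Proof.
move=> [_ FD]; apply/eqP; rewrite -subr_eq0 -normr_le0; apply/ler_addgt0Pr => e e0.
rewrite add0r; have e20 : 0 < e / 2 by exact: divr_gt0.
have [f [cf fF Df]] := FD _ e20.
rewrite -(subrKA (eval y (iota (ext0 f)) (gunit y))) [e]splitr.
apply: le_trans (ler_normD _ _) _; apply: lerD.
  apply: le_trans (coord_le (eval y D - eval y (iota (ext0 f))) (gunit y)) _.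
  exact: le_trans (eval_dist _ _ _) _.
rewrite eval_iotaE; last exact: Cc_ext0.
by rewrite eqxx ext0_gunit distrC.
Qed.

End Evaluation.

(** * From groupoids to C*-algebras *)

Section Pullback.
Variables (R : realType) (X Y : DRsystem) (h : X -> Y) (hinv : Y -> X).
Variables (Theta : DRgroupoid X -> DRgroupoid Y) (Theta1 : DRgroupoid Y -> DRgroupoid X).
Hypotheses (hh : homeomorphism h hinv) (hT : homeomorphism Theta Theta1).
Hypothesis spT : spatial_iso h Theta.
Local Notation C := (Cplx R).

Lemma spatial_ginv a : Theta (ginv a) = ginv (Theta a).
Proof.
have [_ spT'] := spT; have [r k s] := spT' a; have [r1 k1 s1] := spT' (ginv a).
by apply: arrow_eq; rewrite ?r1 ?k1 ?s1 /= ?r ?k ?s.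
Qed.

Lemma spatial_gmul a b : src a = rng b -> Theta (gmul a b) = gmul (Theta a) (Theta b).
Proof.
move=> ab; have [_ spT'] := spT.
have [ra ka sa] := spT' a; have [rb kb sb] := spT' b.
have [r k s] := spT' (gmul a b); have [r1 s1 k1] := gmulE ab.
have [|r2 s2 k2] := @gmulE _ (Theta a) (Theta b); first by rewrite sa rb ab.
by apply: arrow_eq; rewrite ?r ?k ?s ?r1 ?k1 ?s1 ?r2 ?k2 ?s2 ?ra ?ka ?kb ?sb.
Qed.

Lemma spatial_gunit x : Theta (gunit x) = gunit (h x).
Proof.
by have [_ spT'] := spT; have [r k s] := spT' (gunit x); apply: arrow_eq; rewrite ?r ?k ?s.
Qed.

Lemma Cc_pull (f : DRgroupoid Y -> C) : Cc f -> Cc (f \o Theta).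
Proof. exact: Cc_comp hT. Qed.

Lemma conv_pull (f g : DRgroupoid Y -> C) :
  conv (f \o Theta) (g \o Theta) = conv f g \o Theta.
Proof.
have [_ spT'] := spT; have [TK T1K _ _] := hT; have [hK _ _ _] := hh.
have rT a c : rng (Theta a) = rng (Theta c) <-> rng a = rng c.
  have [-> _ _] := spT' a; have [-> _ _] := spT' c.
  by split=> [/(can_inj hK)|->].
apply/funext => c; rewrite convE /= convE.
rewrite [RHS](@reindex_fsbig _ _ _ _ _ Theta [set a | rng a = rng c]); last first.
  split=> [a /= ac|a b _ _ /(can_inj TK)//|a /= ac]; first exact/rT.
  by exists (Theta1 a); [apply/rT; rewrite T1K|rewrite T1K].
by apply: eq_fsbigr => a; rewrite inE /= => ac; rewrite -spatial_ginv -spatial_gmul.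
Qed.

Lemma invol_pull (f : DRgroupoid Y -> C) : invol (f \o Theta) = invol f \o Theta.
Proof. by apply/funext => c; rewrite /invol /= spatial_ginv. Qed.

Lemma ext0_pull (f : Y -> C) : ext0 f \o Theta = ext0 (f \o h).
Proof.
have [_ spT'] := spT; have [TK _ _ _] := hT.
apply/funext => c; rewrite /= !ext0E; have [-> _ _] := spT' c.
rewrite (_ : `[< Theta c = gunit (h (rng c)) >] = `[< c = gunit (rng c) >])//.
apply/asbool_equiv_eq; rewrite -spatial_gunit.
by split=> [/(can_inj TK)|->].
Qed.

Lemma rep_pull (H : hilbertSpace R) (pi : (DRgroupoid X -> C) -> H -> H) :
  Cc_rep pi -> Cc_rep (fun f => pi (f \o Theta)).
Proof.
move=> [pb pl pm ps]; split.
- by move=> f /Cc_pull; exact: pb.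
- by move=> z f g v /Cc_pull cf /Cc_pull cg; rewrite -pl.
- by move=> f g v /Cc_pull cf /Cc_pull cg; rewrite -pm// conv_pull.
- by move=> f v w /Cc_pull cf; rewrite ps// invol_pull.
Qed.

(** Representations over [X] pull back to representations over [Y], so every value on the left also
    occurs on the right. The same bound for the inverse map gives the isometry [norm_pull]. *)
Lemma full_norm_pull (f : DRgroupoid Y -> C) :
  (full_norm (f \o Theta) <= full_norm f)%E.
Proof.
apply: ge_ereal_sup => _ [H [pi [rpi ->]]]; apply: ereal_sup_ubound.
by exists H, (fun f => pi (f \o Theta)); split => //; exact: rep_pull.
Qed.

End Pullback.

Section SpatialToCstar.
Variables (R : realType) (X Y : DRsystem) (h : X -> Y) (hinv : Y -> X).
Variables (Theta : DRgroupoid X -> DRgroupoid Y) (Theta1 : DRgroupoid Y -> DRgroupoid X).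
Hypotheses (hh : homeomorphism h hinv) (hT : homeomorphism Theta Theta1).
Hypotheses (spT : spatial_iso h Theta) (spT1 : spatial_iso hinv Theta1).
Variables (A : cstarAlgebra R) (iX : (DRgroupoid X -> Cplx R) -> A).
Hypothesis A_cstar : groupoid_cstar iX.
Variables (B : cstarAlgebra R) (iY : (DRgroupoid Y -> Cplx R) -> B).
Hypothesis B_cstar : groupoid_cstar iY.
Local Notation C := (Cplx R).

Let hh1 : homeomorphism hinv h. Proof. by case: hh. Qed.
Let hT1 : homeomorphism Theta1 Theta. Proof. by case: hT. Qed.

Lemma norm_pull (f : DRgroupoid X -> C) : Cc f -> `|iY (f \o Theta1)| = `|iX f|.
Proof.
move=> cf; have cf1 := Cc_pull hT1 cf.
rewrite (Cplx_real (normr_ge0 (iY _))) (Cplx_real (normr_ge0 (iX f))).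
suff e : complex.Re `|iY (f \o Theta1)| = complex.Re `|iX f| by rewrite e.
apply/eqP; rewrite -eqe (gc_norm A_cstar cf) (gc_norm B_cstar cf1) eq_le.
rewrite (full_norm_pull hh1 hT1 spT1) /=.
have := full_norm_pull hh hT spT (f \o Theta1).
rewrite (_ : (f \o Theta1) \o Theta = f)//.
by apply/funext => c /=; case: hT => ->.
Qed.

Lemma pull_ex : exists phi : A -> B, forall a f, Cc f ->
  `|phi a - iY (f \o Theta1)| <= `|a - iX f|.
Proof.
apply: (dense_extension (gc_dense A_cstar)) => f g cf cg.
rewrite -(iota_B B_cstar (Cc_pull hT1 cf) (Cc_pull hT1 cg)) -(iota_B A_cstar cf cg).
by rewrite -norm_pull//; exact: Cc_sub.
Qed.

Definition spatial_hom : A -> B := sval (cid pull_ex).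

Lemma spatial_hom_le a f : Cc f -> `|spatial_hom a - iY (f \o Theta1)| <= `|a - iX f|.
Proof. by rewrite /spatial_hom; case: cid => phi /= P; exact: P. Qed.

Lemma spatial_hom_iota f : Cc f -> spatial_hom (iX f) = iY (f \o Theta1).
Proof.
move=> cf; apply/eqP; rewrite -subr_eq0 -normr_le0.
by apply: le_trans (spatial_hom_le _ cf) _; rewrite subrr normr0.
Qed.

Lemma spatial_hom_dist a b : `|spatial_hom a - spatial_hom b| <= `|a - b|.
Proof. exact: (extension_dist (gc_dense A_cstar) (fun a f cf => spatial_hom_le a cf)). Qed.

Lemma spatial_hom_continuous : continuous spatial_hom.
Proof. exact/dist_continuous/spatial_hom_dist. Qed.

Let hausB : hausdorff_space B. Proof. exact: norm_hausdorff. Qed.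

Lemma spatial_hom_linear : linear spatial_hom.
Proof.
move=> z a b; have sc := spatial_hom_continuous.
pose F a b := spatial_hom (z *: a + b); pose K a b := z *: spatial_hom a + spatial_hom b.
(* Density is used twice, once in each variable. *)
apply: (dense_eq (f := F a) (g := K a) hausB (gc_dense A_cstar)) => [b'|b'|g cg].
- apply: (@continuous_comp _ _ _ (fun b => z *: a + b) spatial_hom); last exact: sc.
  by apply: cvgD; [exact: cvg_cst|exact: cvg_id].
- by apply: cvgD; [exact: cvg_cst|exact: sc].
apply: (dense_eq (f := F^~ (iX g)) (g := K^~ (iX g)) hausB (gc_dense A_cstar)) => [a'|a'|f cf].
- apply: (@continuous_comp _ _ _ (fun a => z *: a + iX g) spatial_hom); last exact: sc.
  by apply: cvgD; [apply: cvgZr; exact: cvg_id|exact: cvg_cst].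
- by apply: cvgD; [apply: cvgZr; exact: sc|exact: cvg_cst].
rewrite /F /K -(gc_linear A_cstar)// !spatial_hom_iota//; last exact: Cc_lin.
by rewrite -(gc_linear B_cstar)//; exact: (Cc_pull hT1).
Qed.

Lemma spatial_hom_mul a b :
  spatial_hom (cs_mul a b) = cs_mul (spatial_hom a) (spatial_hom b).
Proof.
have sc := spatial_hom_continuous.
pose F a b := spatial_hom (cs_mul a b).
pose K a b := cs_mul (spatial_hom a) (spatial_hom b).
apply: (dense_eq (f := F a) (g := K a) hausB (gc_dense A_cstar)) => [b'|b'|g cg].
- apply: (@continuous_comp _ _ _ (fun b => cs_mul a b) spatial_hom); last exact: sc.
  by apply: cvg_cs_mul; [exact: cvg_cst|exact: cvg_id].
- by apply: cvg_cs_mul; [exact: cvg_cst|exact: sc].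
apply: (dense_eq (f := F^~ (iX g)) (g := K^~ (iX g)) hausB (gc_dense A_cstar)) => [a'|a'|f cf].
- apply: (@continuous_comp _ _ _ (fun a => cs_mul a (iX g)) spatial_hom); last exact: sc.
  by apply: cvg_cs_mul; [exact: cvg_id|exact: cvg_cst].
- by apply: cvg_cs_mul; [exact: sc|exact: cvg_cst].
rewrite /F /K -(gc_mul A_cstar)// !spatial_hom_iota//; last exact: Cc_conv.
by rewrite -(gc_mul B_cstar) ?(conv_pull hh1 hT1 spT1)//; exact: (Cc_pull hT1).
Qed.

Lemma spatial_hom_star a : spatial_hom (cs_star a) = cs_star (spatial_hom a).
Proof.
have sc := spatial_hom_continuous.
apply: (dense_eq (f := fun a => spatial_hom (cs_star a))
  (g := fun a => cs_star (spatial_hom a)) hausB (gc_dense A_cstar)) => [a'|a'|f cf].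
- by apply: (@continuous_comp _ _ _ (@cs_star R A) spatial_hom); [exact: cs_starC|exact: sc].
- by apply: (@continuous_comp _ _ _ spatial_hom (@cs_star R B)); [exact: sc|exact: cs_starC].
rewrite -(gc_star A_cstar)// !spatial_hom_iota//; last exact: Cc_invol.
by rewrite -(gc_star B_cstar) ?(invol_pull spT1)//; exact: (Cc_pull hT1).
Qed.

Lemma C0_pull (f : X -> C) : C0 f -> C0 (f \o hinv).
Proof.
move=> [cf kf]; have [hK hinvK hc hinvc] := hh; split.
  by move=> y; apply: continuous_comp; [exact: hinvc|exact: cf].
move=> e e0; have -> : [set t | e <= `|(f \o hinv) t|] = h @` [set t | e <= `|f t|].
  apply/seteqP; split => [y /= ey|_ [x /= ex <-]]; last by rewrite /= hK.
  by exists (hinv y); rewrite ?hinvK.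
by apply: continuous_compact; [exact: continuous_subspaceT|exact: kf].
Qed.

Lemma spatial_hom_C0 f a : C0_elt iX f a -> C0_elt iY (f \o hinv) (spatial_hom a).
Proof.
move=> [C0f H]; split; first exact: C0_pull.
move=> e e0; have [f' [cf' ff' af']] := H e e0; exists (f' \o hinv); split.
- exact: (Cc_comp hh1).
- by move=> y; exact: ff'.
rewrite -(ext0_pull hT1 spT1) -spatial_hom_iota; last exact: Cc_ext0.
exact: le_trans (spatial_hom_dist _ _) _.
Qed.

Lemma spatial_hom_gauge gamX gamY : gauge_action iX gamX -> gauge_action iY gamY ->
  forall z a, `|z| = 1 -> spatial_hom (gamX z a) = gamY z (spatial_hom a).
Proof.
move=> [isoX _ gX] [isoY _ gY] z a z1; have sc := spatial_hom_continuous.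
apply: (dense_eq (f := fun a => spatial_hom (gamX z a))
  (g := fun a => gamY z (spatial_hom a)) hausB (gc_dense A_cstar)) => [a'|a'|f cf].
- apply: (@continuous_comp _ _ _ (gamX z) spatial_hom); last exact: sc.
  exact: (hom_continuous (isoX z z1)).
- apply: (@continuous_comp _ _ _ spatial_hom (gamY z)); first exact: sc.
  exact: (hom_continuous (isoY z z1)).
rewrite gX// !spatial_hom_iota//; last exact: Cc_gauge.
rewrite gY//; last exact: (Cc_pull hT1).
congr iY; apply/funext => c /=; have [_ spT1'] := spT1.
by have [_ -> _] := spT1' c.
Qed.

End SpatialToCstar.

Lemma spatial_to_cstar (R : realType) (X Y : DRsystem)
    (h : X -> Y) (hinv : Y -> X) (h_homeo : homeomorphism h hinv)
    (A : cstarAlgebra R) (iX : (DRgroupoid X -> Cplx R) -> A)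
    (A_cstar : groupoid_cstar iX)
    (B : cstarAlgebra R) (iY : (DRgroupoid Y -> Cplx R) -> B)
    (B_cstar : groupoid_cstar iY)
    (gamX : Cplx R -> A -> A) (gamX_gauge : gauge_action iX gamX)
    (gamY : Cplx R -> B -> B) (gamY_gauge : gauge_action iY gamY) Theta :
  spatial_iso h Theta -> exists phi : A -> B,
      [/\ cstar_iso phi,
          phi @` C0_subalgebra iX = C0_subalgebra iY,
          forall f a, C0_elt iX f a -> C0_elt iY (f \o hinv) (phi a)
        & forall z a, `|z| = 1 -> phi (gamX z a) = gamY z (phi a)].
Proof.
move=> spT; have [T1 [hT spT1]] := spatial_iso_sym h_homeo spT.
have [hK hinvK hc hinvc] := h_homeo; have [TK T1K cT cT1] := hT.
have hh1 : homeomorphism hinv h by [].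
have hT1 : homeomorphism T1 Theta by [].
pose phi := spatial_hom h_homeo hT spT spT1 A_cstar B_cstar.
pose psi := spatial_hom hh1 hT1 spT1 spT B_cstar A_cstar.
have phiK a : psi (phi a) = a.
  apply: (dense_eq (f := fun a => psi (phi a)) (g := id) (@norm_hausdorff _ A) (gc_dense A_cstar)).
  - move=> a'; apply: (@continuous_comp _ _ _ phi psi); exact: spatial_hom_continuous.
  - by move=> a'; exact: cvg_id.
  move=> f cf; rewrite /phi spatial_hom_iota// /psi spatial_hom_iota; last exact: (Cc_pull hT1).
  by congr iX; apply/funext => c /=; rewrite TK.
have psiK b : phi (psi b) = b.
  apply: (dense_eq (f := fun b => phi (psi b)) (g := id) (@norm_hausdorff _ B) (gc_dense B_cstar)).
  - move=> b'; apply: (@continuous_comp _ _ _ psi phi); exact: spatial_hom_continuous.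
  - by move=> b'; exact: cvg_id.
  move=> f cf; rewrite /psi spatial_hom_iota// /phi spatial_hom_iota; last exact: (Cc_pull hT).
  by congr iY; apply/funext => c /=; rewrite T1K.
exists phi; split.
- split; [exact: spatial_hom_linear|exact: spatial_hom_mul|exact: spatial_hom_star|].
  by exists psi.
- apply/seteqP; split => [_ [a [f fa] <-]|b [f fb]].
    by exists (f \o hinv); exact: spatial_hom_C0.
  exists (psi b); last exact: psiK.
  by exists (f \o h); exact: spatial_hom_C0.
- by move=> f a; exact: spatial_hom_C0.
- by move=> z a; exact: spatial_hom_gauge.
Qed.

(** * From C*-algebras to groupoids *)

(** With [N = |m - n|], an [N]-th root [z] of -1 lies on the circle, and [z ^ (m - n)] would be both
    1 and -1. *)
Lemma expz_inj_unit (R : realType) (m n : int) :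
  (forall z : Cplx R, `|z| = 1 -> z ^ m = z ^ n) -> m = n.
Proof.
move=> H; apply: contrapT => mn.
pose N := `|m - n|%N; have N0 : (0 < N)%N by rewrite /N absz_gt0 subr_eq0; apply/eqP.
have [z zN] : exists z : Cplx R, z ^+ N = -1 by exists (N.-root (-1)); exact: rootCK.
have z1 : `|z| = 1.
  apply/eqP; rewrite -(eqrXn2 N0 (normr_ge0 z) ler01) -normrX zN normrN normr1.
  by rewrite expr1n.
have n1 : (-1 : Cplx R) <> 1.
  by move/eqP; rewrite eq_sym -addr_eq0 (_ : 1 + 1 = 2%:R)// pnatr_eq0.
have z0 : z != 0 by rewrite -normr_eq0 z1 oner_neq0.
have : z ^ (m - n) = 1 by rewrite expfzDr// H// -expfzDr// subrr expr0z.
have : z ^ N%:Z = -1 by rewrite -exprnP.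
have [p|p] := lerP 0 (m - n).
  rewrite (_ : N%:Z = m - n); last by rewrite /N gez0_abs.
  by move=> ->; exact: n1.
rewrite (_ : N%:Z = - (m - n)); last by rewrite /N ltz0_abs.
by rewrite -invr_expz => e1 e2; apply: n1; rewrite -e1 e2 invr1.
Qed.

(** * Norms of images of functions on a bisection *)

Section BisectionNorm.
Variables (R : realType) (X Y : DRsystem) (h : X -> Y) (hinv : Y -> X).
Hypothesis hh : homeomorphism h hinv.
Variables (A : cstarAlgebra R) (iX : (DRgroupoid X -> Cplx R) -> A).
Hypothesis A_cstar : groupoid_cstar iX.
Variables (B : cstarAlgebra R) (iY : (DRgroupoid Y -> Cplx R) -> B).
Hypothesis B_cstar : groupoid_cstar iY.
Variable phi : A -> B.
Hypothesis phi_iso : cstar_iso phi.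
Hypothesis phi_C0 : forall f a, C0_elt iX f a -> C0_elt iY (f \o hinv) (phi a).
Local Notation C := (Cplx R).

Variables (f : DRgroupoid X -> C) (Z : set (DRgroupoid X)).
Hypotheses (bZ : bisection Z) (cf : Cc f) (f0 : forall c, ~ Z c -> f c = 0).

Let fZ c : f c != 0 -> Z c.
Proof. by move=> fc; apply: contrapT => /f0/eqP; rewrite (negPf fc). Qed.

(** A nonzero term at [d] has [ginv a] and [gmul (ginv a) d] in [Z] with the same range; so they
    coincide and [d] is a unit. *)
Lemma bisection_invol_conv :
  conv (invol f) f = ext0 (fun x => conv (invol f) f (gunit x)).
Proof.
have [_ iZ jZ] := bZ; apply/funext => d; rewrite ext0E.
case: asboolP => [{1}->//|nd]; rewrite convE fsbig1// => a /= ad.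
have [e|fa] := eqVneq (f (ginv a)) 0; first by rewrite /invol e conjC0 mul0r.
have [->|fd] := eqVneq (f (gmul (ginv a) d)) 0; first exact: mulr0.
have [r s k] := @gmulE _ (ginv a) d ad.
have e := iZ _ _ (fZ fd) (fZ fa) r.
by exfalso; apply: nd; rewrite -ad -{1}(gmulKV ad) e -{1}(ginvK a) gmulVg.
Qed.

(** Injectivity of [src] on [Z] leaves [ginv c] as the only first factor. *)
Lemma bisection_invol_conv_src c : Z c ->
  conv (invol f) f (gunit (src c)) = `|f c| ^+ 2.
Proof.
have [_ iZ jZ] := bZ => Zc.
rewrite (@conv_single _ _ _ _ _ (ginv c))//.
  rewrite ginvK /invol ginvK gmulg1 normCK mulrC.
  by [].
move=> b bc; rewrite /invol conjC_eq0 => fb; apply: (can_inj (@ginvK X)).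
by rewrite ginvK; apply: jZ => //; exact: fZ.
Qed.

(* f* f lies in C_0(X), where its value at src c is |f c|^2; the isomorphism
   transports it to Y. *)
Lemma bisection_eval_norm c : Z c -> `|eval B_cstar (h (src c)) (phi (iX f))| = `|f c|.
Proof.
move=> Zc; apply/eqP; rewrite -(@eqrXn2 _ 2)//; apply/eqP.
have [hK _ _ _] := hh; have cfi := Cc_invol cf.
pose F x := conv (invol f) f (gunit x).
have cF : Cc F by apply: Cc_gunit; exact: Cc_conv.
have := eval_C0 B_cstar (h (src c)) (phi_C0 (C0_elt_ext0 iX cF)).
rewrite -bisection_invol_conv (gc_mul A_cstar)// (gc_star A_cstar)//.
rewrite (ci_mul phi_iso) (ci_star phi_iso) eval_sq => ->.
by rewrite /= hK /F bisection_invol_conv_src.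
Qed.

End BisectionNorm.

(** * Reconstruction of the map on arrows *)

Section Reconstruction.
Variables (R : realType) (X Y : DRsystem) (h : X -> Y) (hinv : Y -> X).
Hypothesis hh : homeomorphism h hinv.
Variables (A : cstarAlgebra R) (iX : (DRgroupoid X -> Cplx R) -> A).
Hypothesis A_cstar : groupoid_cstar iX.
Variables (B : cstarAlgebra R) (iY : (DRgroupoid Y -> Cplx R) -> B).
Hypothesis B_cstar : groupoid_cstar iY.
Variables (gamX : Cplx R -> A -> A) (gamY : Cplx R -> B -> B).
Hypotheses (gamX_gauge : gauge_action iX gamX) (gamY_gauge : gauge_action iY gamY).
Variable phi : A -> B.
Hypothesis phi_iso : cstar_iso phi.
Hypothesis phi_C0 : forall f a, C0_elt iX f a -> C0_elt iY (f \o hinv) (phi a).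
Hypothesis phi_gauge : forall z a, `|z| = 1 -> phi (gamX z a) = gamY z (phi a).
Local Notation C := (Cplx R).

Lemma eval_support (f : DRgroupoid X -> C) (Z : set (DRgroupoid X)) (p : int) c g :
  bisection Z -> Cc f -> (forall c, ~ Z c -> f c = 0) -> (forall c, Z c -> coc c = p) ->
  Z c -> eval B_cstar (h (src c)) (phi (iX f)) g != 0 ->
  [/\ rng g = h (rng c), coc g = p & src g = h (src c)].
Proof.
move=> bZ cf f0 fp Zc eg; have [hK hinvK hc hinvc] := hh; split.
(* If the range were wrong, some bump [d1] would be 1 at [hinv (rng g)] and 0 at [rng c]. Then [f1]
   vanishes at [c], so its image annihilates the point mass, although it multiplies the nonzero
   coordinate at [g] by 1. *)
- apply: contrapT => ne.
  have nw : hinv (rng g) <> rng c by move=> e; apply: ne; rewrite -e hinvK.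
  have nU : nbhs (hinv (rng g)) (~` [set rng c]).
    apply: open_nbhs_nbhs; split => //; apply: closed_openC.
    by apply: accessible_closed_set1; apply: hausdorff_accessible; exact: dr_hausdorff.
  have [d1 [K [cK KU cd1 d1w [_ d1K]]]] := bump R nU.
  have d1c : d1 (rng c) = 0 by apply: d1K => /KU; exact.
  have Cd1 : Cc d1.
    apply: (@Cc_extend _ _ setT K) => //; [exact: dr_hausdorff|exact: openT|].
    by move=> t _; exact: cd1.
  pose f1 := conv (ext0 d1) f.
  have cf1 : Cc f1 by apply: Cc_conv => //; exact: Cc_ext0.
  have f10 d : ~ Z d -> f1 d = 0 by move=> /f0 fd; rewrite /f1 conv_ext0 fd mulr0.
  have := bisection_eval_norm hh A_cstar B_cstar phi_iso phi_C0 bZ cf1 f10 Zc.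
  rewrite /f1 conv_ext0 d1c mul0r normr0 (gc_mul A_cstar)//; last exact: Cc_ext0.
  rewrite (ci_mul phi_iso) => /eqP; rewrite normr_eq0 => /eqP e.
  have := eval_C0_mul B_cstar (h (src c)) (phi (iX f)) g (phi_C0 (C0_elt_ext0 iX Cd1)).
  by rewrite e /= d1w mul1r => e0; rewrite -e0 eqxx in eg.
(* [f] is homogeneous of degree [p] for the gauge action, hence so is its image, and the nonzero
   coordinate at [g] can be cancelled. *)
- apply: (@expz_inj_unit R) => z z1.
  have := eval_gauge B_cstar (h (src c)) (phi (iX f)) g gamY_gauge z1.
  rewrite -phi_gauge//; have [_ _ ->] := gamX_gauge => //.
  have -> : (fun c => z ^ coc c * f c) = (fun c => z ^ p * f c).
    apply/funext => d; have [Zd|/f0->] := pselect (Z d); first by rewrite fp.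
    by rewrite !mulr0.
  rewrite (iota_Z A_cstar)// (hom_Z phi_iso).
  by rewrite evalZ l2_coordZ => /(mulIf eg).
- by apply: contrapT => /(eval_src B_cstar (phi (iX f))) e; rewrite e eqxx in eg.
Qed.

(** The final estimate serves continuity: a good approximant [f2] of the image of [f] cannot vanish
    at the new arrow. *)
Lemma reconstruct_arrow (f : DRgroupoid X -> C) (Z : set (DRgroupoid X)) (p : int) c :
  bisection Z -> Cc f -> (forall c, ~ Z c -> f c = 0) -> (forall c, Z c -> coc c = p) ->
  f c != 0 -> exists g, [/\ rng g = h (rng c), coc g = p, src g = h (src c) &
    forall f2, Cc f2 -> `|(`|f c| - `|f2 g|)| <= `|phi (iX f) - iY f2|].
Proof.
move=> bZ cf f0 fp fc.
have Zc : Z c by apply: contrapT => /f0/eqP; rewrite (negPf fc).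
have sup := eval_support bZ cf f0 fp Zc.
have nrm := bisection_eval_norm hh A_cstar B_cstar phi_iso phi_C0 bZ cf f0 Zc.
set u := eval B_cstar (h (src c)) (phi (iX f)) in sup nrm.
have [g ug] : exists g, u g != 0.
  apply: contrapT => nu; move: nrm; rewrite (_ : u = 0) ?normr0.
    by move/esym/eqP; rewrite normr_eq0 (negPf fc).
  by apply: l2_ext => g; apply: contrapT => /eqP ug; apply: nu; exists g.
have [rg kg sg] := sup _ ug; exists g; split => // f2 cf2.
(* All arrows in the support of [u] share range, cocycle value and source, so there is only one. *)
have uE : u = (u g : C) *: deltaH R g.
  apply: l2_ext => d; rewrite l2_coordZ deltaHE; case: eqP => [->|dg].
    by rewrite mulr1.
  rewrite mulr0; apply: contrapT => /eqP ud; apply: dg.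
  by have [rd kd sd] := sup _ ud; apply: arrow_eq; rewrite ?rd ?rg ?kd ?kg ?sd ?sg.
have fu : `|f c| = `|u g : C| by rewrite -nrm uE normrZ norm_delta mulr1 l2_coordZ deltaHE eqxx mulr1.
rewrite fu; apply: le_trans (ler_dist_dist _ _) _.
have -> : f2 g = eval B_cstar (h (src c)) (iY f2) g by rewrite eval_iotaE// sg eqxx.
apply: le_trans (coord_le (u - eval B_cstar (h (src c)) (iY f2)) g) _.
exact: eval_dist.
Qed.

Lemma reconstruct : exists Theta : DRgroupoid X -> DRgroupoid Y, continuous Theta /\
  forall g, [/\ rng (Theta g) = h (rng g), coc (Theta g) = coc g & src (Theta g) = h (src g)].
Proof.
have bumpf (g : DRgroupoid X) : exists (f : DRgroupoid X -> C) (Z : set (DRgroupoid X)),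
    [/\ [/\ bisection Z, Cc f & forall c, ~ Z c -> f c = 0],
      (forall c, Z c -> coc c = coc g) & f g = 1].
  have [f [Z [K [[bZ cK KZ ZW] cf f1 _ fK]]]] := arrow_bump R (near_coc g).
  exists f, Z; split => //; split => //.
    by apply: bisection_fun_Cc; exists Z, K.
  by move=> c nZ; apply: fK => /KZ.
have arr (g : DRgroupoid X) : exists g' : DRgroupoid Y,
    [/\ rng g' = h (rng g), coc g' = coc g & src g' = h (src g)].
  have [f [Z [[bZ cf f0] fp f1]]] := bumpf g.
  have [|g' [? ? ? _]] := reconstruct_arrow bZ cf f0 fp (c := g).
    by rewrite f1 oner_neq0.
  by exists g'.
have [T TE] := choice arr; exists T; split => // g.
have [f [Z [[bZ cf f0] fp f1]]] := bumpf g.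
(* Near [g] the modulus of [f] exceeds 1/2, so an error below 1/4 keeps [f2] nonzero at the images
   [T c]. *)
have q0 : 0 < 4^-1 :> C by rewrite invr_gt0.
have [f2 cf2 ff2] := iota_approx B_cstar (phi (iX f)) q0.
have near4 : \forall c \near g, 2^-1 < `|f c|.
  have [cff _] := cf; have : \forall c \near g, `|f g - f c| < 2^-1.
    by move/cvgrPdist_lt : (cff g); apply; rewrite invr_gt0.
  apply: filterS => c; rewrite f1 => fc.
  have : `|1 : C| <= `|1 - f c| + `|f c| by rewrite -{1}(subrK (f c) 1) ler_normD.
  rewrite normr1 => h1; have : 2^-1 + 2^-1 < 2^-1 + `|f c|.
    have -> : 2^-1 + 2^-1 = 1 :> C by field.
    by apply: le_lt_trans h1 _; rewrite ltrD2r.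
  by rewrite ltrD2l.
have f2T c : 2^-1 < `|f c| -> f2 (T c) != 0.
  move=> fc; have fc0 : f c != 0.
    by apply: contraTneq fc => ->; rewrite normr0 -real_leNgt ?real0 ?ger0_real ?invr_ge0.
  have [g' [rg kg sg /(_ _ cf2) H]] := reconstruct_arrow bZ cf f0 fp fc0.
  have Zc : Z c by apply: contrapT => /f0/eqP; rewrite (negPf fc0).
  have [rT kT sT] := TE c.
  have -> : T c = g' by apply: arrow_eq; rewrite ?rT ?rg ?kT ?kg ?sT ?sg ?fp.
  apply: contraTneq (le_lt_trans H ff2) => ->; rewrite normr0 subr0 normr_id.
  rewrite -real_leNgt ?gtr0_real//; last exact: lt_trans fc; rewrite ?invr_gt0//.
  apply: ltW; apply: le_lt_trans fc.
  by rewrite lef_pV2 ?posrE// ler_nat.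
pose K := closure [set t | f2 t != 0].
have cK : compact K by case: cf2.
have TK : nbhs g (T @^-1` K).
  by apply: filterS near4 => c fc; apply: subset_closure; exact: f2T.
have gK : nbhs (T g) K.
  have [cff2 _] := cf2.
  have n0 : \forall d \near T g, f2 d != 0.
    apply: (cvgr_neq0 _ (cff2 (T g))); apply: f2T.
    by rewrite f1 normr1 invf_lt1// ltr1n.
  by apply: filterS n0 => d; exact: (@subset_closure _ [set t | f2 t != 0]).
have FT : ProperFilter (T @ g) := fmap_proper_filter T (nbhs_pfilter g).
(* Near [g] the values of [T] lie in the compact set [K], so they converge to [T g] once it is their
   only cluster point. *)
apply: (compact_cluster_set1 (@DRgroupoid_hausdorff Y) cK gK) => //.
have [hK hinvK hc hinvc] := hh.
(* Range, source and cocycle are continuous, so a cluster point shares all three with [T g]. *)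
have uniq k : cluster (T @ g) k -> k = T g.
  move=> kc; have [rT kT sT] := TE g; apply: arrow_eq.
  - apply: (@dr_hausdorff Y) => U V nU nV; rewrite rT in nV.
    have nV' : nbhs g (T @^-1` [set d | V (rng d)]).
      have n1 : nbhs (rng g) (h @^-1` V) := hc _ _ nV.
      have n2 : nbhs g (@rng X @^-1` (h @^-1` V)) := rng_continuous n1.
      apply: filterS n2 => c /= Vc.
      by have [-> _ _] := TE c.
    have [d [Vd Ud]] := kc _ _ nV' (rng_continuous nU).
    by exists (rng d).
  - have nV' : nbhs g (T @^-1` [set d | coc d = coc g]).
      by apply: filterS (near_coc g) => c /= e; have [_ -> _] := TE c.
    by have [d [/= -> <-]] := kc _ _ nV' (near_coc k).
  - apply: (@dr_hausdorff Y) => U V nU nV; rewrite sT in nV.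
    have nV' : nbhs g (T @^-1` [set d | V (src d)]).
      have n1 : nbhs (src g) (h @^-1` V) := hc _ _ nV.
      have n2 : nbhs g (@src X @^-1` (h @^-1` V)) := src_continuous n1.
      apply: filterS n2 => c /= Vc.
      by have [_ _ ->] := TE c.
    have [d [Vd Ud]] := kc _ _ nV' (src_continuous nU).
    by exists (src d).
apply/seteqP; split => [k /uniq//|_ ->].
have [k [_ kc]] := cK (T @ g) FT TK.
by rewrite -(uniq _ kc).
Qed.

End Reconstruction.

Lemma cstar_to_spatial (R : realType) (X Y : DRsystem)
    (h : X -> Y) (hinv : Y -> X) (h_homeo : homeomorphism h hinv)
    (A : cstarAlgebra R) (iX : (DRgroupoid X -> Cplx R) -> A)
    (A_cstar : groupoid_cstar iX)
    (B : cstarAlgebra R) (iY : (DRgroupoid Y -> Cplx R) -> B)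
    (B_cstar : groupoid_cstar iY)
    (gamX : Cplx R -> A -> A) (gamX_gauge : gauge_action iX gamX)
    (gamY : Cplx R -> B -> B) (gamY_gauge : gauge_action iY gamY) (phi : A -> B) :
  [/\ cstar_iso phi,
      phi @` C0_subalgebra iX = C0_subalgebra iY,
      forall f a, C0_elt iX f a -> C0_elt iY (f \o hinv) (phi a)
    & forall z a, `|z| = 1 -> phi (gamX z a) = gamY z (phi a)] ->
  exists Theta : DRgroupoid X -> DRgroupoid Y, spatial_iso h Theta.
Proof.
move=> [iso C0E C0f gE]; have [hK hinvK hc hinvc] := h_homeo.
have hh1 : homeomorphism hinv h by [].
have [psi phiK psiK] := ci_bij iso; have inj := can_inj phiK.
have isoV : cstar_iso psi.
  split.
  - by move=> z a b; apply: inj; rewrite psiK (ci_linear iso) !psiK.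
  - by move=> a b; apply: inj; rewrite psiK (ci_mul iso) !psiK.
  - by move=> a; apply: inj; rewrite psiK (ci_star iso) psiK.
  - by exists phi.
(* The inverse must satisfy the same hypothesis. Equality of the subalgebras gives [b = phi a] with
   [a] coming from some [f0], and evaluating [b] at the units of [Y] identifies [f0] with
   [f \o h]. *)
have C0V f b : C0_elt iY f b -> C0_elt iX (f \o h) (psi b).
  move=> fb; have : C0_subalgebra iY b by exists f.
  rewrite -C0E => -[a [f0 f0a] ab]; rewrite -ab phiK.
  suff -> : f \o h = f0 by [].
  apply/funext => x /=; rewrite -(eval_C0 B_cstar (h x) fb) -ab.
  by rewrite (eval_C0 B_cstar (h x) (C0f _ _ f0a)) /= hK.
have gV z b : `|z| = 1 -> psi (gamY z b) = gamX z (psi b).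
  by move=> z1; apply: inj; rewrite psiK gE// psiK.
have [T [cT TE]] := reconstruct h_homeo A_cstar B_cstar gamX_gauge gamY_gauge iso C0f gE.
have [T' [cT' TE']] := reconstruct hh1 B_cstar A_cstar gamY_gauge gamX_gauge isoV C0V gV.
exists T; split=> //; exists T'; split => //.
- move=> g; have [r k s] := TE g; have [r' k' s'] := TE' (T g).
  by apply: arrow_eq; rewrite ?r' ?k' ?s' ?r ?k ?s ?hK.
- move=> g; have [r k s] := TE' g; have [r' k' s'] := TE (T' g).
  by apply: arrow_eq; rewrite ?r' ?k' ?s' ?r ?k ?s ?hinvK.
Qed.

Theorem theorem8p10 (R : realType) (X Y : DRsystem)
    (h : X -> Y) (hinv : Y -> X) (h_homeo : homeomorphism h hinv)
    (A : cstarAlgebra R) (iX : (DRgroupoid X -> Cplx R) -> A)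
    (A_cstar : groupoid_cstar iX)
    (B : cstarAlgebra R) (iY : (DRgroupoid Y -> Cplx R) -> B)
    (B_cstar : groupoid_cstar iY)
    (gamX : Cplx R -> A -> A) (gamX_gauge : gauge_action iX gamX)
    (gamY : Cplx R -> B -> B) (gamY_gauge : gauge_action iY gamY) :
  let stmt1 := exists (l k : X -> nat) (l' k' : Y -> nat),
      eventual_conjugacy h hinv l k l' k' in
  let stmt2 := exists Theta : DRgroupoid X -> DRgroupoid Y,
      [/\ groupoid_iso Theta,
          forall x, Theta (gunit x) = gunit (h x)
        & forall g, coc g = coc (Theta g)] in
  let stmt3 := exists phi : A -> B,
      [/\ cstar_iso phi,
          phi @` C0_subalgebra iX = C0_subalgebra iY,
          forall f a, C0_elt iX f a -> C0_elt iY (f \o hinv) (phi a)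
        & forall z a, `|z| = 1 -> phi (gamX z a) = gamY z (phi a)] in
  (stmt1 <-> stmt2) /\ (stmt2 <-> stmt3).
Proof.
have spP : (exists Theta : DRgroupoid X -> DRgroupoid Y, spatial_iso h Theta) <->
    exists Theta : DRgroupoid X -> DRgroupoid Y,
      [/\ groupoid_iso Theta, forall x, Theta (gunit x) = gunit (h x)
        & forall g, coc g = coc (Theta g)].
  by split=> -[T /(spatial_isoP h_homeo) spT]; exists T.
move=> stmt1 stmt2 stmt3; split.
  by rewrite /stmt1 (conj_iff_spatial h_homeo); exact: spP.
split=> [/spP[T spT]|[phi phiP]]; first exact: spatial_to_cstar spT.
by apply/spP; exact: cstar_to_spatial phiP.
Qed.
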